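(* Assume $T$ is $\mathrm{NTP}_2$. Let $p(x)$ be a dependent partial type over a set $C$, $\kappa$ a nonzero cardinal, $c\models p$, and $\{I_i\mid i<\kappa\}$ sequences of order type $\omega$, mutually indiscernible over $C$, such that no $I_i$ is indiscernible over $C\cup\{c\}$. Then there exist $C'\supseteq C$ with $C'\setminus C$ finite, $c'\models p$ and a sequence $J_0$ such that: $\{J_0\}\cup\{I_i\mid 0<i<\kappa\}$ is mutually indiscernible over $C'$; $c'\equiv_{C\cup\bigcup\{I_i\mid 0<i<\kappa\}}c$; $J_0$ is not indiscernible over $C'\cup\{c'\}$; and all tuples in $J_0$ realize $p$.
   Context: $T$ is a complete theory with monster $\mathfrak{C}$. $T$ is $\mathrm{NTP}_2$ if there are no formula $\varphi(x,y)$, array $\langle a_{i,j}\mid i,j<\omega\rangle$ and $k<\omega$ with each row $\{\varphi(x,a_{i,j})\mid j<\omega\}$ $k$-inconsistent and every path $\{\varphi(x,a_{i,\eta(i)})\mid i<\omega\}$ ($\eta:\omega\to\omega$) consistent. Sequences $\{I_i\}$ are mutually indiscernible over $B$ if each $I_i$ is indiscernible over $B\cup\bigcup_{j\ne i}I_j$. A partial type $p$ over $C$ is dependent if for some cardinal $\lambda$, for every $a\models p$ and every $\lambda$ sequences mutually indiscernible over $C$, at least one is indiscernible over $C\cup\{a\}$. *)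

(* Defs.v *)
From HB Require Import structures.
From mathcomp Require Import all_boot all_order.
From mathcomp Require Import all_classical.

Set Implicit Arguments.
Unset Strict Implicit.
Unset Printing Implicit Defensive.

Local Open Scope card_scope.
Local Open Scope classical_set_scope.

(** * First-order logic *)

Record language := Language {
  fsym : Type;
  far : fsym -> nat;
  rsym : Type;
  rar : rsym -> nat }.
Arguments far {l} _.
Arguments rar {l} _.

(** The free variables of a [term L V] or a [formula L V] are elements of [V];
    a quantifier binds the variable [None] of [option V]. Thus
    [formula L (X + Y)] is the type of formulas phi(x, y) with x indexed by [X]
    and y indexed by [Y]. *)
Inductive term (L : language) (V : Type) : Type :=
| tvar (v : V)
| tapp (f : fsym L) (t : 'I_(far f) -> term L V).
Arguments tvar {L V} v.
Arguments tapp {L V} f t.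

Inductive formula (L : language) (V : Type) : Type :=
| fbot
| feq (t u : term L V)
| frel (r : rsym L) (t : 'I_(rar r) -> term L V)
| fimp (phi psi : formula L V)
| fall (phi : formula L (option V)).
Arguments fbot {L V}.
Arguments feq {L V} t u.
Arguments frel {L V} r t.
Arguments fimp {L V} phi psi.
Arguments fall {L V} phi.

Definition fnot (L : language) (V : Type) (phi : formula L V) : formula L V :=
  fimp phi fbot.

Record structure (L : language) := Structure {
  carrier :> Type;
  carrier_inhabited : inhabited carrier;
  finterp : forall f : fsym L, ('I_(far f) -> carrier) -> carrier;
  rinterp : forall r : rsym L, ('I_(rar r) -> carrier) -> Prop }.
Arguments finterp {L} s f _.
Arguments rinterp {L} s r _.

Fixpoint teval (L : language) (M : structure L) (V : Type) (e : V -> M)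
    (t : term L V) : M :=
  match t with
  | tvar v => e v
  | tapp f ts => finterp M f (fun i => teval e (ts i))
  end.

Definition env_cons (M V : Type) (e : V -> M) (x : M) : option V -> M :=
  fun o => if o is Some v then e v else x.

Definition env_sum (M X Y : Type) (u : X -> M) (v : Y -> M) : X + Y -> M :=
  fun s => match s with inl x => u x | inr y => v y end.

Fixpoint holds (L : language) (M : structure L) (V : Type) (e : V -> M)
    (phi : formula L V) {struct phi} : Prop :=
  match phi with
  | fbot => False
  | feq t u => teval e t = teval e u
  | frel r ts => rinterp M r (fun i => teval e (ts i))
  | fimp phi psi => holds e phi -> holds e psi
  | fall phi => forall x : M, holds (env_cons e x) phi
  end.

(** ** Theories *)

Definition sentence (L : language) := formula L void.

Definition theory (L : language) := set (sentence L).

Definition is_model (L : language) (T : theory L) (M : structure L) : Prop :=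
  forall s : sentence L, T s -> holds (of_void M) s.

Definition entails (L : language) (T : theory L) (s : sentence L) : Prop :=
  forall M : structure L, is_model T M -> holds (of_void M) s.

Definition complete_theory (L : language) (T : theory L) : Prop :=
  (exists M : structure L, is_model T M) /\
  forall s : sentence L, entails T s \/ entails T (fnot s).

(** ** Types over parameter sets *)

(** Formulas with free variables [X] and parameters in the set [A]. *)
Definition pformula (L : language) (M : structure L) (X : Type) (A : set M) :=
  formula L (X + A).

Definition pholds (L : language) (M : structure L) (X : Type) (A : set M)
    (u : X -> M) (phi : pformula X A) : Prop :=
  holds (env_sum u (@set_val M A)) phi.

Definition realizes (L : language) (M : structure L) (X : Type) (A : set M)
    (u : X -> M) (p : set (pformula X A)) : Prop :=
  forall phi, p phi -> pholds u phi.

Definition finitely_satisfiable (L : language) (M : structure L) (X : Type)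
    (A : set M) (p : set (pformula X A)) : Prop :=
  forall q, finite_set q -> q `<=` p -> exists u : X -> M, realizes u q.

Definition same_type (L : language) (M : structure L) (X : Type) (A : set M)
    (u v : X -> M) : Prop :=
  forall phi : pformula X A, pholds u phi <-> pholds v phi.

(** * Monster models *)

(** Cardinals are represented by types: [small kap A] means |A| < |kap|. *)
Definition small (kap T : Type) (A : set T) : Prop := ~ ([set: kap] #<= A).

Definition uncountable_strong_limit (kap : Type) : Prop :=
  small kap [set: nat] /\
  forall X : Type, small kap [set: X] -> small kap [set: set X].

Definition automorphism (L : language) (M : structure L) (s : M -> M) : Prop :=
  [/\ bijective s,
      forall (f : fsym L) a, s (finterp M f a) = finterp M f (s \o a) &
      forall (r : rsym L) a, rinterp M r a <-> rinterp M r (s \o a)].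

Definition saturated (L : language) (kap : Type) (M : structure L) : Prop :=
  forall (A : set M) (p : set (pformula unit A)),
    small kap A -> finitely_satisfiable p ->
    exists u : unit -> M, realizes u p.

Definition strongly_homogeneous (L : language) (kap : Type) (M : structure L) :
    Prop :=
  forall (X : Type) (u v : X -> M),
    small kap [set: X] -> same_type set0 u v ->
    exists2 s : M -> M, automorphism s & forall x, s (u x) = v x.

(** [kap] bounds the size of the small sets; it is a strong limit cardinal
    larger than |T|, so that the small cardinals are closed under the usual
    cardinal operations. *)
Definition monster (L : language) (T : theory L) (kap : Type)
    (M : structure L) : Prop :=
  [/\ is_model T M,
      uncountable_strong_limit kap,
      small kap [set: fsym L] /\ small kap [set: rsym L],
      saturated kap M &
      strongly_homogeneous kap M].

(** * NTP2 *)

(** Consistency of the family of instances { phi(x, b j) | j in D }. *)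
Definition instances_consistent (L : language) (M : structure L) (X Y : Type)
    (phi : formula L (X + Y)) (J : Type) (b : J -> Y -> M) (D : set J) : Prop :=
  forall D', finite_set D' -> D' `<=` D ->
    exists x : X -> M, forall j, D' j -> holds (env_sum x (b j)) phi.

(** As usual, k-inconsistency is that of the family indexed by [J]: repeated
    instances count as distinct members. *)
Definition k_inconsistent (L : language) (M : structure L) (X Y : Type)
    (phi : formula L (X + Y)) (J : Type) (b : J -> Y -> M) (k : nat) : Prop :=
  forall D : set J, D #= `I_k -> ~ instances_consistent phi b D.

Definition NTP2 (L : language) (M : structure L) : Prop :=
  ~ exists (n m : nat) (phi : formula L ('I_n + 'I_m))
           (a : nat -> nat -> 'I_m -> M) (k : nat),
      (forall i, k_inconsistent phi (a i) k) /\
      (forall eta : nat -> nat,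
         instances_consistent phi (fun i => a i (eta i)) [set: nat]).

(** * Indiscernible sequences *)

(** A sequence of finite tuples, all of the same length [seq_len], indexed by a
    linear order. *)
Record oseq (M : Type) := OSeq {
  seq_disp : Order.disp_t;
  seq_idx : orderType seq_disp;
  seq_len : nat;
  seq_elt :> seq_idx -> 'I_seq_len -> M }.
Arguments OSeq {M seq_disp seq_idx seq_len} seq_elt.

Definition omega_seq (M : Type) (n : nat) (a : nat -> 'I_n -> M) : oseq M :=
  @OSeq M _ nat n a.

Definition infinite_seq (M : Type) (s : oseq M) : Prop :=
  infinite_set [set: seq_idx s].

Definition seq_range (M : Type) (s : oseq M) : set M :=
  [set x | exists t j, x = s t j].

Definition indiscernible (L : language) (M : structure L) (A : set M)
    (s : oseq M) : Prop :=
  forall (k : nat) (i j : 'I_k -> seq_idx s),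
    {homo i : x y / (x < y)%O} -> {homo j : x y / (x < y)%O} ->
    same_type A (fun q : 'I_k * 'I_(seq_len s) => s (i q.1) q.2)
                (fun q : 'I_k * 'I_(seq_len s) => s (j q.1) q.2).

Definition mutually_indiscernible (L : language) (M : structure L) (A : set M)
    (K : Type) (I : K -> oseq M) : Prop :=
  forall i : K,
    indiscernible (A `|` \bigcup_(j in [set j | j <> i]) seq_range (I j)) (I i).

Definition replace_at (K S : Type) (i0 : K) (s : S) (I : K -> S) : K -> S :=
  fun i => if `[< i = i0 >] then s else I i.

(** The cardinal lambda of the definition is required to be small, as are all
    cardinals considered inside a monster model: without this, any [Lam] larger
    than the number of sequences in [M] would do, for trivial reasons. *)
Definition dependent (L : language) (kap : Type) (M : structure L) (C : set M)
    (n : nat) (p : set (pformula 'I_n C)) : Prop :=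
  exists2 Lam : Type, small kap [set: Lam] &
    forall (a : 'I_n -> M) (I : Lam -> oseq M),
      realizes a p ->
      (forall i, infinite_seq (I i)) ->
      mutually_indiscernible C I ->
      exists i, indiscernible (C `|` range a) (I i).

(* Main.v *)
(** Suppose the theorem fails. Then a sequence [J] of realizations of [p] which is
    mutually indiscernible with the [I_i], [i <> i0], over [C] and finitely many
    further parameters stays indiscernible over any [c'] having over [C] and the
    [I_i], [i <> i0], the type of [c]. Fix a definable [Phi] and a block sequence
    [(a_i)] of [I_i0] such that [Phi (c, a_i)] holds for [i = 0] only; such a choice
    exists because dependence of [p] forbids infinite alternation.

    Rows [(e^t_i)_i] of realizations of [p], mutually indiscernible over [C], and
    satisfying [Phi (e^t_i, a_i)] and [~ Phi (e^t_i, a_j)] for [i < j], are built one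
    at a time. Stretch the [I_i], [i <> i0], to consecutive pieces [B_0, B_1, ...],
    take [c_i] which is to [a_i, a_(i+1), ...] and [B_i] what [c] is to
    [a_0, a_1, ...] and the [I_i], and make [(c_i, a_i, e^t_i, B_i)] indiscernible.
    Finite alternation for tuples of realizations of [p] shows that [B_j] is
    mutually indiscernible over the [c_i], [i <> j]. Adding the [c_i] to the
    parameters one by one, the failure of the theorem (applied to [c_i] and [B_i])
    keeps the old rows mutually indiscernible, so that [(c_i)] is a new row.

    A single [a_1] thus breaks arbitrarily many mutually indiscernible rows at
    consecutive terms. By the dual form of finite alternation the instances of
    [~ Phi (e^t_2i, y) /\ Phi (e^t_(2i+1), y)] are [k]-inconsistent for a uniform [k],
    contradicting NTP2. *)

From Stdlib Require List.
Require Import Defs.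
From mathcomp Require wochoice.
From mathcomp Require Import all_boot all_order zify.
From mathcomp Require Import all_classical.

Set Implicit Arguments.
Unset Strict Implicit.
Unset Printing Implicit Defensive.

Local Open Scope card_scope.
Local Open Scope classical_set_scope.

(** * Small cardinals *)

(** The obstacle is that the failure of the theorem handles one copy of [c] at a time, over finitely
    many new parameters, and only for a sequence [J] already mutually indiscernible with the
    matching copy of the other sequences. One copy [B] cannot serve several c_i, as using it for one
    of them destroys control over it. Hence the stretching: each c_i receives its own piece B_i,
    spent when c_i joins the parameters, while B_0, whose c_0 is discarded, is kept as the [B] of
    the next stage. That [Phi] holds at the first block only makes c_i accept a_i and reject every
    later block; copied to all [i], this triangular pattern is what a single a_1 reads as a break
    between terms 0 and 1 of each row. Extractions are indexed by lexicographic orders, which leave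
    spare terms between those in use: a formula violating indiscernibility is repeated on them until
    it alternates infinitely often. The bound [k] must be uniform because NTP2 excludes only arrays
    with one [k] for all rows. *)

Lemma card_leTP (X Y : Type) :
  [set: X] #<= [set: Y] <-> exists f : X -> Y, injective f.
Proof.
split=> [/card_leP[f]|[f fI]].
  exists (fun x => val (f (SigSub (mem_set (I : [set: X] x))))) => x y /val_inj.
  by move=> /(@inj _ _ _ f); rewrite !inE => /(_ I I)/(congr1 val).
apply/card_leP/injfunPex.
exists (fun x : [set: X] => SigSub (mem_set (I : [set: Y] (f (val x))))) => // x y _ _.
by move=> /(congr1 val)/fI/val_inj.
Qed.

(** Zorn's lemma on graphs of partial injections: a maximal graph is total on one side, since
    otherwise a pair of uncovered points could be added. *)
Lemma type_comparability (X Y : Type) :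
  (exists f : X -> Y, injective f) \/ (exists f : Y -> X, injective f).
Proof.
pose P := [set G : set (X * Y) | forall a b, G a -> G b ->
  (a.1 = b.1 <-> a.2 = b.2)].
have [|G [PG Gmax]] := @Zorn_bigcup _ P.
  move=> F FP Ftot a b [G1 FG1 Ga] [G2 FG2 Gb].
  have [G12|G21] := Ftot _ _ FG1 FG2.
    by apply: (FP _ FG2) => //; apply: G12.
  by apply: (FP _ FG1) => //; apply: G21.
have [/choice[f fG]|/existsNP[x xG]] := pselect (forall x, exists y, G (x, y)).
  by left; exists f => x y exy; apply/(PG _ _ (fG x) (fG y)).
have [/choice[f fG]|/existsNP[y yG]] := pselect (forall y, exists x, G (x, y)).
  by right; exists f => u v euv; apply/(PG _ _ (fG u) (fG v)).
exfalso; apply: (Gmax (G `|` [set (x, y)])).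
  split; first by move=> ?; left.
  by move=> /(_ (x, y) (or_intror erefl)) Gxy; apply: xG; exists y.
move=> [a1 a2] [b1 b2] /= [Ga|[-> ->]] [Gb|[-> ->]] //=.
- exact: (PG _ _ Ga Gb).
- by split=> e; [case: xG; exists a2; rewrite -e|case: yG; exists a1; rewrite -e].
- by split=> e; [case: xG; exists b2; rewrite e|case: yG; exists b1; rewrite e].
Qed.

Section Small.
Variable kap : Type.
Hypothesis kapS : uncountable_strong_limit kap.

Definition smallT (X : Type) := small kap [set: X].

Lemma smallTP (X : Type) : smallT X <-> ~ exists f : kap -> X, injective f.
Proof. by split=> h; [move/card_leTP|move/card_leTP/h]. Qed.

Lemma small_inj (X Y : Type) (f : X -> Y) : injective f -> smallT Y -> smallT X.
Proof.
move=> fI /smallTP hY; apply/smallTP => -[g gI].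
by apply: hY; exists (f \o g); exact: inj_comp.
Qed.

Lemma small_surj (X Y : Type) (f : X -> Y) :
  (forall y, exists x, f x = y) -> smallT X -> smallT Y.
Proof.
move=> /choice[g gf]; apply: (@small_inj _ _ g) => x y e.
by rewrite -(gf x) e gf.
Qed.

Lemma small_setP (T : Type) (A : set T) : small kap A <-> smallT A.
Proof.
split=> hA le; apply: hA; apply: card_le_trans le _.
  by apply/card_leP/injfunPex; exists val => // x y _ _ /val_inj.
by apply/card_leP/injfunPex; exists (fun x => SigSub (mem_set (I : [set: A] x))) => // x y _ _ [].
Qed.

Lemma small_set (X : Type) : smallT X -> smallT (set X).
Proof. exact: kapS.2. Qed.

Lemma small_nat : smallT nat. Proof. exact: kapS.1. Qed.

(** Cardinal arithmetic comes from the strong limit property by coding into power sets: the two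
    copies of [x] are {{x}} and {{x}, {}}. *)
Lemma small_double (X : Type) : smallT X -> smallT (X + X)%type.
Proof.
move=> /small_set/small_set; apply: small_inj.
pose f (s : X + X) : set (set X) :=
  match s with inl x => [set [set x]] | inr x => [set [set x]; set0] end.
have s0 (x : X) : [set x] <> set0 by move=> /seteqP[/(_ x erefl)].
have s1 (x y : X) : [set x] = [set y] -> x = y by move=> /seteqP[/(_ x erefl)].
apply: (_ : injective f) => -[x|x] [y|y] /seteqP[/= h1 h2].
- by rewrite (s1 _ _ (h1 [set x] erefl)).
- by have /esym/s0 := h2 set0 (or_intror erefl).
- by have /esym/s0 := h1 set0 (or_intror erefl).
- by have [/s1->|/s0] := h1 [set x] (or_introl erefl).
Qed.

Lemma small_sum (X Y : Type) : smallT X -> smallT Y -> smallT (X + Y)%type.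
Proof.
move=> sX sY; have [[f fI]|[f fI]] := type_comparability X Y.
  apply: small_inj (small_double sY).
  apply: (_ : injective (fun s : X + Y => match s with inl x => inl (f x) | inr y => inr y end)).
  by move=> [x|x] [y|y] //= [] => [/fI->|->].
apply: small_inj (small_double sX).
apply: (_ : injective (fun s : X + Y => match s with inl x => inl x | inr y => inr (f y) end)).
by move=> [x|x] [y|y] //= [] => [->|/fI->].
Qed.

Lemma small_prod (X Y : Type) : smallT X -> smallT Y -> smallT (X * Y)%type.
Proof.
move=> sX sY; apply: small_inj (small_set (small_sum sX sY)).
apply: (_ : injective (fun s : X * Y => [set inl s.1; inr s.2] : set (X + Y))).
move=> [x y] [x' y'] /= /seteqP[h _].
by have [[->]|//] := h _ (or_introl erefl); have [//|[->]] := h _ (or_intror erefl).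
Qed.

Lemma small_count (X : countType) : smallT X.
Proof. exact: small_inj (pcan_inj (@pickleK X)) small_nat. Qed.

Lemma small_sig (X : Type) (P : X -> Prop) : smallT X -> smallT {x | P x}.
Proof.
by apply: (small_inj (f := @proj1_sig _ _)) => -[x px] [y py] /= e; exact: eq_exist.
Qed.

Lemma small_tagged (X : Type) (n : X -> nat) :
  smallT X -> smallT {x : X & 'I_(n x)}.
Proof.
move=> sX; apply: small_inj (small_prod sX small_nat).
apply: (_ : injective (fun s : {x : X & 'I_(n x)} => (projT1 s, nat_of_ord (projT2 s)))).
by move=> [x i] [y j] /= [e]; move: j; rewrite -e => j /val_inj->.
Qed.

End Small.

(** * Renaming and definability *)

Section Renaming.
Variable L : language.

Fixpoint trename (V W : Type) (s : V -> W) (t : term L V) : term L W :=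
  match t with
  | tvar v => tvar (s v)
  | tapp f ts => tapp f (fun i => trename s (ts i))
  end.

Fixpoint frename (V W : Type) (s : V -> W) (phi : formula L V) : formula L W :=
  match phi with
  | fbot => fbot
  | feq t u => feq (trename s t) (trename s u)
  | Defs.frel r ts => Defs.frel r (fun i => trename s (ts i))
  | fimp a b => fimp (frename s a) (frename s b)
  | fall a => fall (frename (omap s) a)
  end.

Lemma trename_comp (U V W : Type) (s : U -> V) (s' : V -> W) (t : term L U) :
  trename s' (trename s t) = trename (s' \o s) t.
Proof. by elim: t => //= f ts IH; congr tapp; apply/funext. Qed.

Lemma frename_comp (U V W : Type) (s : U -> V) (s' : V -> W) (phi : formula L U) :
  frename s' (frename s phi) = frename (s' \o s) phi.
Proof.
elim: phi V W s s' => //=.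
- by move=> X t u V W s s'; rewrite !trename_comp.
- by move=> X r ts V W s s'; congr Defs.frel; apply/funext => i; exact: trename_comp.
- by move=> X a IHa b IHb V W s s'; rewrite IHa IHb.
- by move=> X a IH V W s s'; rewrite IH; congr (fall (frename _ _)); apply/funext; case.
Qed.

Variable M : structure L.

Lemma teval_rename (V W : Type) (s : V -> W) (e : W -> M) (t : term L V) :
  teval e (trename s t) = teval (e \o s) t.
Proof. by elim: t => //= f ts IH; congr finterp; apply/funext. Qed.

Lemma holds_rename (V W : Type) (s : V -> W) (e : W -> M) (phi : formula L V) :
  holds e (frename s phi) <-> holds (e \o s) phi.
Proof.
elim: phi W s e => //=.
- by move=> X t u W s e; rewrite !teval_rename.
- move=> X r ts W s e; rewrite (_ : (fun i => _) = (fun i => teval (e \o s) (ts i)))//.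
  by apply/funext => i; rewrite teval_rename.
- by move=> X a IHa b IHb W s e; rewrite IHa IHb.
- move=> X a IH W s e.
  have E x : env_cons e x \o omap s = env_cons (e \o s) x by apply/funext; case.
  by split=> h x; move: (h x); rewrite IH E.
Qed.

(** Splits off the finitely many left-hand values and leaves the right-hand ones in place; this
    separates free from bound variables, and later variables from parameters. *)
Lemma factor_sum (F : finType) (A B : Type) (f : F -> A + B) :
  exists (F1 : finType) (f1 : F1 -> A) (g : F -> F1 + B),
    f = (fun s => match s with inl x => inl (f1 x) | inr b => inr b end) \o g.
Proof.
pose p x := if f x is inl _ then true else false.
have f1 (x : {x | p x}) : {a | f (val x) = inl a}.
  by case: x => x /=; rewrite /p; case: (f x) => // a _; exists a.
have g x : {y : {x | p x} + B | f x = match y with inl z => f (val z) | inr b => inr b end}.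
  case e: (f x) => [a|b]; last by exists (inr b).
  have px : p x by rewrite /p e.
  by exists (inl (exist _ x px)).
exists {x | p x}, (fun x => sval (f1 x)), (fun x => sval (g x)).
apply/funext => x /=; case: (g x) => -[z|b] //= ->; exact: (svalP (f1 z)).
Qed.

Lemma term_factor (V : Type) (t : term L V) :
  exists (F : finType) (f : F -> V) t', t = trename f t'.
Proof.
elim: t => [v|f ts IH]; first by exists unit, (fun=> v), (tvar tt).
have {}IH i : {z : {F : finType & ((F -> V) * term L F)%type} |
    ts i = trename (projT2 z).1 (projT2 z).2}.
  by apply/cid; have [F [g [t' e]]] := IH i; exists (existT _ F (g, t')).
pose F i : finType := projT1 (sval (IH i)).
exists {i : 'I_(far f) & F i}, (fun x => (projT2 (sval (IH (tag x)))).1 (tagged x)).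
exists (tapp f (fun i => trename (fun x => Tagged F x) (projT2 (sval (IH i))).2)).
by rewrite /=; congr tapp; apply/funext => i; rewrite trename_comp; exact: svalP (IH i).
Qed.

Lemma formula_factor (V : Type) (phi : formula L V) :
  exists (F : finType) (f : F -> V) phi', phi = frename f phi'.
Proof.
elim: phi => {}V.
- by exists void, (of_void V), fbot.
- move=> t u; have [F [f [t' ->]]] := term_factor t.
  have [G [g [u' ->]]] := term_factor u.
  exists (F + G)%type, (fun s => match s with inl x => f x | inr y => g y end).
  by exists (feq (trename inl t') (trename inr u')); rewrite /= !trename_comp.
- move=> r ts; have IH i : {z : {F : finType & ((F -> V) * term L F)%type} |
      ts i = trename (projT2 z).1 (projT2 z).2}.
    by apply/cid; have [F [g [t' e]]] := term_factor (ts i); exists (existT _ F (g, t')).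
  pose F i : finType := projT1 (sval (IH i)).
  exists {i : 'I_(rar r) & F i}, (fun x => (projT2 (sval (IH (tag x)))).1 (tagged x)).
  exists (Defs.frel r (fun i => trename (fun x => Tagged F x) (projT2 (sval (IH i))).2)).
  by rewrite /=; congr Defs.frel; apply/funext => i; rewrite trename_comp; exact: svalP (IH i).
- move=> a [F [f [a' ->]]] b [G [g [b' ->]]].
  exists (F + G)%type, (fun s => match s with inl x => f x | inr y => g y end).
  by exists (fimp (frename inl a') (frename inr b')); rewrite /= !frename_comp.
- move=> a [F [f [a' ->]]].
  (* The bound variable [None] goes to the right summand, which [factor_sum] keeps fixed. *)
  have [F1 [f1 [g e]]] := factor_sum (fun x => if f x is Some v then inl v else inr tt).
  exists F1, f1, (fall (frename (fun x => if g x is inl y then Some y else None) a')).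
  rewrite /= frename_comp; congr (fall (frename _ _)); apply/funext => x /=.
  by have := congr1 (fun h => h x) e; rewrite /=; case: (f x) (g x) => [v|] [y|[]] //= [->].
Qed.

(** Indices with the same value are merged through chosen representatives. Injectivity later allows
    values given on ['I_m] to be read as values on variables. *)
Lemma injective_factor (F : finType) (X : Type) (f : F -> X) :
  exists m (f' : 'I_m -> X) (g : F -> 'I_m), injective f' /\ f = f' \o g.
Proof.
pose rep x : F := odflt x [pick y | `[< f y = f x >]].
have repE x y : f x = f y -> rep x = rep y.
  move=> e; rewrite /rep (eq_pick (Q := fun z => `[< f z = f y >])) => [|z]; last by rewrite e.
  by case: pickP => //= /(_ x); rewrite e asboolT.
have frep x : f (rep x) = f x by rewrite /rep; case: pickP => //= y /asboolP.
pose P := [set x | rep x == x]%SET.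
have repP x : rep x \in P by rewrite inE; apply/eqP/repE.
have [x0 _|F0] := pickP (@predT F); last first.
  have F0' (x : F) : False by have := F0 x.
  have I0 (i : 'I_0) : False by case: i.
  exists 0, (fun i => False_rect _ (I0 i)), (fun x => False_rect _ (F0' x)).
  by split=> [i|]; [case: (I0 i)|apply/funext => x; case: (F0' x)].
exists #|P|, (f \o enum_val), (fun x => enum_rank_in (repP x0) (rep x)).
split; last by apply/funext => x /=; rewrite enum_rankK_in // frep.
move=> i j /= e; apply: enum_val_inj.
have := enum_valP i; rewrite inE => /eqP <-; rewrite (repE _ _ e).
by have := enum_valP j; rewrite inE => /eqP.
Qed.

Lemma holds_ex (m : nat) (V : Type) (phi : formula L (V + 'I_m)) :
  exists psi : formula L V, forall e : V -> M,
    holds e psi <-> exists v : 'I_m -> M, holds (env_sum e v) phi.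
Proof.
elim: m V phi => [|m IH] V phi.
  have h (s : V + 'I_0) : {v | s = inl v} by case: s => [v|[]//]; exists v.
  exists (frename (fun s => sval (h s)) phi) => e; rewrite holds_rename.
  have E (v : 'I_0 -> M) : e \o (fun s => sval (h s)) = env_sum e v.
    by apply/funext => s /=; case: (h s) => /= x ->.
  split=> [H|[v]]; last by rewrite -E.
  have I0 (i : 'I_0) : False by case: i.
  by exists (fun i => False_rect _ (I0 i)); rewrite -E.
pose s (x : V + 'I_m.+1) : option V + 'I_m := match x with
  | inl v => inl (Some v)
  | inr i => if unlift ord0 i is Some j then inr j else inl None end.
have [psi hpsi] := IH _ (frename s phi).
exists (fnot (fall (fnot psi))) => e /=; split.
  move=> H; apply: contrapT => H1; apply: H => x; rewrite hpsi => -[v].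
  rewrite holds_rename => H; apply: H1.
  exists (fun i => if unlift ord0 i is Some j then v j else x).
  rewrite (_ : env_sum _ _ = env_sum (env_cons e x) v \o s)//.
  by apply/funext => -[y|i] //=; case: unlift.
move=> [v hv] /(_ (v ord0)); apply; rewrite hpsi.
exists (v \o lift ord0); rewrite holds_rename.
rewrite (_ : _ \o s = env_sum e v)//.
by apply/funext => -[y|i] //=; case: unliftP => [j|] ->.
Qed.

End Renaming.

Lemma finite_set_list (T : Type) (A : set T) :
  finite_set A -> exists s : list T, forall x, A x -> List.In x s.
Proof.
move: A; elim/Peq: T => T A /finite_seqP[s ->]; exists s => x /=.
by elim: s => //= y s IH; rewrite inE => /orP[/eqP->|/IH]; [left|right].
Qed.

(** * Definable sets of assignments and equality of types *)

Section Definability.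
Variables (L : language) (M : structure L) (C : set M).

Definition Def (X : Type) (S : set (X -> M)) : Prop :=
  exists phi : pformula X C, forall u, pholds u phi <-> S u.

(** An implication gives equality of types, definable sets being closed under complement. *)
Definition tpeq (X : Type) (u v : X -> M) : Prop := forall S, Def S -> S u -> S v.

Lemma env_sum_comp (X Y Z W N : Type) (u : Y -> N) (v : W -> N) (s : X -> Y) (t : Z -> W) :
  env_sum (u \o s) (v \o t) =
  env_sum u v \o (fun x => match x with inl a => inl (s a) | inr b => inr (t b) end).
Proof. by apply/funext; case. Qed.

Lemma Def_ext (X : Type) (S S' : set (X -> M)) :
  (forall u, S u <-> S' u) -> Def S -> Def S'.
Proof. by move=> h [phi hphi]; exists phi => u; rewrite hphi. Qed.

Lemma Def_pholds (X : Type) (phi : pformula X C) : Def (fun u => pholds u phi).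
Proof. by exists phi. Qed.

Lemma Def_rename (X Y : Type) (s : X -> Y) (S : set (X -> M)) :
  Def S -> Def (fun u : Y -> M => S (u \o s)).
Proof.
move=> [phi hphi].
exists (frename (fun x => match x with inl a => inl (s a) | inr c => inr c end) phi) => u.
by rewrite -hphi /pholds holds_rename -env_sum_comp.
Qed.

Lemma Def_const (X : Type) (P : Prop) : Def (fun _ : X -> M => P).
Proof.
have [p|np] := pselect P; last by exists fbot => u; split=> // /np.
by exists (fimp fbot fbot) => u; split=> // _ H; exact: H.
Qed.

Lemma Def_imp (X : Type) (S S' : set (X -> M)) :
  Def S -> Def S' -> Def (fun u => S u -> S' u).
Proof.
move=> [phi hphi] [psi hpsi]; exists (fimp phi psi) => u.
by rewrite -hphi -hpsi.
Qed.

Lemma Def_not (X : Type) (S : set (X -> M)) : Def S -> Def (fun u => ~ S u).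
Proof. by move=> h; apply: Def_imp => //; exact: Def_const. Qed.

Lemma Def_and (X : Type) (S S' : set (X -> M)) :
  Def S -> Def S' -> Def (fun u => S u /\ S' u).
Proof.
move=> h h'; apply: Def_ext (Def_not (Def_imp h (Def_not h'))) => u.
by split=> [H|[a b] /(_ a b) //]; split; apply: contrapT => H'; apply: H.
Qed.

Lemma Def_all (X A : Type) (S : A -> set (X -> M)) (l : list A) :
  (forall a, List.In a l -> Def (S a)) ->
  Def (fun u => forall a, List.In a l -> S a u).
Proof.
elim: l => [|a l IH] h; first by apply: Def_ext (Def_const _ True).
have h1 : Def (S a) by apply: h; left.
have h2 : Def (fun u => forall a, List.In a l -> S a u).
  by apply: IH => b hb; apply: h; right.
apply: Def_ext (Def_and h1 h2) => u; split=> [[ha hl] b [<-//|]|H]; first exact: hl.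
by split=> [|b hb]; apply: H; [left|right].
Qed.

Lemma Def_eq (X : Type) (x y : X) : Def (fun u : X -> M => u x = u y).
Proof. by exists (feq (tvar (inl x)) (tvar (inl y))). Qed.

Lemma Def_factor (X : Type) (S : set (X -> M)) : Def S ->
  exists m (f : 'I_m -> X) (S' : set ('I_m -> M)),
    [/\ injective f, Def S' & forall u, S u <-> S' (u \o f)].
Proof.
move=> [phi hphi]; have [F [f [phi' e]]] := formula_factor phi.
have [F1 [f1 [g ef]]] := factor_sum f.
have [m [f2 [g2 [f2I ef2]]]] := injective_factor f1.
exists m, f2, (fun v : 'I_m -> M =>
  pholds v (frename (fun x => match g x with inl y => inl (g2 y) | inr c => inr c end) phi')).
split=> // [|u]; first exact: Def_pholds.
rewrite -hphi e /pholds !holds_rename ef ef2.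
rewrite (_ : _ \o _ = env_sum (u \o f2) set_val \o
  (fun x => match g x with inl y => inl (g2 y) | inr c => inr c end))//.
by apply/funext => x /=; case: (g x).
Qed.

Let pt : M := projT1 (cid (let: inhabits x := carrier_inhabited M in ex_intro (fun=> True) x I)).

(** [X] may be infinite: quantifiers are needed only for the finitely many coordinates occurring in
    [S], and the others take the default value [pt]. *)
Lemma Def_ex (X Y : Type) (S : set (X + Y -> M)) : Def S ->
  Def (fun u => exists v, S (env_sum v u)).
Proof.
move=> /Def_factor[m [f [S' [fI [phi hphi] hS]]]].
pose s (x : 'I_m + C) : (Y + C) + 'I_m := match x with
  | inl i => match f i with inl _ => inr i | inr y => inl (inl y) end
  | inr c => inl (inr c) end.
have [psi hpsi] := holds_ex M (frename s phi).
exists psi => u; rewrite /pholds hpsi; split=> -[v].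
  rewrite holds_rename => hv.
  pose w x := if pselect (exists i, f i = inl x) is left h then v (sval (cid h)) else pt.
  exists w; rewrite hS -hphi /pholds (_ : env_sum _ _ = env_sum (env_sum u set_val) v \o s)//.
  apply/funext => -[i|c] //=; case e: (f i) => [x|y] //=.
  rewrite /w; case: pselect => [h|[]]; last by exists i.
  by case: (cid h) => /= j; rewrite -e => /fI->.
rewrite hS -hphi => hv.
exists (env_sum v u \o f); rewrite holds_rename.
move: hv; rewrite /pholds (_ : env_sum _ _ = env_sum (env_sum u set_val) (env_sum v u \o f) \o
  s)//.
by apply/funext => -[i|c] //=; case e: (f i) => [x|y] //=; rewrite e.
Qed.

Lemma tpeq_trans (X : Type) (v u w : X -> M) : tpeq u v -> tpeq v w -> tpeq u w.
Proof. by move=> uv vw S dS /uv-/(_ dS)/vw; exact. Qed.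

Lemma tpeq_sym (X : Type) (u v : X -> M) : tpeq u v -> tpeq v u.
Proof.
move=> uv S dS Sv; apply: contrapT => nSu.
exact: (uv _ (Def_not dS) nSu).
Qed.

Lemma tpeqE (X : Type) (u v : X -> M) (S : set (X -> M)) :
  tpeq u v -> Def S -> S u <-> S v.
Proof. by move=> uv dS; split; [exact: uv|exact: (tpeq_sym uv)]. Qed.

Lemma tpeq_comp (X Y : Type) (s : Y -> X) (u v : X -> M) :
  tpeq u v -> tpeq (u \o s) (v \o s).
Proof. by move=> uv S /Def_rename dS; exact: uv (dS _ s). Qed.

Lemma tpeq_fin (X : Type) (u v : X -> M) :
  (forall m (f : 'I_m -> X), tpeq (u \o f) (v \o f)) -> tpeq u v.
Proof.
move=> h S /Def_factor[m [f [S' [_ dS' hS]]]].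
by rewrite !hS; exact: h.
Qed.

End Definability.

(** * Compactness in small sets of variables, from saturation *)

Section Compactness.
Variables (L : language) (kap : Type) (M : structure L) (C : set M).
Hypothesis kapS : uncountable_strong_limit kap.
Hypothesis M_sat : saturated kap M.
Hypothesis C_small : small kap C.

Let pt : M := projT1 (cid (let: inhabits x := carrier_inhabited M in ex_intro (fun=> True) x I)).

(** Saturation speaks of one variable. That variable is the coordinate [x]; coordinates in [D]
    become parameters, and the finitely many others occurring in [S] are quantified away. The
    resulting formulas are finitely satisfiable because [F] is directed. *)
Lemma one_point_extension (Z : Type) (F : set (set (Z -> M))) (D : set Z) (e : Z -> M) (x : Z) :
  smallT kap Z ->
  (exists S, F S) -> (forall S, F S -> Def C S) ->
  (forall S1 S2, F S1 -> F S2 -> exists2 S3, F S3 & S3 `<=` S1 `&` S2) ->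
  (forall S, F S -> exists2 u, {in D, u =1 e} & S u) ->
  ~ D x ->
  exists y, forall S, F S -> exists u, [/\ {in D, u =1 e}, u x = y & S u].
Proof.
move=> sZ F0 FDef Fdir Fsat nDx.
pose A : set M := C `|` e @` D.
pose TS (S : set (Z -> M)) y := exists u, [/\ {in D, u =1 e}, u x = y & S u].
have sA : small kap A.
  apply/small_setP; have /small_setP sC := C_small.
  have sD : smallT kap D by exact: small_inj val_inj sZ.
  pose g (s : C + D) : A := match s with
    | inl c => SigSub (mem_set (or_introl (set_mem (valP c))) : val c \in A)
    | inr z => SigSub (mem_set (or_intror (ex_intro2 _ _ (val z) (set_mem (valP z)) erefl)) : e
      (val z) \in A)
    end.
  apply: (small_surj (f := g)) (small_sum kapS sC sD) => -[y hy].
  have [Cy|[z Dz ez]] := set_mem hy.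
    by exists (inl (SigSub (mem_set Cy))); apply: val_inj.
  by exists (inr (SigSub (mem_set Dz))); apply: val_inj.
have ex_psi S : F S -> exists psi : pformula unit A, forall u, pholds u psi <-> TS S (u tt).
  move=> /FDef/Def_factor[m [f [S' [fI [phi hphi] hS]]]].
  have De z : D z -> e z \in A by move=> Dz; apply: mem_set; right; exists z.
  have Ce (c : C) : val c \in A by apply: mem_set; left; exact: set_mem (valP c).
  pose s (a : 'I_m + C) : (unit + A) + 'I_m := match a with
    | inl i => if pselect (D (f i)) is left h then inl (inr (SigSub (De _ h)))
               else if pselect (f i = x) then inl (inl tt) else inr i
    | inr c => inl (inr (SigSub (Ce c))) end.
  have [psi hpsi] := holds_ex M (frename s phi).
  exists psi => u; rewrite /pholds hpsi; split=> [[v]|[w [wD wx Sw]]].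
    rewrite holds_rename => hv.
    pose w z := if pselect (D z) then e z else if pselect (z = x) then u tt else
      if pselect (exists i, f i = z) is left h then v (sval (cid h)) else pt.
    exists w; split.
    - by move=> z /set_mem Dz; rewrite /w; case: pselect.
    - by rewrite /w; case: pselect => //= ?; case: pselect.
    rewrite hS -hphi /pholds (_ : env_sum _ _ = env_sum (env_sum u set_val) v \o s)//.
    apply/funext => -[i|c] //=; rewrite /w; case: pselect => //= nD.
    case: pselect => //= nx; case: pselect => [h|[]]; last by exists i.
    by case: (cid h) => /= j /fI->.
  exists (w \o f); rewrite holds_rename.
  move: Sw; rewrite hS -hphi /pholds (_ : env_sum _ _ = env_sum (env_sum u set_val) (w \o f) \o
    s)//.
  apply/funext => -[i|c] //=; case: pselect => //= [Df|nD]; first by apply: wD; exact: mem_set.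
  by case: pselect => //= ->.
pose p : set (pformula unit A) := [set psi | exists2 S, F S &
  forall u, pholds u psi <-> TS S (u tt)].
have [q qfin qp|u hu] := M_sat sA (p := p).
  have [S0 FS0 hS0] : exists2 S, F S & forall psi, q psi -> forall u, TS S (u tt) -> pholds u psi.
    have [s qs] : exists s : list (pformula unit A), forall psi, q psi -> List.In psi s.
      exact: finite_set_list.
    elim: s q {qfin} qp qs => [|psi s IH] q qp qs.
      by have [S FS] := F0; exists S => // psi /qs.
    have [||S FS hS] := IH [set psi' | q psi' /\ List.In psi' s].
    - by move=> psi' [/qp].
    - by move=> psi' [].
    have [/qp[S1 FS1 hS1]|nq] := pselect (q psi); last first.
      exists S => // psi' qpsi'; apply: hS; split=> //.
      by case: (qs _ qpsi') => // epsi; case: nq; rewrite epsi.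
    have [S3 FS3 S13] := Fdir _ _ FS1 FS.
    exists S3 => // psi' qpsi' u [w [wD wx /S13[w1 w2]]].
    case: (qs _ qpsi') => [<-|hin]; first by apply/hS1; exists w.
    by apply: hS => //; exists w.
  have [w wD Sw] := Fsat _ FS0.
  by exists (fun=> w x) => psi qpsi; apply: hS0 => //; exists w.
exists (u tt) => S FS; have [psi hpsi] := ex_psi S FS.
by apply/hpsi; apply: hu; exists S.
Qed.

(** Zorn's lemma on partial assignments that still extend into each member of [F]; by
    [one_point_extension] a maximal one is total. *)
Lemma compactness_directed (Z : Type) (F : set (set (Z -> M))) (D0 : set Z) (e0 : Z -> M) :
  smallT kap Z ->
  (exists S, F S) -> (forall S, F S -> Def C S) ->
  (forall S1 S2, F S1 -> F S2 -> exists2 S3, F S3 & S3 `<=` S1 `&` S2) ->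
  (forall S, F S -> exists2 u, {in D0, u =1 e0} & S u) ->
  exists2 u, {in D0, u =1 e0} & forall S, F S -> S u.
Proof.
move=> sZ F0 FDef Fdir Fsat.
pose good (z : set Z * (Z -> M)) := [/\ D0 `<=` z.1, {in D0, z.2 =1 e0} &
  forall S, F S -> exists2 u, {in z.1, u =1 z.2} & S u].
pose T := {z | good z}.
pose R (a b : T) := `[< (sval a).1 `<=` (sval b).1 /\ {in (sval a).1, (sval b).2 =1 (sval a).2}
  >].
have t0 : T by exists (D0, e0); split.
have [| |A Atot|[[D e] gDe] maxDe] := ZL_preorder t0 (R := R).
- by move=> a; apply/asboolP; split.
- move=> a b c /asboolP[ab eab] /asboolP[bc ebc]; apply/asboolP; split; first exact:
  subset_trans bc.
  by move=> z /set_mem az; rewrite ebc ?eab //; apply: mem_set => //; exact: ab.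
- have [[a0 Aa0]|A0] := pselect (exists a, A a); last by exists t0 => s As; case: A0; exists s.
  pose D := [set z | exists2 a, A a & (sval a).1 z].
  pose e z := if pselect (D z) is left h then (sval (s2val (cid2 h))).2 z else pt.
  have eD a z : A a -> (sval a).1 z -> e z = (sval a).2 z.
    move=> Aa az; rewrite /e; case: pselect => [h|[]]; last by exists a.
    case: (cid2 h) => /= b Ab bz.
    by have [/asboolP[_ E]|/asboolP[_ E]] := Atot _ _ Aa Ab; [|symmetry]; apply: E; exact:
      mem_set.
  have g : good (D, e).
    split=> /=.
    - by move=> z D0z; exists a0 => //; case: (svalP a0) => + _ _; exact.
    - move=> z /[dup] D0z' /set_mem D0z; case: (svalP a0) => h1 h2 _.
      by rewrite (eD a0) //; [exact: h2|exact: h1].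
    - move=> S /[dup] FS /FDef/Def_factor[m [f [S' [fI dS' hS]]]].
      (* [S] sees finitely many coordinates, so one member of the chain already assigns all of them
         that lie in [D]. *)
      have [a Aa ha] : exists2 a, A a & forall i, i \in enum 'I_m -> D (f i) -> (sval a).1 (f i).
        elim: (enum 'I_m) => [|i s [a Aa ha]]; first by exists a0.
        have [[b Ab bi]|nD] := pselect (D (f i)); last first.
          by exists a => // j; rewrite inE => /orP[/eqP->//|/ha].
        have [/asboolP[ab _]|/asboolP[ba _]] := Atot _ _ Aa Ab.
          by exists b => // j; rewrite inE => /orP[/eqP->//|/ha h /h/ab].
        by exists a => // j; rewrite inE => /orP[/eqP-> _|/ha //]; exact: ba.
      case: (svalP a) => _ _ /(_ S FS)[u ua Su].
      exists (fun z => if pselect (D z) then e z else u z).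
        by move=> z /set_mem Dz /=; case: pselect.
      rewrite hS (_ : _ \o f = u \o f); first by rewrite -hS.
      apply/funext => i /=; case: pselect => // Di.
      have ai : (sval a).1 (f i) by apply: ha => //; rewrite mem_enum.
      by rewrite (eD a) // ua //; exact: mem_set.
  exists (exist _ _ g) => a Aa; apply/asboolP; split=> /= [z az|z /set_mem az].
    by exists a.
  exact: eD.
have [/= h1 h2 h3] := gDe.
have DT z : D z.
  apply: contrapT => nDz.
  have [y hy] := one_point_extension sZ F0 FDef Fdir h3 nDz.
  pose e' x := if pselect (x = z) then y else e x.
  have e'D : {in D, e' =1 e}.
    by move=> x /set_mem Dx; rewrite /e'; case: pselect => // xz; rewrite xz in Dx.
  have g : good (D `|` [set z], e').
    split=> /= [x /h1|x /[dup] /set_mem/h1 Dx D0x|S /hy[u [uD ux Su]]]; first by left.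
      by rewrite e'D ?h2 //; exact: mem_set.
    exists u => // x /set_mem[Dx|->]; first by rewrite e'D ?uD//; exact: mem_set.
    by rewrite /e'; case: pselect.
  have /asboolP[/= h _] := maxDe (exist _ _ g) (introT (asboolP _) (conj (fun x Dx => or_introl
    Dx) e'D)).
  by apply: nDz; apply: h; right.
exists e => // S /h3[u ue Su]; rewrite (_ : e = u)//.
by apply/funext => z; rewrite ue //; exact: mem_set.
Qed.

Lemma compactness (X Y A : Type) (u : Y -> M) (S : A -> set (X + Y -> M)) :
  smallT kap X -> smallT kap Y -> (forall a, Def C (S a)) ->
  (forall l : list A, exists v, forall a, List.In a l -> S a (env_sum v u)) ->
  exists v, forall a, S a (env_sum v u).
Proof.
move=> sX sY dS hfin.
pose F : set (set (X + Y -> M)) := [set S' | exists l : list A, S' = (fun w => forall a, List.In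
  a l -> S a w)].
have [|||||w wY wF] := @compactness_directed _ F (range inr) (env_sum (fun=> pt) u).
- exact: small_sum.
- by exists (fun=> True), [::]; apply/funext => w; apply/propext.
- by move=> _ [l ->]; apply: Def_all.
- move=> _ _ [l ->] [l' ->]; exists (fun w => forall a, List.In a (l ++ l') -> S a w).
    by exists (l ++ l').
  by move=> w h; split=> a ha; apply: h; apply/List.in_or_app; [left|right].
- move=> _ [l ->]; have [v hv] := hfin l; exists (env_sum v u) => //.
  by move=> z /set_mem[y _ <-].
exists (w \o inl) => a; rewrite (_ : env_sum _ _ = w).
  by apply: (wF (fun w => forall b, List.In b [:: a] -> S b w)); [exists [:: a]|left].
apply/funext => -[x|y] //=; rewrite wY //; apply: mem_set; by exists y.
Qed.

(** The type of [v] over [u], transported to [u'], is finitely satisfiable because projections of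
    definable sets are definable. *)
Lemma tpeq_extend (X Y : Type) (v : X -> M) (u u' : Y -> M) :
  smallT kap X -> smallT kap Y -> tpeq C u u' ->
  exists v', tpeq C (env_sum v u) (env_sum v' u').
Proof.
move=> sX sY uu'.
pose A := {S : set (X + Y -> M) | Def C S /\ S (env_sum v u)}.
have [||[S []]//|l|v' hv'] := @compactness X Y A u' (fun S => sval S) => //.
  have dS : Def C (fun w => forall a : A, List.In a l -> sval a w).
    by apply: Def_all => -[S []].
  have := uu' _ (Def_ex dS); apply; exists v => -[S []] //.
by exists v' => S dS Su; exact: (hv' (exist _ S (conj dS Su))).
Qed.

End Compactness.

(** * Linear orders and Ramsey's theorem *)

Record chain := Chain {
  csort :> Type;
  clt : rel csort;
  clt_irr : irreflexive clt;
  clt_trans : transitive clt;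
  clt_total : forall x y, [\/ x = y, clt x y | clt y x] }.
Arguments clt {c}.

Lemma clt_asym (O : chain) (x y : O) : clt x y -> clt y x = false.
Proof. by move=> xy; apply/negP => /(clt_trans xy); rewrite clt_irr. Qed.

Definition nat_chain : chain.
Proof.
refine (@Chain nat ltn ltnn ltn_trans _) => x y.
by case: (ltngtP x y) => h; [constructor 2|constructor 3|constructor 1].
Defined.

(** A chain has no boolean equality; once the first disjunct fails, [~~ clt y.1 x.1] says by
    totality that the first components agree. *)
Definition lexi (A B : chain) : rel (A * B) :=
  fun x y => clt x.1 y.1 || (~~ clt y.1 x.1 && clt x.2 y.2).

Definition lex_chain (A B : chain) : chain.
Proof.
refine (@Chain (A * B)%type (@lexi A B) _ _ _).
- by move=> x; rewrite /lexi !clt_irr.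
- move=> [y1 y2] [x1 x2] [z1 z2]; rewrite /lexi /= => /orP[h1|/andP[h1 h2]] /orP[h3|/andP[h3 h4]].
  + by rewrite (clt_trans h1 h3).
  + have [<-|h|h] := clt_total y1 z1; [by rewrite h1|by rewrite (clt_trans h1 h)|by rewrite h in
    h3].
  + have [<-|h|h] := clt_total y1 x1; [by rewrite h3|by rewrite h in h1|by rewrite (clt_trans h
    h3)].
  + rewrite (clt_trans h2 h4) andbT.
    by have [->|->|h] := clt_total x1 z1; rewrite ?clt_irr ?orbT // h;
      have [e|h'|h'] := clt_total x1 y1; [rewrite -e h in h3|rewrite (clt_trans h h') in
        h3|rewrite h' in h1].
- move=> [x1 x2] [y1 y2]; rewrite /lexi /=.
  have [->|->|->] := clt_total x1 y1; rewrite ?orbT ?clt_irr /=; [|by constructor 2|by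
    constructor 3].
  by have [->|->|->] := clt_total x2 y2; [constructor 1|constructor 2|constructor 3].
Defined.

(** The strict part of a well-ordering; minima of sets with two or three elements give totality,
    antisymmetry and transitivity. *)
Lemma linear_order_exists (T : Type) : exists lt : rel T,
  [/\ irreflexive lt, transitive lt & forall x y, [\/ x = y, lt x y | lt y x]].
Proof.
elim/Peq: T => T; have [R Rwo] := wochoice.well_ordering_principle T.
have minR (s : seq T) x : x \in s -> exists2 z, z \in s & {in s, forall y, R z y}.
  move=> xs; have [|z [[zs hz] _]] := Rwo (mem s); first by exists x.
  by exists z.
have Rtot x y : R x y || R y x.
  have [z] := minR [:: x; y] x (mem_head _ _).
  by rewrite !inE => /orP[] /eqP-> h; rewrite h ?orbT // !inE eqxx ?orbT.
have Ranti x y : R x y -> R y x -> x = y.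
  move=> xy yx; have [|z [_ uz]] := Rwo (mem [:: x; y]); first by exists x; exact: mem_head.
  have R1 u : R u u by have := Rtot u u; rewrite orbb.
  have hx : wochoice.minimum_of R (mem [:: x; y]) x.
    by split=> [|u]; rewrite !inE ?eqxx // => /orP[] /eqP->.
  have hy : wochoice.minimum_of R (mem [:: x; y]) y.
    by split=> [|u]; rewrite !inE ?eqxx ?orbT // => /orP[] /eqP->.
  by rewrite -(uz _ hx) -(uz _ hy).
exists (fun x y => (x != y) && R x y); split.
- by move=> x; rewrite eqxx.
- move=> y x z /andP[xy Rxy] /andP[yz Ryz].
  have [w] := minR [:: x; y; z] x (mem_head _ _).
  have xz : x != z by apply: contraNneq xy => e; apply/eqP/Ranti => //; rewrite e.
  rewrite !inE xz => /or3P[] /eqP-> h.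
  + by apply: h; rewrite !inE eqxx !orbT.
  + by rewrite (Ranti x y) ?eqxx // in xy; apply: h; rewrite !inE eqxx.
  + by rewrite (Ranti y z) ?eqxx // in yz; apply: h; rewrite !inE eqxx orbT.
- move=> x y; have [->|xy] := eqVneq x y; first by constructor 1.
  rewrite /=.
  by case/orP: (Rtot x y) => ->; [constructor 2|constructor 3].
Qed.

(** By totality, equalities between entries are preserved as well. *)
Definition pateq (A : Type) (O O' : chain) (o : A -> O) (o' : A -> O') : Prop :=
  forall a b, clt (o a) (o b) = clt (o' a) (o' b).

Lemma pateq_eq (A : Type) (O O' : chain) (o : A -> O) (o' : A -> O') (a b : A) :
  pateq o o' -> o a = o b -> o' a = o' b.
Proof.
move=> h e; have := h a b; have := h b a; rewrite e !clt_irr.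
by have [->|->|->] := clt_total (o' a) (o' b).
Qed.

Definition crank (O : chain) (s : list O) (x : O) : nat := count (fun y => clt y x) s.

Lemma crank_lt (O : chain) (s : list O) (x y : O) :
  List.In x s -> clt x y = (crank s x < crank s y).
Proof.
move=> xs; have le (u v : O) : clt u v -> crank s u <= crank s v.
  by move=> uv; apply: sub_count => w wu; exact: clt_trans wu uv.
have [<-|xy|yx] := clt_total x y; first by rewrite clt_irr ltnn.
  rewrite xy; apply/esym; elim: s xs {le} => //= z s IH [->|/IH h].
    rewrite xy clt_irr add0n add1n ltnS; apply: sub_count => w wu; exact: clt_trans wu xy.
  have hz : clt z x <= clt z y by case E: (clt z x); rewrite // (clt_trans E xy).
  by rewrite -addnS leq_add.
by rewrite (clt_asym yx) ltnNge le.
Qed.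

Definition incr (h : nat -> nat) := forall i j, i < j -> h i < h j.

Lemma incr_le (h : nat -> nat) : incr h -> forall i j, (h i < h j) = (i < j).
Proof.
move=> hi i j; apply/idP/idP; last exact: hi.
by apply: contraTT; rewrite -!leqNgt leq_eqVlt => /orP[/eqP->//|/hi/ltnW].
Qed.

Lemma incr_comp (h g : nat -> nat) : incr h -> incr g -> incr (h \o g).
Proof. by move=> hh hg i j /hg/hh. Qed.

Lemma incrS (h : nat -> nat) : (forall i, h i < h i.+1) -> incr h.
Proof.
move=> hS i j; elim: j => // j IH; rewrite ltnS leq_eqVlt => /orP[/eqP->//|/IH h1].
exact: ltn_trans h1 (hS j).
Qed.

Lemma infinite_pigeonhole (Q : nat -> Prop) :
  exists2 b, incr b & (forall i, Q (b i)) \/ (forall i, ~ Q (b i)).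
Proof.
have [/choice[f hf]|/existsNP[N hN]] := pselect (forall N, exists j, N <= j /\ Q j); last first.
  exists (addn N) => [i j|]; first by rewrite ltn_add2l.
  by right=> i Qi; apply: hN; exists (N + i); rewrite leq_addr.
pose b := fix b i := if i is j.+1 then f (b j).+1 else f 0.
exists b; first by apply: incrS => i; rewrite /= (hf _).1.
by left=> -[|i]; exact: (hf _).2.
Qed.

(* The first [k] values of an increasing enumeration stand for a [k]-subset. *)
Lemma ramsey (k : nat) (P : (nat -> nat) -> Prop) :
  (forall f g, (forall i, i < k -> f i = g i) -> P f -> P g) ->
  exists2 h, incr h & forall f, incr f -> P (h \o f) <-> P h.
Proof.
elim: k P => [|k IH] P Pk.
  by exists id => // f _; split; apply: Pk.
pose cons_fun (a : nat) (f : nat -> nat) n := if n is m.+1 then f m else a.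
(* Thins out the tail of [h] until the truth of [P] on sets with first element [h 0] no longer
   depends on their other elements. *)
have step (h : nat -> nat) : exists g, incr h -> incr g /\
    forall f, incr f -> P (cons_fun (h 0) (h \o S \o g \o f)) <-> P (cons_fun (h 0) (h \o S \o
      g)).
  have [|g gi hg] := IH (fun f => P (cons_fun (h 0) (h \o S \o f))); last by exists g.
  by move=> f g fg; apply: Pk => -[//|i]; rewrite ltnS /= => /fg->.
have [G hG] := choice step.
pose H := fix H j := if j is i.+1 then H i \o S \o G (H i) else id.
have HS j : H j.+1 = H j \o S \o G (H j) by [].
have Hi j : incr (H j).
  elim: j => [//|j IHj]; rewrite HS; apply: incr_comp; last by case: (hG _ IHj).
  by move=> a b ab /=; apply: IHj.
pose a j := H j 0.
have ai : incr a.
  by apply: incrS => j; rewrite /a HS /=; apply: Hi.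
have Hsub j d : exists v, H (j + d) = H j \o v.
  elim: d => [|d [v hv]]; first by rewrite addn0; exists id.
  by rewrite addnS HS hv; exists (v \o S \o G (H j \o v)); apply/funext.
pose Q j := P (cons_fun (a j) (H j.+1)).
(* The terms of [a] after index [j] lie in the sequence [H j.+1], so [P] depends on the first index
   only; the pigeonhole principle then makes it constant. *)
have PQ f : incr f -> P (a \o f) <-> Q (f 0).
  move=> fi.
  have ex n : exists v, a (f n.+1) = H (f 0).+1 v.
    have lt0 : (f 0).+1 <= f n.+1 by apply: fi.
    by have [v hv] := Hsub (f 0).+1 (f n.+1 - (f 0).+1); exists (v 0); rewrite /a -(subnKC lt0)
      hv.
  have [w hw] := choice ex.
  have wi : incr w by move=> i j ij; rewrite -(incr_le (Hi (f 0).+1)) -!hw; apply/ai/fi.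
  have [_ /(_ w wi)] := hG _ (Hi (f 0)); rewrite -HS => hPQ; rewrite /Q -[a (f 0)]/(H (f 0) 0)
    -hPQ.
  by split; apply: Pk => -[//|i] _ /=; rewrite hw.
have [b bi hb] := infinite_pigeonhole Q.
exists (a \o b); first exact: incr_comp.
move=> f fi; rewrite -[(a \o b) \o f]/(a \o (b \o f)) PQ; last exact: incr_comp.
by rewrite PQ //; case: hb => hb; split=> h; by [exact: hb|case: (hb _ h)].
Qed.

Lemma sorted_reps (A : eqType) (o : A -> nat) (s : seq A) :
  exists L : seq A, [/\ sorted ltn (map o L), {subset L <= s} &
    forall a, a \in s -> exists2 b, b \in L & o a = o b].
Proof.
have pre (l : seq nat) : {subset l <= map o s} -> exists s', {subset s' <= s} /\ map o s' = l.
  elim: l => [|x l IH] h; first by exists [::].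
  have [|s' [s's e]] := IH; first by move=> y yl; apply: h; rewrite inE yl orbT.
  have /mapP[a as_ ->] := h x (mem_head _ _).
  exists (a :: s'); split; last by rewrite /= e.
  by move=> y; rewrite inE => /orP[/eqP->|/s's].
have [|L [Ls e]] := pre (sort leq (undup (map o s))).
  by move=> y; rewrite mem_sort mem_undup.
exists L; split=> //.
  by rewrite e ltn_sorted_uniq_leq sort_uniq undup_uniq sort_sorted // => x y; exact: leq_total.
move=> a as_; have : o a \in map o L by rewrite e mem_sort mem_undup map_f.
by move=> /mapP[b bL ->]; exists b.
Qed.

(** [eta] ranks an entry among the distinct values of [o]; a tuple of the same pattern is an
    increasing function of these ranks. *)
Lemma pateq_normal (m : nat) (o : 'I_m -> nat_chain) :
  exists eta : 'I_m -> nat,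
    forall i : 'I_m -> nat_chain, pateq o i -> exists2 g, incr g & i = g \o eta.
Proof.
have [L [Lsort _ Lrep]] := sorted_reps o (enum 'I_m).
have ex_rep a : exists b, b \in L /\ o a = o b.
  by have [|b bL e] := Lrep a; [rewrite mem_enum|exists b].
have [rep hrep] := choice ex_rep.
exists (fun a => index (rep a) L) => i hi.
have [a0 _|I0] := pickP (@predT 'I_m); last first.
  by exists id => //; apply/funext => a; have := I0 a.
have iL : sorted ltn (map i L).
  move: Lsort; case: L {Lrep ex_rep hrep} => //= b L.
  elim: L b => //= b L IH c /andP[h1 h2]; rewrite IH // andbT.
  by have := hi c b; rewrite /clt /= => <-.
pose N := \max_a i a.
(* Past the last rank the function only has to keep growing, hence the bound [N] on the values of
   [i]. *)
exists (fun n => if n < size L then i (nth a0 L n) else N + n).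
  apply: incrS => n; case: (ltnP n (size L)) => h.
    case: (ltnP n.+1 (size L)) => h'.
      have := sorted_ltn_nth ltn_trans 0 iL.
      move=> /(_ n n.+1); rewrite !inE !size_map h h' !(nth_map a0) //.
      exact.
    by rewrite addnS ltnS (leq_trans _ (leq_addr _ _)) // /N (leq_bigmax_cond (F := i)).
  by rewrite (ltnNge n.+1) (leq_trans h (leqnSn n)) ltn_add2l.
apply/funext => a /=; rewrite index_mem (hrep a).1 nth_index ?(hrep a).1 //.
exact: (pateq_eq hi (hrep a).2).
Qed.

Lemma ramsey_pattern (m : nat) (P : ('I_m -> nat_chain) -> Prop) (o : 'I_m -> nat_chain) :
  exists2 h : nat -> nat, incr h &
    (forall i : 'I_m -> nat_chain, pateq o i -> P (h \o i)) \/
    (forall i : 'I_m -> nat_chain, pateq o i -> ~ P (h \o i)).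
Proof.
have [eta heta] := pateq_normal o.
have [|h hi hP] := @ramsey (\max_a (eta a).+1) (fun f => P (f \o eta)).
  move=> f g fg; rewrite (_ : f \o eta = g \o eta)//; apply/funext => a /=.
  by apply: fg; exact: (leq_bigmax_cond (F := fun a => (eta a).+1)).
exists h => //; have [Ph|nPh] := pselect (P (h \o eta)); [left|right] => i /heta[g gi ->].
  exact/(hP _ gi).
by move/(hP _ gi).
Qed.

(** * Mutual indiscernibility *)

Definition rowpat (A T : Type) (O O' : chain) (r : A -> T) (o : A -> O) (o' : A -> O') : Prop :=
  forall a b, r a = r b -> clt (o a) (o b) = clt (o' a) (o' b).

Lemma pateq_rowpat (A T : Type) (O O' : chain) (r : A -> T) (o : A -> O) (o' : A -> O') :
  pateq o o' -> rowpat r o o'.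
Proof. by move=> h a b _; exact: h. Qed.

Lemma rowpat_sym (A T : Type) (O O' : chain) (r : A -> T) (o : A -> O) (o' : A -> O') :
  rowpat r o o' -> rowpat r o' o.
Proof. by move=> h a b /h. Qed.

Lemma rowpat_comp (A B T : Type) (O O' : chain) (r : A -> T) (o : A -> O) (o' : A -> O') (f : B
  -> A) :
  rowpat r o o' -> rowpat (r \o f) (o \o f) (o' \o f).
Proof. by move=> h a b; exact: h. Qed.

Section Alike.
Variables (L : language) (M : structure L) (C : set M).

(* The coordinates of the terms of the sequence [y] are distributed into rows
   by [r]; the rows of [y] and [y'] are mutually indiscernible and have the same
   Ehrenfeucht-Mostowski types over the parameters [u] and [u'] respectively. *)
Definition alike (U X T : Type) (O O' : chain) (u u' : U -> M) (r : X -> T)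
    (y : O -> X -> M) (y' : O' -> X -> M) : Prop :=
  forall m (x : 'I_m -> X) (s : 'I_m -> O) (t : 'I_m -> O'),
    rowpat (r \o x) s t ->
    tpeq C (env_sum (fun i => y (s i) (x i)) u) (env_sum (fun i => y' (t i) (x i)) u').

Definition MI (U X T : Type) (O : chain) (u : U -> M) (r : X -> T) (y : O -> X -> M) : Prop :=
  alike u u r y y.

Lemma alike_gen (U X T E : Type) (O O' : chain) (u u' : U -> M) (r : X -> T)
    (y : O -> X -> M) (y' : O' -> X -> M) (x : E -> X) (s : E -> O) (t : E -> O') :
  alike u u' r y y' -> rowpat (r \o x) s t ->
  tpeq C (env_sum (fun i => y (s i) (x i)) u) (env_sum (fun i => y' (t i) (x i)) u').
Proof.
move=> hy hst; apply: tpeq_fin => m f.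
have [F [f1 [g ->]]] := factor_sum f.
pose g' i : 'I_#|F| + U := match g i with inl a => inl (enum_rank a) | inr b => inr b end.
pose h (i : 'I_#|F|) := f1 (enum_val i).
have eq (v : E -> M) (w : U -> M) : env_sum v w \o
    ((fun s0 => match s0 with inl x => inl (f1 x) | inr b => inr b end) \o g) =
    env_sum (v \o h) w \o g'.
  by apply/funext => i; rewrite /g' /h /=; case: (g i) => //= a; rewrite enum_rankK.
rewrite !eq; apply: tpeq_comp; exact: (hy _ (x \o h) (s \o h) (t \o h) (rowpat_comp hst)).
Qed.

Lemma alike_gen0 (X T E : Type) (O O' : chain) (r : X -> T)
    (y : O -> X -> M) (y' : O' -> X -> M) (x : E -> X) (s : E -> O) (t : E -> O') :
  alike (of_void M) (of_void M) r y y' -> rowpat (r \o x) s t ->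
  tpeq C (fun i => y (s i) (x i)) (fun i => y' (t i) (x i)).
Proof. by move=> hy /(alike_gen hy)/(@tpeq_comp _ _ _ _ _ inl). Qed.

Lemma alike0 (X T : Type) (O O' : chain) (r : X -> T) (y : O -> X -> M) (y' : O' -> X -> M) :
  (forall m (x : 'I_m -> X) (s : 'I_m -> O) (t : 'I_m -> O'), rowpat (r \o x) s t ->
     tpeq C (fun i => y (s i) (x i)) (fun i => y' (t i) (x i))) ->
  alike (of_void M) (of_void M) r y y'.
Proof.
move=> h m x s t /h hst.
pose g (a : 'I_m + void) : 'I_m := match a with inl i => i | inr v => of_void _ v end.
have e (v : 'I_m -> M) : env_sum v (of_void M) = v \o g by apply/funext; case=> // -[].
by rewrite !e; exact: tpeq_comp.
Qed.

(** Rows may be merged but not split: a coarser row map asks for more of the order to be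
    preserved. *)
Lemma alike_sub (U U' X X' T T' : Type) (O O' : chain) (u u' : U -> M) (r : X -> T)
    (r' : X' -> T') (y : O -> X -> M) (y' : O' -> X -> M) (f : U' -> U) (g : X' -> X) :
  (forall a b, r (g a) = r (g b) -> r' a = r' b) ->
  alike u u' r y y' ->
  alike (u \o f) (u' \o f) r' (fun o => y o \o g) (fun o => y' o \o g).
Proof.
move=> hr hy m x s t hst.
have hst' : rowpat (r \o (g \o x)) s t by move=> a b /hr; exact: hst.
have := hy _ _ _ _ hst'.
by move=> /(@tpeq_comp _ _ _ _ _
  (fun a => match a with inl i => inl i | inr v => inr (f v) end)); rewrite -!(env_sum_comp _ _
    id).
Qed.

(* The Ehrenfeucht-Mostowski type of the indiscernible sequence [z'] extends that
   of [z]. *)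
Definition em_of (X : Type) (O : chain) (z : nat -> X -> M) (z' : O -> X -> M) : Prop :=
  (forall m (x : 'I_m -> X) (o : 'I_m -> O) S, Def C S ->
     (forall i : 'I_m -> nat_chain, pateq o i -> S (fun a => z (i a) (x a))) ->
     S (fun a => z' (o a) (x a))) /\
  (forall m (x : 'I_m -> X) (o o' : 'I_m -> O), pateq o o' ->
     tpeq C (fun a => z' (o a) (x a)) (fun a => z' (o' a) (x a))).

(** The official notion compares strictly increasing index tuples; an arbitrary tuple is reduced to
    the sorted list of its distinct indices. *)
Lemma indiscernible_MI (A : set M) (n : nat) (J : nat -> 'I_n -> M) (U : Type) (u : U -> M) :
  C `<=` A -> (forall v, A (u v)) -> indiscernible A (omega_seq J) ->
  @MI U _ _ nat_chain u (fun=> tt) J.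
Proof.
move=> CA uA indJ m x s t hst.
have [Lr [Lsort _ Lrep]] := sorted_reps (s : 'I_m -> nat) (enum 'I_m).
have ex_rep a : exists b : 'I_(size Lr), s a = s (tnth (in_tuple Lr) b).
  have [|b bL e] := Lrep a; first by rewrite mem_enum.
  move: (bL); rewrite -index_mem => hb; exists (Ordinal hb).
  by rewrite (tnth_nth b) /= nth_index.
have [rk hrk] := choice ex_rep.
pose i (q : 'I_(size Lr)) : nat := s (tnth (in_tuple Lr) q).
pose j (q : 'I_(size Lr)) : nat := t (tnth (in_tuple Lr) q).
have pat : pateq s t by move=> a b; exact: hst.
have hi : {homo i : p q / (p < q)%O}.
  move=> p q; rewrite ltEord ltEnat /i => pq.
  have /(_ 0 _ Lsort p q) := sorted_ltn_nth ltn_trans.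
  have x0 := tnth (in_tuple Lr) p.
  by rewrite !inE !size_map !(nth_map x0) // !(tnth_nth x0) /=; apply.
have hj : {homo j : p q / (p < q)%O}.
  by move=> p q /hi; rewrite !ltEnat /i /j /=; have := pat (tnth (in_tuple Lr) p) (tnth
    (in_tuple Lr) q); rewrite /clt /= => ->.
have hs a : s a = i (rk a) by rewrite hrk.
have ht a : t a = j (rk a) by exact: (pateq_eq pat (hrk a)).
move=> S [phi hphi]; rewrite -!hphi /pholds.
have cA (c : C) : val c \in A by apply/mem_set/CA/set_mem/(valP c).
pose g (a : ('I_m + U) + C) : ('I_(size Lr) * 'I_n) + A := match a with
  | inl (inl a) => inl (rk a, x a)
  | inl (inr v) => inr (SigSub (mem_set (uA v)))
  | inr c => inr (SigSub (cA c)) end.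
have := indJ _ i j hi hj (frename g phi); rewrite /pholds !holds_rename => -[+ _].
rewrite (_ : env_sum _ _ \o g = env_sum (env_sum (fun a => J (s a) (x a)) u) set_val); last first.
  by apply/funext => -[[a|v]|c] //=; rewrite hs.
rewrite (_ : env_sum _ _ \o g = env_sum (env_sum (fun a => J (t a) (x a)) u) set_val) //.
by apply/funext => -[[a|v]|c] //=; rewrite ht.
Qed.

Lemma MI_indiscernible (A : set M) (n : nat) (J : nat -> 'I_n -> M) (U : Type) (u : U -> M) :
  A `<=` C `|` range u -> @MI U _ _ nat_chain u (fun=> tt) J ->
  indiscernible A (omega_seq J).
Proof.
move=> AC hJ k i j hi hj.
have mono (h : 'I_k -> nat) : {homo h : p q / (p < q)%O} -> forall p q, (h p < h q) = (p < q).
  move=> hh p q; apply/idP/idP; last by move=> pq; exact: hh.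
  by apply: contraTT; rewrite -!leqNgt leq_eqVlt => /orP[/eqP/val_inj->//|qp]; exact/ltnW/hh.
have cl (a : A) : exists z : U + C, val a = match z with inl v => u v | inr c => val c end.
  have [Ca|[v _ e]] := AC _ (set_mem (valP a)).
    by exists (inr (SigSub (mem_set Ca))).
  by exists (inl v).
have [c hc] := choice cl.
pose g (a : ('I_k * 'I_n) + A) : (('I_k * 'I_n) + U) + C := match a with
  | inl q => inl (inl q)
  | inr a => match c a with inl v => inl (inr v) | inr c => inr c end end.
have E (f : 'I_k -> nat) : env_sum (fun q : 'I_k * 'I_n => J (f q.1) q.2) (@set_val M A) =
    env_sum (env_sum (fun q : 'I_k * 'I_n => J (f q.1) q.2) u) set_val \o g.
  by apply/funext => -[q|a] //=; have := hc a; rewrite /g; case: (c a).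
have hij : rowpat ((fun=> tt) \o @snd 'I_k 'I_n) (i \o fst : _ -> nat_chain) (j \o fst : _ ->
  nat_chain).
  by move=> p q _; rewrite /clt /= !mono.
move=> phi; rewrite /pholds /= (E i) (E j) -!holds_rename.
exact: (tpeqE (alike_gen hJ hij) (Def_pholds (frename g phi))).
Qed.

End Alike.

(** * Extraction of indiscernible sequences *)

Section EM.
Variables (L : language) (kap : Type) (M : structure L) (C : set M).
Hypothesis kapS : uncountable_strong_limit kap.
Hypothesis M_sat : saturated kap M.
Hypothesis C_small : small kap C.

Lemma compactness0 (X A : Type) (S : A -> set (X -> M)) :
  smallT kap X -> (forall a, Def C (S a)) ->
  (forall l : list A, exists v, forall a, List.In a l -> S a v) ->
  exists v, forall a, S a v.
Proof.
move=> sX dS hfin.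
have [||||v hv] := @compactness _ _ _ C kapS M_sat C_small X void A (of_void M)
  (fun a w => S a (w \o inl)) => //; last by exists v.
- exact: small_count.
- by move=> a; exact: Def_rename.
Qed.

(** Compactness in the variables [O * X]: finitely many requirements involve finitely many indices
    and are met by a subsequence of [z] given by Ramsey's theorem. *)
Lemma em_extract (X : Type) (O : chain) (z : nat -> X -> M) :
  smallT kap X -> smallT kap O ->
  exists z' : O -> X -> M, em_of C z z'.
Proof.
move=> sX sO.
pose ev m (x : 'I_m -> X) (o : 'I_m -> O) (w : O * X -> M) := fun a => w (o a, x a).
pose good1 (Q : set (O * X -> M)) := exists m (x : 'I_m -> X) (o : 'I_m -> O) S,
  [/\ Def C S, (forall i : 'I_m -> nat_chain, pateq o i -> S (fun a => z (i a) (x a))) &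
      Q = (fun w => S (ev _ x o w))].
pose good2 (Q : set (O * X -> M)) := exists m (x : 'I_m -> X) (o o' : 'I_m -> O) S,
  [/\ Def C S, pateq o o' & Q = (fun w => S (ev _ x o w) -> S (ev _ x o' w))].
pose A := {Q | good1 Q \/ good2 Q}.
have dev m (x : 'I_m -> X) (o : 'I_m -> O) S : Def C S -> Def C (fun w => S (ev _ x o w)).
  by move=> dS; exact: (Def_rename (fun a => (o a, x a)) dS).
pose emb (s : list O) (rho : O -> nat) := forall p q, List.In p s -> List.In q s ->
  clt p q = (rho p < rho q).
pose val_of (h : nat -> nat) (rho : O -> nat) : O * X -> M := fun p => z (h (rho p.1)) p.2.
(* The requirement is met inside any given subsequence [h0] and survives further thinning [h'], so
   that several requirements can be treated in succession. *)
have one (Q : A) : exists s : list O, forall h0, incr h0 -> exists2 h, incr h &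
    forall h' rho, incr h' -> emb s rho -> sval Q (val_of (h0 \o h \o h') rho).
  have pat m (o : 'I_m -> O) s rho h : incr h -> emb s rho -> (forall a, List.In (o a) s) ->
      @pateq _ O nat_chain o (h \o rho \o o).
    by move=> hi hr hs a b; rewrite (hr _ _ (hs a) (hs b)) /clt /= incr_le.
  have in_enum m (o : 'I_m -> O) a : List.In (o a) (map o (enum 'I_m)).
    have : a \in enum 'I_m by rewrite mem_enum.
    by elim: (enum 'I_m) => //= b s IH; rewrite inE => /orP[/eqP->|/IH]; [left|right].
  case: Q => Q /= [[m [x [o [S [dS hS ->]]]]]|[m [x [o [o' [S [dS opat ->]]]]]]].
    exists (map o (enum 'I_m)) => h0 hi0; exists id => // h' rho hi' hr.
    apply: (hS ((h0 \o h') \o rho \o o)); apply: pat hr _ => //; exact: incr_comp.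
  exists (map o (enum 'I_m) ++ map o' (enum 'I_m)) => h0 hi0.
  have ins a : List.In (o a) (map o (enum 'I_m) ++ map o' (enum 'I_m)).
    by apply/List.in_or_app; left.
  have ins' a : List.In (o' a) (map o (enum 'I_m) ++ map o' (enum 'I_m)).
    by apply/List.in_or_app; right.
  set s := _ ++ _ in ins ins' *.
  have embc : emb s (crank s) by move=> p q ps qs; exact: crank_lt.
  have pat0 := pat _ o s _ id (fun _ _ h => h) embc ins.
  have [h hi hP] := ramsey_pattern (fun i => S (fun a => z (h0 (i a)) (x a))) (crank s \o o).
  exists h => // h' rho hi' hr.
  have p1 : pateq (crank s \o o : _ -> nat_chain) (h' \o rho \o o : _ -> nat_chain).
    by move=> a b; rewrite -(pat _ _ _ _ _ hi' hr ins) -pat0.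
  have p2 : pateq (crank s \o o : _ -> nat_chain) (h' \o rho \o o' : _ -> nat_chain).
    by move=> a b; rewrite -(pat _ _ _ _ _ hi' hr ins') -opat -pat0.
  case: hP => hP; [by move=> _; exact: (hP _ p2)|by move=> /(hP _ p1)].
have many (l : list A) : exists s : list O, forall h0, incr h0 -> exists2 h, incr h &
    forall h' rho, incr h' -> emb s rho -> forall Q, List.In Q l -> sval Q (val_of (h0 \o h \o
      h') rho).
  elim: l => [|Q l [s hs]]; first by exists [::] => h0 hi0; exists id.
  have [s1 hs1] := one Q; exists (s1 ++ s) => h0 hi0.
  have [h1 hi1 H1] := hs1 _ hi0.
  have [h2 hi2 H2] := hs _ (incr_comp hi0 hi1).
  exists (h1 \o h2); first exact: incr_comp.
  move=> h' rho hi' hr Q' [<-|Q'l].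
    apply: (H1 (h2 \o h')); first exact: incr_comp.
    by move=> p q ps qs; apply: hr; apply/List.in_or_app; left.
  apply: H2 => // p q ps qs; apply: hr; apply/List.in_or_app; by right.
have [|||w hw] := @compactness0 (O * X)%type A (fun Q => sval Q).
- exact: small_prod.
- move=> [Q /= [[m [x [o [S [dS hS ->]]]]]|[m [x [o [o' [S [dS opat ->]]]]]]]]; first exact: dev.
  by apply: Def_imp; exact: dev.
- move=> l; have [s hs] := many l; have [h hi H] := hs id (fun _ _ h => h).
  exists (val_of (id \o h \o id) (crank s)); apply: H => // p q ps qs; exact: crank_lt.
exists (fun o x => w (o, x)); split.
  move=> m x o S dS hS.
  by apply: (hw (exist _ (fun w => S (ev _ x o w)) _)); left; exists m, x, o, S.
move=> m x o o' opat S dS.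
by apply: (hw (exist _ (fun w => S (ev _ x o w) -> S (ev _ x o' w)) _)); right; exists m, x, o,
  o', S.
Qed.

End EM.

Lemma pateq_exists (m : nat) (O : chain) (o : 'I_m -> O) :
  exists i : 'I_m -> nat_chain, pateq o i.
Proof.
exists (crank (map o (enum 'I_m)) \o o) => a b; apply: crank_lt.
have : a \in enum 'I_m by rewrite mem_enum.
by elim: (enum 'I_m) => //= c s IH; rewrite inE => /orP[/eqP->|/IH]; [left|right].
Qed.

Lemma pateq_sym (A : Type) (O O' : chain) (o : A -> O) (o' : A -> O') :
  pateq o o' -> pateq o' o.
Proof. by move=> h a b. Qed.

Lemma pateq_trans (A : Type) (O O' O'' : chain) (o : A -> O) (o' : A -> O') (o'' : A -> O'') :
  pateq o o' -> pateq o' o'' -> pateq o o''.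
Proof. by move=> h h' a b; rewrite h h'. Qed.

Section EMConsequences.
Variables (L : language) (M : structure L) (C : set M).

Section Fixed.
Variables (X : Type) (O : chain) (z : nat -> X -> M) (z' : O -> X -> M).
Hypothesis zz' : em_of C z z'.

Lemma em_Def (E : finType) (x : E -> X) (o : E -> O) (S : set (E -> M)) : Def C S ->
  (forall i : E -> nat_chain, pateq o i -> S (fun a => z (i a) (x a))) ->
  S (fun a => z' (o a) (x a)).
Proof.
move=> dS hS.
have := zz'.1 _ (x \o enum_val) (o \o enum_val) _ (Def_rename enum_rank dS).
rewrite (_ : _ \o _ = fun a => z' (o a) (x a)); last by apply/funext => a /=; rewrite enum_rankK.
apply=> i hi; have := hS (i \o enum_rank).
rewrite (_ : _ \o _ = fun a => z (i (enum_rank a)) (x a)); last first.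
  by apply/funext => a /=; rewrite enum_rankK.
by apply=> a b; have := hi (enum_rank a) (enum_rank b); rewrite /= !enum_rankK.
Qed.

Lemma em_tp (E : Type) (x : E -> X) (o : E -> O) (v : E -> M) :
  (forall m (f : 'I_m -> E) (i : 'I_m -> nat_chain), pateq (o \o f) i ->
     tpeq C (v \o f) (fun a => z (i a) (x (f a)))) ->
  tpeq C v (fun a => z' (o a) (x a)).
Proof.
move=> h; apply: tpeq_fin => m f S dS Sv.
by apply: (zz'.1 _ (x \o f) (o \o f)) => // i hi; exact: (h _ f i hi _ dS Sv).
Qed.

Lemma em_MI : MI C (of_void M) (fun=> tt) z'.
Proof. by apply: alike0 => m x s t hst; apply: zz'.2 => a b; exact: hst. Qed.

End Fixed.

(** All rows are extracted together as one sequence. Their independence survives because a finite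
    tuple of [y'] has the type of [y] at any tuple of the same pattern. *)
Lemma MI_stretch (kap : Type) (X T : Type) (O : chain) (r : X -> T) (y : nat_chain -> X -> M) :
  uncountable_strong_limit kap -> saturated kap M -> small kap C ->
  smallT kap X -> smallT kap O -> MI C (of_void M) r y ->
  exists y' : O -> X -> M, alike C (of_void M) (of_void M) r y y'.
Proof.
move=> kapS Msat sC sX sO hy.
have [y' yy'] := em_extract kapS Msat sC y sX sO.
exists y'; apply: alike0 => m x s t hst; apply: (em_tp yy') => k f i hi.
have hsi : rowpat (r \o (x \o f)) (s \o f) i by move=> a b /hst e; rewrite -hi.
exact: (alike_gen0 hy hsi).
Qed.

(** Rows are moved from [s] to [t] one after the other, each over all terms of the other rows; in
    [mix l] the rows listed in [l] have been moved. *)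
Lemma MI_of_rows (U X T : Type) (O : chain) (u : U -> M) (r : X -> T) (y : O -> X -> M) :
  (forall t, MI C (env_sum u (fun q : O * {x | r x <> t} => y q.1 (sval q.2))) (fun=> tt)
                  (fun i (x : {x | r x = t}) => y i (sval x))) ->
  MI C u r y.
Proof.
move=> hrow m x s t hst.
pose mix (l : list T) (a : 'I_m) : O := if pselect (List.In (r (x a)) l) then t a else s a.
suff H l : tpeq C (env_sum (fun i => y (s i) (x i)) u) (env_sum (fun i => y (mix l i) (x i)) u).
  rewrite (_ : t = mix (map (fun a => r (x a)) (enum 'I_m))); first exact: H.
  apply/funext => a; rewrite /mix; case: pselect => // -[].
  have : a \in enum 'I_m by rewrite mem_enum.
  by elim: (enum 'I_m) => //= b l' IH; rewrite inE => /orP[/eqP->|/IH]; [left|right].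
elim: l => [|k l IH].
  by rewrite (_ : mix [::] = s)//; apply/funext => a; rewrite /mix; case: pselect.
apply: tpeq_trans IH _.
pose E := (O * {x | r x <> k})%type.
pose E' := {a : 'I_m | r (x a) = k}.
pose x' (q : E') : {x | r x = k} := exist _ (x (sval q)) (svalP q).
have g (a : 'I_m) : {e : E' + E | match e with
    | inl q => sval q = a
    | inr e => [/\ e.1 = mix l a, sval e.2 = x a & r (x a) <> k] end}.
  have [e|ne] := pselect (r (x a) = k); last by exists (inr (mix l a, exist _ (x a) ne)).
  by exists (inl (exist _ a e)).
pose gg (a : 'I_m + U) : E' + (U + E) := match a with
  | inl a => match sval (g a) with inl q => inl q | inr e => inr (inr e) end
  | inr v => inr (inl v) end.
have hst' : rowpat ((fun=> tt) \o x') (fun q : E' => mix l (sval q)) (fun q : E' => mix (k :: l)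
  (sval q)).
  have mk a : r (x a) = k -> mix (k :: l) a = t a.
    by move=> e; rewrite /mix; case: pselect => // -[]; left.
  move=> [a ab] [a' ab'] _; rewrite /= !mk // /mix ab ab'.
  by case: pselect => //= _; apply: hst; rewrite /= ab ab'.
have := alike_gen (hrow k) hst'; move=> /(@tpeq_comp _ _ _ _ _ gg).
have E1 l' : (forall a, r (x a) <> k -> mix l' a = mix l a) ->
    env_sum (fun q : E' => y (mix l' (sval q)) (sval (x' q)))
      (env_sum u (fun q : E => y q.1 (sval q.2))) \o gg =
    env_sum (fun i => y (mix l' i) (x i)) u.
  move=> hl'; apply/funext => -[a|//] /=; case: (g a) => -[[a' e]|[i [w ne]]] /=; first by
    move=> <-.
  by move=> [-> -> /hl' ->].
rewrite !E1 // => a ne; rewrite /mix; case: pselect => [[e|h]|h]; case: pselect => //= h'.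
- by case: ne.
- by case: h; right.
Qed.

(** * Systems of rows and mutually indiscernible sequences *)

Section Rows.
Variables (K : Type) (len : K -> nat) (I : forall k : K, nat -> 'I_(len k) -> M).

Definition row_system (i : nat_chain) (x : {k : K & 'I_(len k)}) : M :=
  @I (projT1 x) i (projT2 x).

Lemma MI_mutual (U : Type) (u : U -> M) (A : set M) :
  A `<=` C `|` range u ->
  MI C u (@projT1 K (fun k => 'I_(len k))) row_system ->
  mutually_indiscernible A (fun k => omega_seq (@I k)).
Proof.
move=> AC hI k.
pose E := (nat * {x : {k : K & 'I_(len k)} | projT1 x <> k})%type.
pose u' : U + E -> M := env_sum u (fun e => row_system e.1 (sval e.2)).
apply: (@MI_indiscernible _ _ C _ _ (@I k) _ u').
  move=> a [/AC[Ca|[v _ <-]]|[j jk [i [l ->]]]]; first by left.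
    by right; exists (inl v).
  by right; exists (inr (i, exist _ (existT _ j l) jk)).
move=> m x s t hst.
pose xx (e : 'I_m + E) := match e with inl a => existT _ k (x a) | inr e => sval e.2 end.
pose mk (w : 'I_m -> nat) (e : 'I_m + E) : nat_chain := match e with inl a => w a | inr e => e.1
  end.
have pat : rowpat (@projT1 _ _ \o xx) (mk s) (mk t).
  move=> [a|e] [b|e'] //=; first by move=> _; exact: hst.
    by case: e' => ? [? h] /= /esym.
  by case: e => ? [? h] /=.
have := alike_gen hI pat.
pose g (a : 'I_m + (U + E)) : ('I_m + E) + U := match a with
  | inl a => inl (inl a) | inr (inl v) => inr v | inr (inr e) => inl (inr e) end.
move=> /(@tpeq_comp _ _ _ _ _ g).
have E1 (w : 'I_m -> nat) : env_sum (fun i => row_system (mk w i) (xx i)) u \o g =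
    env_sum (fun i => @I k (w i) (x i)) u'.
  by apply/funext => -[a|[v|e]].
by rewrite !E1.
Qed.

Lemma mutual_MI : mutually_indiscernible C (fun k => omega_seq (@I k)) ->
  MI C (of_void M) (@projT1 K (fun k => 'I_(len k))) row_system.
Proof.
move=> hI; apply: MI_of_rows => k.
pose E := (nat * {x : {k : K & 'I_(len k)} | projT1 x <> k})%type.
pose u (e : E) : M := row_system e.1 (sval e.2).
have hk : @MI _ _ C _ _ _ nat_chain u (fun=> tt) (@I k).
  apply: indiscernible_MI (hI k); first by left.
  by move=> [i [[j b] jk]]; right; exists j => //; exists i, b.
pose f (a : void + E) : E := match a with inl v => of_void _ v | inr e => e end.
have g (x : {x : {k : K & 'I_(len k)} | projT1 x = k}) : {l : 'I_(len k) | sval x = existT _ k l}.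
  by case: x => -[k' l] /= e; case: _ / e; exists l.
have := alike_sub (r' := fun=> tt) (f := f) (g := fun x => sval (g x)) (fun _ _ _ => erefl) hk.
rewrite (_ : u \o f = env_sum (of_void M) u); last by apply/funext => -[[]|].
rewrite (_ : (fun i => @I k i \o _) = fun i x => row_system i (sval x)) //.
by apply/funext => i; apply/funext => x /=; case: (g x) => l /= ->.
Qed.

End Rows.

End EMConsequences.

(** * Finite alternation for dependent types *)

Lemma Def_restrict_right (L : language) (M : structure L) (C : set M) (A Y : Type)
    (S : set (A + Y -> M)) : Def C S ->
  exists m (f : 'I_m -> Y) (S' : set (A + 'I_m -> M)), Def C S' /\
    forall a y, S (env_sum a y) <-> S' (env_sum a (y \o f)).
Proof.
move=> /Def_factor[q [f [S0 [_ dS0 hS0]]]].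
have [F [f1 [g e]]] := factor_sum (fun i => match f i with inl a => inr a | inr y => inl y end).
pose h i : A + 'I_#|F| := match g i with inl x => inr (enum_rank x) | inr a => inl a end.
exists #|F|, (f1 \o enum_val), (fun w => S0 (w \o h)); split; first exact: Def_rename.
move=> a y; rewrite hS0 (_ : _ \o f = env_sum a (y \o (f1 \o enum_val)) \o h)//.
apply/funext => i; have := congr1 (fun k => k i) e; rewrite /h /=.
by case: (f i) (g i) => [b|b] [x|x] //= [->]; rewrite ?enum_rankK.
Qed.

Lemma pateq_double (A : Type) (O : chain) (o : A -> O) (i : A -> nat_chain) (odd_bit : A ->
  bool) :
  pateq o i -> (forall a b, o a = o b -> odd_bit a = odd_bit b) ->
  @pateq A O nat_chain o (fun a => (i a).*2 + odd_bit a).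
Proof.
move=> oi hb a b; rewrite oi /clt /=.
case: (ltngtP (i a) (i b)) => h.
- by apply/esym; case: (odd_bit a) (odd_bit b) => -[] /=; lia.
- by apply/esym/negbTE; rewrite -leqNgt; case: (odd_bit a) (odd_bit b) => -[] /=; lia.
- by rewrite (hb a b (pateq_eq (pateq_sym oi) h)) h ltnn.
Qed.

Section Dependent.
Variables (L : language) (kap : Type) (M : structure L) (C : set M).
Hypothesis kapS : uncountable_strong_limit kap.
Hypothesis M_sat : saturated kap M.
Hypothesis C_small : small kap C.
Variables (n : nat) (p : set (pformula 'I_n C)).
Hypothesis p_dep : dependent kap p.

(** Each extracted term carries [c] and a pair of consecutive terms of [d]; the index order consists
    of [Lam] blocks of type omega. Taking first and second members in turn within each block gives
    [Lam] mutually indiscernible sequences, none of them indiscernible over the copy [c'] of [c]. *)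
Lemma no_alternation_fin (m : nat) (c : 'I_n -> M) (d : nat_chain -> 'I_m -> M)
    (S : set ('I_n + 'I_m -> M)) :
  realizes c p -> MI C (of_void M) (fun=> tt) d -> Def C S ->
  ~ forall i : nat, S (env_sum c (d i.*2)) /\ ~ S (env_sum c (d i.*2.+1)).
Proof.
move=> cp hd dS hS.
have [Lam sLam hLam] := p_dep.
have [lt [lt_irr lt_tr lt_tot]] := linear_order_exists Lam.
pose LO := Chain lt_irr lt_tr lt_tot.
pose O := lex_chain LO nat_chain.
pose X := ('I_n + ('I_m + 'I_m))%type.
pose z (i : nat) : X -> M := env_sum c (env_sum (d i.*2) (d i.*2.+1)).
have sX : smallT kap X by exact: small_count.
have sO : smallT kap O by apply: small_prod => //; exact: small_nat.
have [z' zz'] := em_extract kapS M_sat C_small z sX sO.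
pose coord (i : nat) (l : 'I_m) : X := inr (if odd i then inr l else inl l).
pose I (lam : Lam) (i : nat) (l : 'I_m) : M := z' ((lam, i) : O) (coord i l).
have zc i j l : z i (coord j l) = d (i.*2 + odd j) l.
  by rewrite /z /coord; case: (odd j); rewrite ?addn1 ?addn0.
have inf (s : nat -> 'I_m -> M) : infinite_seq (omega_seq s) by exact: infinite_nat.
(* An empty [Lam] is impossible, since dependence would produce a member of it. *)
have [[lam0 _]|nL] := pselect (exists lam : Lam, True); last first.
  have [| |lam _] := hLam c (fun lam => omega_seq (I lam)) cp; last by apply: nL; exists lam.
    by move=> lam; exact: inf.
  by move=> lam; case: nL; exists lam.
pose c' l := z' ((lam0, 0) : O) (inl l).
have Hc o l : z' o (inl l) = c' l.
  have := em_Def zz' (E := bool) (x := fun=> inl l) (o := fun b => if b then o else (lam0, 0) : O)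
    (@Def_eq _ _ C _ true false).
  by apply.
have c'p : realizes c' p.
  move=> phi pphi; apply: (em_Def zz' (E := 'I_n) (x := inl) (o := fun=> (lam0, 0) : O)
    (Def_pholds phi)).
  by move=> i _; exact: cp.
have IMI : MI C (of_void M) (@projT1 Lam (fun=> 'I_m)) (row_system (len := fun=> m) I).
  apply: alike0 => k x s t hst.
  pose o (w : 'I_k -> nat) a : O := (projT1 (x a), w a).
  have os w : rowpat (@projT1 _ _ \o x) (s : _ -> nat_chain) (w : _ -> nat_chain) -> pateq (o s)
    (o w).
    move=> sw a b; rewrite /clt /= /lexi /=.
    have [e|->//|h] := lt_tot (projT1 (x a)) (projT1 (x b)).
      by rewrite /= e (lt_irr _) /=; exact: sw.
    by rewrite h.
  have [i0 hi0] := pateq_exists (o s).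
  pose v a := d ((i0 a).*2 + odd (s a)) (projT2 (x a)).
  suff H (w : 'I_k -> nat) : rowpat (@projT1 _ _ \o x) (s : _ -> nat_chain) (w : _ -> nat_chain)
    ->
      tpeq C v (fun a => row_system (len := fun=> m) I (w a) (x a)).
    by apply: tpeq_trans (H t hst); apply: tpeq_sym; exact: H.
  move=> sw.
  apply: (em_tp zz' (x := fun a => coord (w a) (projT2 (x a))) (o := o w)) => q f i hi.
  have -> : (fun a => z (i a) (coord (w (f a)) (projT2 (x (f a))))) =
      fun a => d ((i a).*2 + odd (w (f a))) (projT2 (x (f a))).
    by apply/funext => a; exact: zc.
  refine (alike_gen0 hd (x := fun a => projT2 (x (f a)))
    (s := (fun a => (i0 (f a)).*2 + odd (s (f a))) : _ -> nat_chain)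
    (t := (fun a => (i a).*2 + odd (w (f a))) : _ -> nat_chain) _).
  apply: pateq_rowpat; apply: (@pateq_trans _ _ O _ _ (o s \o f)).
    apply: pateq_sym; apply: pateq_double => [a b|a b [_ ->] //]; exact: hi0.
  apply: (@pateq_trans _ _ O _ _ (o w \o f)); first by move=> a b; exact: (os w sw).
  by apply: pateq_double => // a b [_ ->].
have [|lam] := hLam c' (fun lam => omega_seq (I lam)) c'p (fun lam => inf _).
  by apply: MI_mutual IMI => a Ca; left.
move=> indI; have hI : @MI _ _ C _ _ _ nat_chain c' (fun=> tt) (I lam).
  by apply: indiscernible_MI indI => [a Ca|v]; [left|right; exists v].
have Sval b : (~~ odd b -> S (env_sum c' (I lam b))) /\ (odd b -> ~ S (env_sum c' (I lam b))).
  pose xx (a : 'I_n + 'I_m) : X := match a with inl l => inl l | inr l => coord b l end.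
  have -> : env_sum c' (I lam b) = fun a => z' ((lam, b) : O) (xx a).
    by apply/funext => -[l|l] //=; rewrite Hc.
  have Z (i : 'I_n + 'I_m -> nat_chain) : pateq (fun=> (lam, b) : O) i ->
      exists j, (fun a => z (i a) (xx a)) = env_sum c (d (j.*2 + odd b)).
    move=> hi; have [e0 _|E0] := pickP (@predT ('I_n + 'I_m)%type); last first.
      by exists 0; apply/funext => a; have := E0 a.
    exists (i e0); apply/funext => a; rewrite (@pateq_eq _ _ _ _ _ a e0 hi erefl).
    by case: a => l; [|exact: zc].
  split=> ob.
    apply: (em_Def zz' (o := fun=> (lam, b) : O) dS) => i /Z[j ->].
    by rewrite (negbTE ob) addn0; case: (hS j).
  apply: (em_Def zz' (o := fun=> (lam, b) : O) (Def_not dS)) => i /Z[j ->].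
  by rewrite ob addn1; case: (hS j).
have h01 : rowpat ((fun=> tt) \o @id 'I_m) (fun=> 0 : nat_chain) (fun=> 1 : nat_chain) by [].
have := alike_gen hI h01.
move=> /(@tpeq_comp _ _ _ _ _ (fun a : 'I_n + 'I_m => match a with inl l => inr l | inr l => inl
  l end)).
have E b : env_sum (fun i : 'I_m => I lam b i) c' \o
    (fun a : 'I_n + 'I_m => match a with inl l => inr l | inr l => inl l end) = env_sum c' (I
      lam b).
  by apply/funext; case.
by rewrite !E => /(_ S dS) H; apply: (Sval 1).2 => //; apply: H; apply: (Sval 0).1.
Qed.

Lemma no_alternation (Y : Type) (c : 'I_n -> M) (d : nat_chain -> Y -> M)
    (S : set ('I_n + Y -> M)) :
  realizes c p -> MI C (of_void M) (fun=> tt) d -> Def C S ->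
  ~ forall i : nat, S (env_sum c (d i.*2)) /\ ~ S (env_sum c (d i.*2.+1)).
Proof.
move=> cp hd /Def_restrict_right[m [f [S' [dS' hS']]]] hS.
apply: (@no_alternation_fin m c (fun i => d i \o f) S' cp _ dS').
  by have := alike_sub (r' := fun=> tt) (f := id) (g := f) _ hd; apply.
by move=> i; rewrite -!hS'.
Qed.

(** Induction along the tuple. If [D] is indiscernible over the first [j] entries but not over one
    more, shifted copies of the two distinguished index tuples, used in turn, make a formula
    alternate at that single realization. The first [j] entries enter the sequence as constant
    coordinates, so [no_alternation] applies. *)
Lemma no_alternation_tuple_fin (k m : nat) (x : 'I_k -> 'I_n -> M) (d : nat_chain -> 'I_m -> M)
    (S : set (('I_k * 'I_n) + 'I_m -> M)) :
  (forall t, realizes (x t) p) -> MI C (of_void M) (fun=> tt) d -> Def C S ->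
  ~ forall i : nat, S (env_sum (fun q => x q.1 q.2) (d i.*2)) /\
                    ~ S (env_sum (fun q => x q.1 q.2) (d i.*2.+1)).
Proof.
move=> xp hd dS hS.
pose X := (('I_k * 'I_n) + ('I_m + 'I_m))%type.
pose z (i : nat) : X -> M := env_sum (fun q => x q.1 q.2) (env_sum (d i.*2) (d i.*2.+1)).
have sX : smallT kap X by exact: small_count.
have sO : smallT kap nat_chain by exact: small_nat.
have [z' zz'] := em_extract kapS M_sat C_small z sX sO.
pose coord (i : nat) (l : 'I_m) : X := inr (if odd i then inr l else inl l).
pose D (j : nat_chain) (l : 'I_m) : M := z' j./2 (coord j l).
pose x' (q : 'I_k * 'I_n) := z' 0 (inl q).
have zc i j l : z i (coord j l) = d (i.*2 + odd j) l.
  by rewrite /z /coord; case: (odd j); rewrite ?addn1 ?addn0.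
have Hx (o : nat) q : z' o (inl q) = x' q.
  have := em_Def zz' (E := bool) (x := fun=> inl q) (o := fun b => if b then o else 0 : nat_chain)
    (@Def_eq _ _ C _ true false).
  by apply.
have x'p t : realizes (fun l => x' (t, l)) p.
  move=> phi pphi; apply: (em_Def zz' (E := 'I_n) (x := fun l => inl (t, l)) (o := fun=> 0 :
    nat_chain) (Def_pholds phi)).
  by move=> i _; exact: xp.
have Sval b : (~~ odd b -> S (env_sum x' (D b))) /\ (odd b -> ~ S (env_sum x' (D b))).
  pose xx (a : ('I_k * 'I_n) + 'I_m) : X := match a with inl l => inl l | inr l => coord b l end.
  have -> : env_sum x' (D b) = fun a => z' (b./2 : nat_chain) (xx a).
    by apply/funext => -[l|l] //=; rewrite Hx.
  have Z (i : ('I_k * 'I_n) + 'I_m -> nat_chain) : pateq (fun=> b./2 : nat_chain) i ->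
      exists j, (fun a => z (i a) (xx a)) = env_sum (fun q => x q.1 q.2) (d (j.*2 + odd b)).
    move=> hi; have [e0 _|E0] := pickP (@predT (('I_k * 'I_n) + 'I_m)%type); last first.
      by exists 0; apply/funext => a; have := E0 a.
    exists (i e0); apply/funext => a; rewrite (@pateq_eq _ _ _ _ _ a e0 hi erefl).
    by case: a => l; [|exact: zc].
  split=> ob.
    apply: (em_Def zz' (o := fun=> b./2 : nat_chain) dS) => i /Z[j ->].
    by rewrite (negbTE ob) addn0; case: (hS j).
  apply: (em_Def zz' (o := fun=> b./2 : nat_chain) (Def_not dS)) => i /Z[j ->].
  by rewrite ob addn1; case: (hS j).
have Dd (E : Type) (y : E -> 'I_m) (s : E -> nat_chain) :
    tpeq C (fun a => d (s a) (y a)) (fun a => D (s a) (y a)).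
  apply: (em_tp zz' (x := fun a => coord (s a) (y a)) (o := fun a => (s a)./2)) => q f i hi.
  have -> : (fun a => z (i a) (coord (s (f a)) (y (f a)))) =
      fun a => d ((i a).*2 + odd (s (f a))) (y (f a)).
    by apply/funext => a; exact: zc.
  refine (alike_gen0 hd (x := y \o f) (s := s \o f) (t := (fun a => (i a).*2 + odd (s (f a))) :
    _ -> nat_chain) _).
  move=> a b _; have := hi b a; have := hi a b; rewrite /clt /=.
  rewrite -{3}(odd_double_half (s (f a))) -{3}(odd_double_half (s (f b))).
  move: (odd _) (odd _) (_./2) (_./2) => o1 o2 h1 h2.
  by case: o1; case: o2; lia.
have DMI : MI C (of_void M) (fun=> tt) D.
  apply: alike0 => q y s t hst.
  apply: tpeq_trans (tpeq_sym (Dd _ y s)) _; apply: tpeq_trans (Dd _ y t).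
  exact: (alike_gen0 hd).
(* The pairs [(D_2i, D_2i+1)] are indiscernible over [x']. *)
have shift (E : Type) (y : E -> 'I_m) (s : E -> nat) (N : nat) :
    tpeq C (env_sum (fun a => D (s a) (y a)) x') (env_sum (fun a => D (s a + N.*2) (y a)) x').
  apply: tpeq_fin => q f.
  pose B := \max_i (if f i is inl a then (s a)./2 else 0).
  pose o (N : nat) i : nat_chain := N + (if f i is inl a then (s a)./2 else B).
  pose xx i : X := match f i with inl a => coord (s a) (y a) | inr q => inl q end.
  have := alike_gen0 (em_MI zz') (x := xx) (s := o 0) (t := o N).
  rewrite (_ : (fun i => z' (o 0 i) (xx i)) = env_sum (fun a => D (s a) (y a)) x' \o f); last
    first.
    by apply/funext => i; rewrite /o /xx /=; case: (f i) => //= ?; rewrite Hx.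
  rewrite (_ : (fun i => z' (o N i) (xx i)) = env_sum (fun a => D (s a + N.*2) (y a)) x' \o f);
    last first.
    apply/funext => i; rewrite /o /xx /D /coord /=; case: (f i) => /= [a|?]; last by rewrite Hx.
    by rewrite halfD odd_double andbF add0n doubleK oddD odd_double addbF addnC.
  by move=> H; apply: H => a b _; rewrite /o /clt /= !add0n ltn_add2l.
pose U (j : nat) := ({t : 'I_k | t < j} * 'I_n)%type.
pose u j (v : U j) := x' (val v.1, v.2).
have ind j : j <= k -> MI C (u j) (fun=> tt) D.
  elim: j => [_|j IH jk].
    have U0 (v : U 0) : void by case: v => -[t]; rewrite ltn0.
    rewrite (_ : u 0 = of_void M \o U0); last by apply/funext => v; case: (U0 v).
    exact: (@alike_sub _ _ C _ _ _ _ _ _ _ _ _ _ _ _ _ _ U0 id _ DMI).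
  move=> q y s t hst S1 dS1 S1s; apply: contrapT => S1t.
  (* All indices in use lie within the first [N] pairs, so shifts by multiples of [N] pairs give
     disjoint consecutive copies. *)
  pose N := (\max_a maxn (s a) (t a)).+1.
  have sN a : s a < N.*2 by rewrite -addnn ltn_addr // ltnS (leq_trans (leq_maxl _ (t a))) //
    (leq_bigmax_cond (F := fun a => maxn (s a) (t a))).
  have tN a : t a < N.*2 by rewrite -addnn ltn_addr // ltnS (leq_trans (leq_maxr (s a) _)) //
    (leq_bigmax_cond (F := fun a => maxn (s a) (t a))).
  pose V (w : 'I_q -> nat) := S1 (env_sum (fun a => D (w a) (y a)) (u j.+1)).
  have Vshift w l : V w <-> V (fun a => w a + (N * l).*2).
    have /(@tpeq_comp _ _ _ _ _ (fun a : 'I_q + U j.+1 => match a with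
      inl a => inl a | inr v => inr (val v.1, v.2) end)) := shift _ y w (N * l).
    have E w' : env_sum (fun a => D (w' a) (y a)) x' \o (fun a : 'I_q + U j.+1 => match a with
        inl a => inl a | inr v => inr (val v.1, v.2) end) = env_sum (fun a => D (w' a) (y a)) (u
          j.+1).
      by apply/funext; case.
    by rewrite !E => h; exact: (tpeqE h dS1).
  pose w (l : nat) a : nat_chain := (if odd l then t a else s a) + (N * l).*2.
  have wlt l l' a a' : clt (w l a) (w l' a') = (l < l') || ((l == l') && (s a < s a')).
    have hst' : (t a < t a') = (s a < s a') by have /esym := hst a a' erefl.
    rewrite /w /clt /=; have [ll|ll|<-] := ltngtP l l'.
    - have : N * l.+1 <= N * l' by rewrite leq_mul2l ll orbT.
      rewrite mulnS; have := sN a; have := tN a; move: (N * l) (N * l') => x1 x2.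
      by case: (odd l); case: (odd l'); lia.
    - have : N * l'.+1 <= N * l by rewrite leq_mul2l ll orbT.
      rewrite mulnS; have := sN a'; have := tN a'; move: (N * l) (N * l') => x1 x2.
      by case: (odd l); case: (odd l'); lia.
    - by rewrite ltn_add2r; case: (odd l).
  pose d' (l : nat_chain) : 'I_q + U j -> M := env_sum (fun a => D (w l a) (y a)) (u j).
  have d'MI : MI C (of_void M) (fun=> tt) d'.
    apply: alike0 => r yy s' t' hst'.
    have hE : rowpat ((fun=> tt) \o (fun e : 'I_r * 'I_q => y e.2)) (fun e => w (s' e.1) e.2)
      (fun e => w (t' e.1) e.2).
      move=> [i a] [i' a'] _; apply: etrans (wlt _ _ _ _) _; apply: etrans _ (esym (wlt _ _ _ _)).
      congr (_ || (_ && _)); first exact: hst'.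
      have := hst' i i' erefl; have := hst' i' i erefl; rewrite /clt /=.
      by move: (s' i) (s' i') (t' i) (t' i') => /= *; apply/eqP/eqP; lia.
    have := alike_gen (IH (ltnW jk)) hE.
    pose g i : 'I_r * 'I_q + U j := match yy i with inl a => inl (i, a) | inr v => inr v end.
    move=> /(@tpeq_comp _ _ _ _ _ g).
    have E (w' : 'I_r -> nat) : env_sum (fun e : 'I_r * 'I_q => D (w (w' e.1) e.2) (y e.2)) (u
      j) \o g = fun i => d' (w' i) (yy i).
      by apply/funext => i; rewrite /g /d' /=; case: (yy i).
    by rewrite !E.
  pose g (a : 'I_q + U j.+1) : 'I_n + ('I_q + U j) := match a with
    | inl a => inr (inl a)
    | inr v => if pselect (val v.1 < j) is left h then inr (inr (exist _ (val v.1) h, v.2)) else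
      inl v.2 end.
  have E l : env_sum (fun b => x' (Ordinal jk, b)) (d' l) \o g = env_sum (fun a => D (w l a) (y
    a)) (u j.+1).
    apply/funext => -[a|[[tt htt] b]] //=; case: pselect => //= ntj.
    rewrite /u /=; congr (x' (_, _)); apply: val_inj => /=.
    by apply/eqP; rewrite eqn_leq leqNgt; move: htt; rewrite ltnS => ->; rewrite andbT;
      exact/negP.
  apply: (no_alternation (x'p (Ordinal jk)) d'MI (Def_rename g dS1)) => l.
  have e0 : w l.*2 = fun a => s a + (N * l.*2).*2 by apply/funext => a; rewrite /w odd_double.
  have e1 : w l.*2.+1 = fun a => t a + (N * l.*2.+1).*2 by apply/funext => a; rewrite /w /=
    odd_double.
  rewrite !E; split; first by change (V (w l.*2)); rewrite e0; exact: (Vshift s l.*2).1 S1s.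
  by change (~ V (w l.*2.+1)); rewrite e1 => /(Vshift t l.*2.+1).2.
have h01 : rowpat ((fun=> tt) \o @id 'I_m) (fun=> 0 : nat_chain) (fun=> 1 : nat_chain) by [].
have := alike_gen (ind k (leqnn k)) h01.
pose g (a : ('I_k * 'I_n) + 'I_m) : 'I_m + U k := match a with
  inl q => inr (exist _ q.1 (ltn_ord q.1), q.2) | inr l => inl l end.
move=> /(@tpeq_comp _ _ _ _ _ g).
have E b : env_sum (fun i : 'I_m => D b i) (u k) \o g = env_sum x' (D b).
  by apply/funext => -[[t l]|l].
by rewrite !E => /(_ S dS) H; apply: (Sval 1).2 => //; apply: H; apply: (Sval 0).1.
Qed.

End Dependent.

Section DependentDual.
Variables (L : language) (kap : Type) (M : structure L) (C : set M).
Hypothesis kapS : uncountable_strong_limit kap.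
Hypothesis M_sat : saturated kap M.
Hypothesis C_small : small kap C.
Variables (n : nat) (p : set (pformula 'I_n C)).
Hypothesis p_dep : dependent kap p.

Lemma no_alternation_tuple (k : nat) (Y : Type) (x : 'I_k -> 'I_n -> M) (d : nat_chain -> Y -> M)
    (S : set (('I_k * 'I_n) + Y -> M)) :
  (forall t, realizes (x t) p) -> MI C (of_void M) (fun=> tt) d -> Def C S ->
  ~ forall i : nat, S (env_sum (fun q => x q.1 q.2) (d i.*2)) /\
                    ~ S (env_sum (fun q => x q.1 q.2) (d i.*2.+1)).
Proof.
move=> xp hd /Def_restrict_right[m [f [S' [dS' hS']]]] hS.
apply: (@no_alternation_tuple_fin _ kap _ C kapS M_sat C_small _ p p_dep k m x (fun i => d i \o
  f) S' xp _ dS').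
  by have := alike_sub (r' := fun=> tt) (f := id) (g := f) _ hd; apply.
by move=> i; rewrite -!hS'.
Qed.

(* If [S (e_j, a)] alternated, indiscernibility would give [a_i] such that
   [S (e_j, a_i)] holds iff [i] belongs to the finite set coded by [j], and then
   some realization of [p] alternates on an indiscernible sequence like [a_i]. *)
Lemma no_alternation_dual (m : nat) (e : nat_chain -> 'I_n -> M) (a : 'I_m -> M)
    (S : set ('I_n + 'I_m -> M)) :
  (forall i, realizes (e i) p) -> MI C (of_void M) (fun=> tt) e -> Def C S ->
  ~ forall i : nat, S (env_sum (e i.*2) a) /\ ~ S (env_sum (e i.*2.+1) a).
Proof.
move=> ep he dS hS.
pose bit (i j : nat) := if (unpickle j : option (seq nat)) is Some s then i \in s else false.
have ex_a i : exists a' : 'I_m -> M, forall j, S (env_sum (e j) a') <-> bit i j.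
  (* e_j is moved to e_2j, where [S] holds, or to e_(2j+1), where it fails, as [bit] prescribes. *)
  pose f (j : nat) : nat_chain := j.*2 + ~~ bit i j.
  have hf : rowpat ((fun=> tt) \o @snd nat 'I_n) (f \o fst) (fst : _ -> nat_chain).
    apply/rowpat_sym/pateq_rowpat.
    exact: (@pateq_double _ nat_chain fst fst (fun x => ~~ bit i x.1) (fun _ _ => erefl) (fun x
      y (h : x.1 = y.1) => congr1 (fun j => ~~ bit i j) h)).
  have [||a' ha'] := tpeq_extend kapS M_sat C_small a _ _ (alike_gen0 he hf).
  - exact: small_count.
  - exact: small_count.
  exists a' => j.
  pose g (x : 'I_n + 'I_m) : 'I_m + nat * 'I_n := match x with inl l => inr (j, l) | inr y =>
    inl y end.
  have := tpeqE (tpeq_comp (s := g) ha') dS.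
  have E1 (u : nat * 'I_n -> M) (v : 'I_m -> M) : env_sum v u \o g = env_sum (fun l => u (j, l))
    v.
    by apply/funext; case.
  rewrite !E1 /= => <-; rewrite /f; have [h1 h2] := hS j.
  by case: (bit i j); rewrite ?addn0 ?addn1.
have [a_ ha_] := choice ex_a.
have [pt] := carrier_inhabited M.
(* The extra coordinate keeps the index visible when [m = 0]. *)
pose X := option 'I_m.
pose z (i : nat) (x : X) : M := if x is Some l then a_ i l else pt.
have sX : smallT kap X by exact: small_count.
have sO : smallT kap nat_chain by exact: small_nat.
have [z' zz'] := em_extract kapS M_sat C_small z sX sO.
pose b (i : nat_chain) (l : 'I_m) : M := z' i (Some l).
have bMI : MI C (of_void M) (fun=> tt) b.
  by have := alike_sub (r' := fun=> tt) (f := id) (g := @Some 'I_m) _ (em_MI zz'); apply.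
pose A := ({phi | p phi} + nat)%type.
pose Q (q : A) : set ('I_n + nat * 'I_m -> M) := match q with
  | inl phi => fun w => pholds (w \o inl) (sval phi)
  | inr i => fun w => if odd i then ~ S (w \o (fun x => match x with inl l => inl l | inr l =>
    inr (i, l) end))
                      else S (w \o (fun x => match x with inl l => inl l | inr l => inr (i, l)
                        end)) end.
have dQ q : Def C (Q q).
  case: q => [phi|i] /=; first exact: Def_rename (Def_pholds _).
  by case: (odd i); [apply: Def_not|]; exact: Def_rename.
have [|||c hc] := @compactness _ _ _ C kapS M_sat C_small _ _ _ (fun q : nat * 'I_m => b q.1
  q.2) Q _ _ dQ.
- exact: small_count.
- exact: small_count.
- move=> l.
  pose N := (foldr maxn 0 (map (fun q : A => if q is inr i then i else 0) l)).+1.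
  have lN i : List.In (inr i) l -> i < N.
    rewrite /N ltnS; elim: (l) => //= q l' IH [->|/IH h]; first exact: leq_maxl.
    exact: leq_trans h (leq_maxr _ _).
  pose E := ('I_N * X)%type.
  pose g (x : 'I_n + nat * 'I_m) : 'I_n + E := match x with
    | inl l => inl l | inr (i, l) => inr (inord i, Some l) end.
  have dE : Def C (fun w : E -> M => exists v, forall q, List.In q l -> Q q (env_sum v w \o g)).
    apply: (Def_ex (S := fun w => forall q, List.In q l -> Q q (w \o g))).
    by apply: Def_all => q _; exact: Def_rename.
  have [i|v hv] := em_Def zz' (x := @snd 'I_N X) (o := (fun q : E => q.1 : nat) : _ ->
    nat_chain) dE.
    move=> hi.
    (* The indices in even position: the realization with code [s] satisfies [S] exactly there. *)
    pose s : seq nat := map (fun q : 'I_N => i (q, None)) (seq.filter (fun q : 'I_N => ~~ odd q)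
      (enum 'I_N)).
    have si (q : 'I_N) : (i (q, None) \in s) = ~~ odd q.
      apply/mapP/idP => [[q']|oq]; last by exists q => //; rewrite mem_filter oq mem_enum.
      rewrite mem_filter => /andP[oq' _] eqq.
      by rewrite (_ : q = q')//; apply: val_inj; exact: (@pateq_eq _ _ _ _ _ (q, None) (q',
        None) (pateq_sym hi) eqq).
    exists (e (pickle s)) => -[[phi pphi]|k] /= ql; first exact: ep.
    have kN : k < N by exact: lN.
    have E1 : (env_sum (e (pickle s)) (fun a0 => z (i a0) a0.2) \o g) \o
        (fun x => match x with inl l => inl l | inr l => inr (k, l) end) =
        env_sum (e (pickle s)) (a_ (i (inord k, None))).
      apply/funext => -[//|y] /=.
      by rewrite (@pateq_eq _ _ _ _ _ (inord k, Some y) (inord k, None) hi erefl).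
    have bE : bit (i (inord k, None)) (pickle s) = ~~ odd k.
      by rewrite /bit pickleK si inordK.
    case: ifP => ok; rewrite E1; first by rewrite ha_ bE ok.
    by apply/ha_; rewrite bE ok.
  exists v => q ql; have := hv q ql.
  rewrite /Q; case: q ql => // i /lN iN.
  have E1 : (env_sum v (fun a0 : E => z' (a0.1 : nat) a0.2) \o g) \o
      (fun x => match x with inl l => inl l | inr l => inr (i, l) end) =
      env_sum v (fun q : nat * 'I_m => b q.1 q.2) \o
      (fun x => match x with inl l => inl l | inr l => inr (i, l) end).
    by apply/funext => -[//|y] /=; rewrite inordK.
  by rewrite E1.
have cp : realizes c p by move=> phi pphi; exact: (hc (inl (exist _ phi pphi))).
apply: (no_alternation kapS M_sat C_small p_dep cp bMI dS) => i.
have hE j : env_sum c (fun q : nat * 'I_m => b q.1 q.2) \o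
    (fun x => match x with inl l => inl l | inr l => inr (j, l) end) = env_sum c (b j).
  by apply/funext; case.
have := hc (inr i.*2); have := hc (inr i.*2.+1); rewrite /= odd_double /= !hE.
by move=> h1 h2; split.
Qed.

(** Without a bound, alternations of every finite length exist. Compactness realizes all definable
    conditions that hold for every alternation of some length, and the result alternates forever. *)
Lemma uniform_alternation_bound (m : nat) (S : set ('I_n + 'I_m -> M)) : Def C S ->
  exists k, forall (e : nat_chain -> 'I_n -> M) (a : 'I_m -> M),
    (forall i, realizes (e i) p) -> MI C (of_void M) (fun=> tt) e ->
    ~ forall i, i < k -> S (env_sum (e i.*2) a) /\ ~ S (env_sum (e i.*2.+1) a).
Proof.
move=> dS; apply: contrapT => H.
pose bad k (e : nat -> 'I_n -> M) (a : 'I_m -> M) :=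
  [/\ forall i, realizes (e i) p, @MI _ _ C _ _ _ nat_chain (of_void M) (fun=> tt) e &
     forall i, i < k -> S (env_sum (e i.*2) a) /\ ~ S (env_sum (e i.*2.+1) a)].
have ex_bad k : exists e a, bad k e a.
  apply: contrapT => H1; apply: H; exists k => e a h1 h2 h3; apply: H1; exists e, a.
  by split.
pose X := (nat * 'I_n + 'I_m)%type.
pose env (e : nat -> 'I_n -> M) (a : 'I_m -> M) : X -> M := env_sum (fun q => e q.1 q.2) a.
pose A := {Q : set (X -> M) | Def C Q /\ exists k, forall e a, bad k e a -> Q (env e a)}.
have [|[Q []] //|l|w hw] := compactness0 kapS M_sat C_small (S := fun q : A => sval q).
- exact: small_count.
- have [K hK] : exists K, forall e a, bad K e a -> forall q : A, List.In q l -> sval q (env e a).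
    elim: l => [|[Q [dQ [k hk]]] l [K hK]]; first by exists 0.
    exists (maxn k K) => e a [h1 h2 h3] q [<-|ql] /=.
      by apply: hk; split=> // i ik; apply: h3; exact: leq_trans ik (leq_maxl _ _).
    by apply: hK ql; split=> // i ik; apply: h3; exact: leq_trans ik (leq_maxr _ _).
  by have [e [a ea]] := ex_bad K; exists (env e a); exact: hK.
pose e (i : nat_chain) (l : 'I_n) := w (inl (i, l)); pose a l := w (inr l).
have use (Q : set (X -> M)) : Def C Q -> (exists k, forall e a, bad k e a -> Q (env e a)) -> Q w.
  by move=> dQ hQ; exact: (hw (exist _ Q (conj dQ hQ))).
apply: (@no_alternation_dual m e a S) => //.
- move=> i phi pphi.
  apply: (use _ (Def_rename (fun l => inl (i, l)) (Def_pholds phi))).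
  by exists 0 => e' a' [h _ _]; exact: h.
- apply: alike0 => q x s t hst S' dS'.
  apply: (use _ (Def_imp (Def_rename (fun a => inl (s a, x a)) dS') (Def_rename (fun a => inl (t
    a, x a)) dS'))).
  by exists 0 => e' a' [_ h _]; exact: (alike_gen0 h hst).
- move=> i.
  pose g j (x : 'I_n + 'I_m) : X := match x with inl l => inl (j, l) | inr y => inr y end.
  have gE j e' a' : env e' a' \o g j = env_sum (e' j) a' by apply/funext; case.
  have wE j : w \o g j = env_sum (e j) a by apply/funext; case.
  rewrite -!wE; apply: (use (fun w => S (w \o g i.*2) /\ ~ S (w \o g i.*2.+1))).
    by apply: Def_and; [|apply: Def_not]; exact: Def_rename.
  by exists i.+1 => e' a' [_ _ h]; rewrite !gE; exact: h.
Qed.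

End DependentDual.

(** * Arrays of realizations of a dependent type *)

(* [chi (y; x, x', d)] says [S (x, y) /\ ~ S (x', y)], where [d] collects the
   parameters from [C] occurring in [S]. *)
Lemma alternation_formula (L : language) (M : structure L) (C : set M) (n k : nat)
    (S : set ('I_n + 'I_k -> M)) : Def C S ->
  exists m (chi : formula L ('I_k + 'I_m)) (par : ('I_n -> M) -> ('I_n -> M) -> 'I_m -> M),
    forall y x x', holds (env_sum y (par x x')) chi <-> S (env_sum x y) /\ ~ S (env_sum x' y).
Proof.
move=> [phi hphi]; have [F [f [phi' e]]] := formula_factor phi.
have [pt] := carrier_inhabited M.
pose P := ('I_n + 'I_n + F)%type.
pose r (b : bool) (i : F) : 'I_k + 'I_#|{: P}| := match f i with
  | inl (inl l) => inr (enum_rank (inl (if b then inl l else inr l) : P))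
  | inl (inr y) => inl y
  | inr c => inr (enum_rank (inr i : P)) end.
exists #|{: P}|, (fnot (fimp (frename (r true) phi') (frename (r false) phi'))).
exists (fun x x' => env_sum (env_sum x x') (fun i => if f i is inr c then val c else pt) \o
  enum_val).
move=> y x x'.
set par := _ \o enum_val.
have H b : holds (env_sum y par) (frename (r b) phi') <-> S (env_sum (if b then x else x') y).
  rewrite -hphi e /pholds !holds_rename.
  rewrite (_ : _ \o r b = env_sum (env_sum (if b then x else x') y) set_val \o f)//.
  apply/funext => i; rewrite /r /par /=.
  by case E: (f i) => [[l|l]|c] //=; rewrite enum_rankK //=; [case: b|rewrite E].
rewrite /= (H true) (H false); split=> [h|[h1 h2] /(_ h1) //].
by split=> [|h2]; [apply: contrapT => h'; apply: h => /h'|apply: h].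
Qed.

Lemma incr_in_card (D : set nat) (k : nat) : D #= `I_k ->
  exists2 g, incr g & forall i, i < k -> D (g i).
Proof.
move=> /card_esym/card_eqPle[/pcard_leP[h] _].
pose s := sort leq (map h (iota 0 k)).
have su : uniq s.
  rewrite sort_uniq map_inj_in_uniq ?iota_uniq // => i j; rewrite !mem_iota /= !add0n => ik jk.
  by apply: (@inj _ _ _ h); rewrite inE.
have ss : size s = k by rewrite size_sort size_map size_iota.
have sD x : x \in s -> D x.
  rewrite mem_sort => /mapP[i]; rewrite mem_iota add0n => ik ->; exact: (@funS _ _ _ _ h).
have sl : sorted ltn s by rewrite ltn_sorted_uniq_leq su sort_sorted // => x y; exact: leq_total.
pose N := \max_(x <- s) x.
exists (fun i => if i < k then nth 0 s i else N + i) => [|i ik]; last first.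
  by rewrite ik; apply: sD; rewrite mem_nth // ss.
apply: incrS => i; case: (ltnP i k) => ik.
  case: (ltnP i.+1 k) => ik'; first by apply: (sorted_ltn_nth ltn_trans 0 sl); rewrite ?inE ?ss.
  by rewrite addnS ltnS (leq_trans _ (leq_addr _ _)) // /N (leq_bigmax_seq (F := id)) // mem_nth
    // ss.
by rewrite (ltnNge i.+1) (leq_trans ik (leqnSn i)) ltn_add2l.
Qed.

Section Array.
Variables (L : language) (kap : Type) (M : structure L) (C : set M).
Hypothesis kapS : uncountable_strong_limit kap.
Hypothesis M_sat : saturated kap M.
Hypothesis C_small : small kap C.
Variables (n : nat) (p : set (pformula 'I_n C)).
Hypothesis p_dep : dependent kap p.
Hypothesis M_NTP2 : NTP2 M.

Definition broken_rows (k : nat) (S : set ('I_n + 'I_k -> M)) (N : nat) (e : nat -> nat -> 'I_n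
  -> M) :=
  exists a : 'I_k -> M,
  [/\ @MI _ _ C _ _ _ nat_chain (of_void M) fst (fun i (q : 'I_N * 'I_n) => e q.1 i q.2),
      forall t i, t < N -> realizes (e t i) p &
      forall t, t < N -> S (env_sum (e t 0) a) /\ ~ S (env_sum (e t 1) a)].

(** Compactness turns arbitrarily many rows into infinitely many. Paths are consistent because
    mutual indiscernibility moves the pair of terms 0 and 1 of each row to the pair chosen by [eta],
    independently of the other rows. *)
Lemma broken_rows_bounded (k : nat) (S : set ('I_n + 'I_k -> M)) : Def C S ->
  ~ forall N, exists e, broken_rows S N e.
Proof.
move=> dS H.
have [k0 hk0] := uniform_alternation_bound kapS M_sat C_small p_dep dS.
pose X := (nat * nat * 'I_n)%type.
pose env (e : nat -> nat -> 'I_n -> M) : X -> M := fun q => e q.1.1 q.1.2 q.2.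
pose A := {Q : set (X -> M) | Def C Q /\ exists N, forall N' e, N <= N' -> broken_rows S N' e ->
  Q (env e)}.
have [|[Q []] //|l|w hw] := compactness0 kapS M_sat C_small (S := fun q : A => sval q).
- exact: small_count.
- have [K hK] : exists K, forall e, broken_rows S K e -> forall q : A, List.In q l -> sval q
  (env e).
    suff [K hK] : exists K, forall N' e, K <= N' -> broken_rows S N' e -> forall q : A, List.In
      q l -> sval q (env e).
      by exists K => e; exact: hK.
    elim: l => [|[Q [dQ [N hN]]] l [K hK]]; first by exists 0.
    exists (maxn N K) => N' e; rewrite geq_max => /andP[h1 h2] he q [<-|ql] /=; first exact: hN
      he.
    exact: hK he _ ql.
  by have [e he] := H K; exists (env e); exact: hK.
pose e t (i : nat_chain) (l : 'I_n) := w (t, i, l).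
have use (Q : set (X -> M)) : Def C Q ->
    (exists N, forall N' e, N <= N' -> broken_rows S N' e -> Q (env e)) -> Q w.
  by move=> dQ hQ; exact: (hw (exist _ Q (conj dQ hQ))).
have ep t i : realizes (e t i) p.
  move=> phi pphi.
  apply: (use _ (Def_rename (fun l => (t, i, l)) (Def_pholds phi))).
  by exists t.+1 => N e' tN [a [_ h _]]; exact: (h t i tN).
have eMI t : MI C (of_void M) (fun=> tt) (e t).
  apply: alike0 => q x s s' hst S' dS'.
  apply: (use _ (Def_imp (Def_rename (fun a => (t, s a, x a)) dS') (Def_rename (fun a => (t, s'
    a, x a)) dS'))).
  exists t.+1 => N e' tN [a [h _ _]].
  have hst' : rowpat (fst \o (fun a => (Ordinal tN, x a))) s s' by move=> i j _; exact: hst.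
  exact: (alike_gen0 h hst').
have path (eta : nat -> nat) N : exists y, forall t, t < N ->
    S (env_sum (e t (eta t).*2) y) /\ ~ S (env_sum (e t (eta t).*2.+1) y).
  pose g (th : nat -> nat) (t : 'I_N) b (x : 'I_n + 'I_k) : 'I_k + X := match x with
    inl l => inr (t : nat, th t + nat_of_bool b, l) | inr y => inl y end.
  pose Q1 th (t : 'I_N) := fun v : 'I_k + X -> M => S (v \o g th t false) /\ ~ S (v \o g th t
    true).
  have dQ1 th t : Def C (Q1 th t) by apply: Def_and; [|apply: Def_not]; exact: Def_rename.
  have dQ th : Def C (fun u : X -> M => exists y, forall t, List.In t (enum 'I_N) -> Q1 th t
    (env_sum y u)).
    by apply: (Def_ex (S := fun v => forall t, List.In t (enum 'I_N) -> Q1 th t v)); apply: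
      Def_all.
  have gE th t b y (e' : nat -> nat -> 'I_n -> M) : env_sum y (env e') \o g th t b = env_sum (e'
    t (th t + b)) y.
    by apply/funext; case.
  have in_enum (t : 'I_N) : List.In t (enum 'I_N).
    have : t \in enum 'I_N by rewrite mem_enum.
    by elim: (enum 'I_N) => //= b s IH; rewrite inE => /orP[/eqP->|/IH]; [left|right].
  have [|y hy] := use _ (dQ (fun t => (eta t).*2)).
    exists N => N' e' NN' [a [h _ h3]].
    pose cast (i : 'I_N) : 'I_N' := widen_ord NN' i.
    pose gg th (x : 'I_N * bool * 'I_n) : nat_chain := th (x.1.1 : nat) + x.1.2.
    have hst : rowpat (fst \o (fun x : 'I_N * bool * 'I_n => (cast x.1.1, x.2)))
       (gg (fun=> 0)) (gg (fun t => (eta t).*2)).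
      move=> [[t b] l] [[t' b'] l'] /= [] /val_inj ->; rewrite /gg /clt /=.
      by rewrite !ltn_add2l.
    have := alike_gen0 h hst.
    pose Q2 (u : 'I_N * bool * 'I_n -> M) := exists y, forall t, List.In t (enum 'I_N) ->
       S (env_sum (fun l => u (t, false, l)) y) /\ ~ S (env_sum (fun l => u (t, true, l)) y).
    have dQ2 : Def C Q2.
      pose g2 (t : 'I_N) b (x : 'I_n + 'I_k) : 'I_k + 'I_N * bool * 'I_n := match x with
        inl l => inr (t, b, l) | inr y => inl y end.
      apply: (@Def_ext _ _ _ _ (fun u => exists y, forall t, List.In t (enum 'I_N) ->
        S (env_sum y u \o g2 t false) /\ ~ S (env_sum y u \o g2 t true))).
        move=> u; have E t b y : env_sum y u \o g2 t b = env_sum (fun l => u (t, b, l)) y.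
          by apply/funext; case.
        by split=> -[y hy]; exists y => t /hy; rewrite !E.
      apply: (Def_ex (S := fun v => forall t, List.In t (enum 'I_N) ->
        S (v \o g2 t false) /\ ~ S (v \o g2 t true))); apply: Def_all => t _.
      by apply: Def_and; [|apply: Def_not]; exact: Def_rename.
    move=> /(_ Q2 dQ2)[|y hy].
      by exists a => t _; have := h3 t (leq_trans (ltn_ord t) NN').
    by exists y => t /hy; rewrite /Q1 !gE.
  exists y => t tN; have := hy _ (in_enum (Ordinal tN)).
  have wE : w = env e by apply/funext => -[[]].
  by rewrite /Q1 wE !gE /= addn0 addn1.
have [m [chi [par hpar]]] := alternation_formula dS.
apply: M_NTP2; exists k, m, chi, (fun t j => par (e t j.*2) (e t j.*2.+1)), k0; split.
  move=> t D Dk cons.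
  have Dfin : finite_set D by exists k0.
  have [y hy] := cons D Dfin (fun _ h => h).
  have [g gi gD] := incr_in_card Dk.
  (* The pairs of row [t] whose numbers are enumerated by [g]; a common solution [y] would alternate
     [k0] times along them. *)
  pose e' (i : nat_chain) : 'I_n -> M := e t ((g i./2).*2 + odd i).
  apply: (hk0 e' y) => [i| |i ik]; first exact: ep.
    apply: alike0 => q x s s' hst.
    pose G (i : nat_chain) : nat_chain := (g i./2).*2 + odd i.
    have Glt i j : clt (G i) (G j) = clt i j.
      have key (g1 g2 h1 h2 : nat) (a b : bool) : (g1 < g2) = (h1 < h2) -> (g2 < g1) = (h2 < h1)
        ->
          (g1.*2 + a < g2.*2 + b) = (a + h1.*2 < b + h2.*2) by case: a; case: b; lia.
      by rewrite /clt /= (key _ _ _ _ _ _ (incr_le gi _ _) (incr_le gi _ _)) !odd_double_half.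
    have hG : rowpat ((fun=> tt) \o x) (G \o s) (G \o s') by move=> a b h; rewrite /comp !Glt;
      exact: hst.
    exact: (alike_gen0 (eMI t) hG).
  have /hpar := hy _ (gD i ik).
  by rewrite /e' doubleK /= odd_double uphalf_double /= addn0 addn1.
move=> eta D' Dfin _.
have [l hl] := finite_set_list Dfin.
have [y hy] := path eta (foldr maxn 0 l).+1.
exists y => j /hl jl; apply/hpar; apply: hy; rewrite ltnS.
elim: l jl {hl} => //= q l' IH [->|/IH h]; first exact: leq_maxl.
exact: leq_trans h (leq_maxr _ _).
Qed.

End Array.

(** * Adding a row *)

Section MoreEM.
Variables (L : language) (M : structure L) (C : set M).
Variables (X : Type) (x0 : X) (O : chain) (z : nat -> X -> M) (z' : O -> X -> M).
Hypothesis zz' : em_of C z z'.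

(* The coordinate [x0] makes every index of [G] occur in the tuple. *)
Lemma em_Def_grouped (E G : finType) (x : E -> X) (gam : E -> G) (o : G -> O) (S : set (E -> M)) :
  Def C S ->
  (forall i : G -> nat_chain, pateq o i -> S (fun a => z (i (gam a)) (x a))) ->
  S (fun a => z' (o (gam a)) (x a)).
Proof.
move=> dS hS.
pose x1 (a : E + G) := match a with inl a => x a | inr _ => x0 end.
pose o1 (a : E + G) := match a with inl a => o (gam a) | inr g => o g end.
have := em_Def zz' (x := x1) (o := o1) (Def_rename (@inl E G) dS); apply => i hi.
have -> : (fun a => z (i a) (x1 a)) \o inl = fun a => z (i (inr (gam a))) (x a).
  by apply/funext => a /=; rewrite (@pateq_eq _ _ _ _ _ (inl a) (inr (gam a)) hi erefl).
by apply: (hS (i \o inr)) => g g'; exact: (hi (inr g) (inr g')).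
Qed.

Lemma em_tp_const (E : Type) (x : E -> X) (o : O) (v : E -> M) :
  (forall j, tpeq C v (fun a => z j (x a))) -> tpeq C v (fun a => z' o (x a)).
Proof.
move=> h; apply: tpeq_fin => m f S dS Sv.
apply: (@em_Def_grouped 'I_m unit (x \o f) (fun=> tt) (fun=> o) S dS) => i _.
exact: (tpeq_comp (s := f) (h (i tt)) dS Sv).
Qed.

End MoreEM.

(** Form of [alike_gen] for tuples mixing parameters and terms; only the terms constrain the
    indices. *)
Lemma MI_move (L : language) (M : structure L) (C : set M) (V X T E : Type) (O : chain)
    (v : V -> M) (r : X -> T) (y : O -> X -> M) (x : E -> V + X) (s t : E -> O) :
  MI C v r y ->
  (forall a b xa xb, x a = inr xa -> x b = inr xb -> r xa = r xb ->
     clt (s a) (s b) = clt (t a) (t b)) ->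
  tpeq C (fun a => match x a with inl w => v w | inr b => y (s a) b end)
         (fun a => match x a with inl w => v w | inr b => y (t a) b end).
Proof.
move=> hy hst.
pose E' := {q : E * X | x q.1 = inr q.2}.
have g a : {e : E' + V | match e with
    | inl q => (sval q).1 = a | inr w => x a = inl w end}.
  case e: (x a) => [w|b]; first by exists (inr w).
  by exists (inl (exist _ (a, b) e)).
have hst' : rowpat (r \o (fun q : E' => (sval q).2)) (fun q : E' => s (sval q).1) (fun q : E' =>
  t (sval q).1).
  by move=> [[a xa] /= ea] [[b xb] /= eb]; exact: hst.
have := alike_gen hy hst'; move=> /(@tpeq_comp _ _ _ _ _ (fun a => sval (g a))).
have E1 (w : E -> O) : env_sum (fun q : E' => y (w (sval q).1) (sval q).2) v \o (fun a => sval
  (g a)) =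
    fun a => match x a with inl u => v u | inr b => y (w a) b end.
  apply/funext => a /=; case: (g a) => -[[[a' b] /= e]|u] /=; first by move=> <-; rewrite e.
  by move=> ->.
by rewrite !E1.
Qed.

Section Stage.
Variables (L : language) (kap : Type) (M : structure L) (C : set M).
Hypothesis kapS : uncountable_strong_limit kap.
Hypothesis M_sat : saturated kap M.
Hypothesis C_small : small kap C.
Variables (n : nat) (p : set (pformula 'I_n C)).
Hypothesis p_dep : dependent kap p.
Variables (K XB : Type) (rB : XB -> K) (c : 'I_n -> M) (B0 : nat_chain -> XB -> M).
Hypothesis XB_small : smallT kap XB.
Hypothesis c_p : realizes c p.
Variables (k : nat) (Phi : set ('I_n + 'I_k -> M)).
Hypothesis dPhi : Def C Phi.

Definition flat (X : Type) (y : nat_chain -> X -> M) (q : nat * X) : M := y q.1 q.2.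

(** Two groupings of the same coordinates: here [W] is one sequence of long tuples, whereas
    [tuple_row_of] makes a separate row of each tuple of realizations. *)
Definition row_of (W : Type) (x : W + XB) : option K :=
  match x with inl _ => None | inr b => Some (rB b) end.

Definition tuple_row_of (Rw : Type) (x : Rw * 'I_n + XB) : Rw + K :=
  match x with inl q => inl q.1 | inr b => inr (rB b) end.

Definition select (Rw W : Type) (e : Rw -> 'I_n -> W) (x : Rw * 'I_n + XB) : W + XB :=
  match x with inl q => inl (e q.1 q.2) | inr b => inr b end.

(* The coordinates [al] of the first row play the role of the sequence [I_0];
   the rows selected by [e], each broken by every term of it, consist of
   realizations of [p]; the coordinates in [XB] play the role of the other [I_i]. *)
Record stage (Rw : finType) (W : Type) (al : 'I_k -> W) (e : Rw -> 'I_n -> W)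
    (y : nat_chain -> W + XB -> M) : Prop := Stage {
  stage_small : smallT kap W;
  stage_MI : MI C (of_void M) (@row_of W) y;
  stage_rows : MI C (of_void M) (@tuple_row_of Rw) (fun i => y i \o select e);
  stage_p : forall t i, realizes (fun l => y i (inl (e t l))) p;
  stage_broken : forall t,
    Phi (env_sum (fun l => y 0 (inl (e t l))) (fun l => y 0 (inl (al l)))) /\
    ~ Phi (env_sum (fun l => y 0 (inl (e t l))) (fun l => y 1 (inl (al l))));
  stage_next : exists c' : 'I_n -> M,
    [/\ tpeq C (env_sum c' (flat (fun i b => y i (inr b)))) (env_sum c (flat B0)),
        Phi (env_sum c' (fun l => y 0 (inl (al l)))) &
        forall j, ~ Phi (env_sum c' (fun l => y j.+1 (inl (al l))))] }.

Definition with_first (J : nat_chain -> 'I_n -> M) (B : nat_chain -> XB -> M) (i : nat_chain) :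
  'I_n + XB -> M := env_sum (J i) (B i).

(* What the failure of the theorem gives: [(c', B)] is a copy of [c] and the [I_i],
   [i <> i0]. *)
Hypothesis star : forall (U : Type) (u : U -> M) (B : nat_chain -> XB -> M) (c' : 'I_n -> M)
    (J : nat_chain -> 'I_n -> M),
  tpeq C (env_sum c (flat B0)) (env_sum c' (flat B)) -> (forall i, realizes (J i) p) ->
  MI C u (@row_of 'I_n) (with_first J B) -> MI C (env_sum u c') (fun=> tt) J.

(** The blocks (a, 0) are those in use; the blocks (a, i) with i > 0 are spare ones between them.
    [O3] adds the position inside a piece. *)
Definition O2 := lex_chain nat_chain nat_chain.
Definition O3 := lex_chain O2 nat_chain.

(** * Construction of the next stage *)

Section Step.
Variables (Rw : finType) (W : Type) (al : 'I_k -> W) (e : Rw -> 'I_n -> W)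
  (y : nat_chain -> W + XB -> M).
Hypothesis st : stage al e y.

(** A block is one long tuple: the element c_q, the [W]-part and the whole piece B_q. *)
Definition Z := ('I_n + (W + nat * XB))%type.

Definition zcoord (j : nat) (x : W + XB) : Z :=
  match x with inl w => inr (inl w) | inr b => inr (inr (j, b)) end.

(** Position in the stretched system: a piece fills the omega places of its block, a [W]-entry the
    first of them. *)
Definition idx (q : O2) (j : nat) (x : W + XB) : O3 :=
  match x with inl _ => (q, 0) | inr _ => (q, j) end.

Lemma clt_O3 (a i j a' i' j' : nat) :
  clt (((a, i), j) : O3) ((a', i'), j') =
  (a < a') || (a == a') && ((i < i') || (i == i') && (j < j')).
Proof.
rewrite /clt /= /lexi /= /clt /= /lexi /= /clt /=.
by case: (ltngtP a a'); case: (ltngtP i i').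
Qed.

Lemma clt_O2_first (a a' : nat) : clt ((a, 0) : O2) (a', 0) = (a < a').
Proof. by rewrite /clt /= /lexi /clt /= andbF orbF. Qed.

Lemma clt_O3_first (a a' : nat) : clt (((a, 0), 0) : O3) ((a', 0), 0) = (a < a').
Proof. by rewrite clt_O3 ltnn !andbF orbF. Qed.

Lemma idxE (q : O2) (j : nat) (x : W + XB) : idx q j x = (q, if x is inl _ then 0 else j).
Proof. by case: x. Qed.

(** [sd_ind] treats each block as a single term. [sd_sys] says that without the c_q the blocks form
    a stretched copy of [y], whose rows move independently. *)
Record step_data (z : O2 -> Z -> M) : Prop := StepData {
  sd_ind : MI C (of_void M) (fun=> tt) z;
  sd_sys : forall m (x : 'I_m -> W + XB) (q : 'I_m -> O2) (j : 'I_m -> nat) (t : 'I_m ->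
    nat_chain),
    rowpat (@row_of W \o x) (fun a => idx (q a) (j a) (x a)) t ->
    tpeq C (fun a => y (t a) (x a)) (fun a => z (q a) (zcoord (j a) (x a)));
  sd_cB : forall q, tpeq C (env_sum c (flat B0))
     (env_sum (fun l => z q (inl l)) (flat (fun i b => z q (zcoord i (inr b)))));
  sd_Phi : forall q, Phi (env_sum (fun l => z q (inl l)) (fun l => z q (inr (inl (al l)))));
  sd_nPhi : forall q q', clt q q' ->
    ~ Phi (env_sum (fun l => z q (inl l)) (fun l => z q' (inr (inl (al l))))) }.

(** If ['I_k] were empty, [Phi] could not tell a_0 from a_1. *)
Lemma W_inhabited : exists w : W, True.
Proof.
have [c' [_ h0 /(_ 0) h1]] := stage_next st.
have [l _|k0] := pickP (@predT 'I_k); first by exists (al l).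
case: h1; rewrite (_ : (fun l => y 1 _) = fun l => y 0 (inl (al l)))//.
by apply/funext => l; have := k0 l.
Qed.

Lemma step_data_exists : exists z, step_data z.
Proof.
have [c' [c'B c'0 c'1]] := stage_next st.
have sO : smallT kap O2 by exact: small_count.
have sWX : smallT kap (W + XB)%type by apply: small_sum => //; exact: stage_small st.
have [y' yy'] := MI_stretch kapS M_sat C_small sWX sO (stage_MI st).
(* c_i has to see a_i, a_(i+1), ... and B_i: the [W]-entry number [j] goes to the start of block
   [i + j], the other entries stay in block [i]. *)
pose ix (i : nat) (q : nat * (W + XB)) : O2 := match q.2 with inl _ => (i + q.1, 0) | inr _ =>
  (i, q.1) end.
have ixp i : rowpat (@row_of W \o snd) (fst : nat * (W + XB) -> nat_chain) (ix i).
  move=> [j [w|b]] [j' [w'|b']] //= _; rewrite /clt /= /lexi /= /clt /=.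
    by rewrite ltn_add2l ltnn andbF orbF.
  by rewrite ltnn.
have ex_c i : exists ci : 'I_n -> M, tpeq C (env_sum c' (flat y)) (env_sum ci (fun q => y' (ix i
  q) q.2)).
  apply: (tpeq_extend kapS M_sat C_small); first exact: small_count.
    by apply: small_prod => //; exact: small_nat.
  exact: (alike_gen0 yy' (ixp i)).
have [ci hci] := choice ex_c.
pose z0 (i : nat) : Z -> M := env_sum (ci i) (fun x => match x with
  | inl w => y' ((i, 0) : O2) (inl w) | inr (j, b) => y' ((i, j) : O2) (inr b) end).
have sZ : smallT kap Z.
  apply: small_sum => //; first exact: small_count.
  apply: small_sum => //; first exact: stage_small st.
  by apply: small_prod => //; exact: small_nat.
(* In this second extraction [O2] indexes whole blocks rather than positions, which creates the
   spare blocks. *)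
have [z zz] := em_extract kapS M_sat C_small z0 sZ sO.
have [w0 _] := W_inhabited.
pose zw : Z := inr (inl w0).
exists z; split.
- exact: em_MI zz.
- move=> m x q j t hst.
  apply: (em_tp zz (x := fun a => zcoord (j a) (x a)) (o := q)) => r f i hi.
  pose ix' a : O2 := match x (f a) with inl _ => (i a, 0) | inr _ => (i a, j (f a)) end.
  have hix : rowpat (@row_of W \o (x \o f)) (t \o f) ix'.
    move=> a b /= rab; have := hst (f a) (f b) rab; rewrite /clt /= => <-.
    have h1 : lexi (q (f a)) (q (f b)) = (i a < i b) := hi a b.
    have h2 : lexi (q (f b)) (q (f a)) = (i b < i a) := hi b a.
    by rewrite /ix' /idx; case: (x (f a)); case: (x (f b)) => ? ? /=;
      rewrite {1}/lexi /clt /= h1 h2.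
  have := alike_gen0 yy' hix.
  rewrite (_ : (fun a => y' (ix' a) ((x \o f) a)) = fun a => z0 (i a) (zcoord (j (f a)) (x (f
    a))))//.
  by apply/funext => a; rewrite /ix' /= /z0 /zcoord; case: (x (f a)).
- move=> q.
  pose xx (a : 'I_n + nat * XB) : Z := match a with inl l => inl l | inr r => zcoord r.1 (inr
    r.2) end.
  rewrite (_ : env_sum _ (flat (fun i b => z q _)) = fun a => z q (xx a)); last by apply/funext;
    case.
  apply: (em_tp_const zw zz) => j; apply: tpeq_trans (tpeq_sym c'B) _.
  have := tpeq_comp (s := fun a : 'I_n + nat * XB => match a with inl l => inl l | inr r => inr
    (r.1, inr r.2) end) (hci j).
  rewrite (_ : env_sum c' (flat y) \o _ = env_sum c' (flat (fun i b => y i (inr b)))); last by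
    apply/funext; case.
  rewrite (_ : _ \o _ = fun a => z0 j (xx a)) //.
  by apply/funext => -[|[]].
- move=> q.
  pose xx (a : 'I_n + 'I_k) : Z := match a with inl l => inl l | inr l => inr (inl (al l)) end.
  rewrite (_ : env_sum _ _ = fun a => z q (xx a)); last by apply/funext; case.
  apply: (em_Def_grouped zw zz (gam := fun=> tt) (o := fun=> q) dPhi) => i _.
  have := tpeq_comp (s := fun a : 'I_n + 'I_k => match a with inl l => inl l | inr l => inr (0,
    inl (al l)) end) (hci (i tt)).
  move=> /(_ Phi dPhi); rewrite (_ : _ \o _ = env_sum c' (fun l => y 0 (inl (al l)))); last by
    apply/funext; case.
  move=> /(_ c'0); rewrite (_ : _ \o _ = fun a => z0 (i tt) (xx a))//.
  by apply/funext => -[//|l]; rewrite /= /ix /= addn0.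
- move=> q q' qq'.
  pose xx (a : 'I_n + 'I_k) : Z := match a with inl l => inl l | inr l => inr (inl (al l)) end.
  pose gam (a : 'I_n + 'I_k) := if a is inl _ then false else true.
  rewrite (_ : env_sum _ _ = fun a => z (if gam a then q' else q) (xx a)); last by apply/funext;
    case.
  apply: (em_Def_grouped zw zz (gam := gam) (o := fun b => if b then q' else q) (Def_not dPhi))
    => i hi.
  have : i false < i true by have h : clt q q' = (i false < i true) := hi false true; rewrite -h.
  set a : nat := i false; set b : nat := i true => ab.
  have -> : (fun a0 => z0 (i (gam a0)) (xx a0)) = env_sum (ci a) (fun l => y' ((b, 0) : O2) (inl
    (al l))).
    by apply/funext; case.
  have := tpeq_comp (s := fun a0 : 'I_n + 'I_k => match a0 with inl l => inl l | inr l => inr (b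
    - a, inl (al l)) end) (hci a).
  move=> /(_ _ (Def_not dPhi)); rewrite (_ : _ \o _ = env_sum c' (fun l => y (b - a) (inl (al
    l)))); last by apply/funext; case.
  rewrite (_ : _ \o _ = env_sum (ci a) (fun l => y' ((b, 0) : O2) (inl (al l)))); last first.
    by apply/funext => -[//|l]; rewrite /= /ix /= subnKC // ltnW.
  by apply; rewrite (_ : b - a = (b - a).-1.+1) //; lia.
Qed.

Variables (z : O2 -> Z -> M) (sd : step_data z).

Lemma sys_tp (E : Type) (x : E -> W + XB) (q q' : E -> O2) (j j' : E -> nat) :
  rowpat (@row_of W \o x) (fun a => idx (q a) (j a) (x a)) (fun a => idx (q' a) (j' a) (x a)) ->
  tpeq C (fun a => z (q a) (zcoord (j a) (x a))) (fun a => z (q' a) (zcoord (j' a) (x a))).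
Proof.
move=> h; apply: tpeq_fin => m f.
have [t ht] := pateq_exists (fun a => idx (q (f a)) (j (f a)) (x (f a))).
apply: (tpeq_trans (v := fun a => y (t a) (x (f a)))).
  by apply: tpeq_sym; apply: (sd_sys sd (x := x \o f)); apply: pateq_rowpat.
apply: (sd_sys sd (x := x \o f)) => a b rab; rewrite -ht; apply/esym; exact: h.
Qed.

Lemma rows_tp (E : Type) (x : E -> Rw * 'I_n + XB) (q q' : E -> O2) (j j' : E -> nat) :
  rowpat (@tuple_row_of Rw \o x) (fun a => idx (q a) (j a) (select e (x a)))
    (fun a => idx (q' a) (j' a) (select e (x a))) ->
  tpeq C (fun a => z (q a) (zcoord (j a) (select e (x a))))
         (fun a => z (q' a) (zcoord (j' a) (select e (x a)))).
Proof.
move=> h; apply: tpeq_fin => m f.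
have [t ht] := pateq_exists (fun a => idx (q (f a)) (j (f a)) (select e (x (f a)))).
have [t' ht'] := pateq_exists (fun a => idx (q' (f a)) (j' (f a)) (select e (x (f a)))).
apply: (tpeq_trans (v := fun a => y (t a) (select e (x (f a))))).
  by apply: tpeq_sym; apply: (sd_sys sd (x := select e \o x \o f)); apply: pateq_rowpat.
apply: (tpeq_trans (v := fun a => y (t' a) (select e (x (f a))))).
  have htt : rowpat (@tuple_row_of Rw \o (x \o f)) t t'.
    by move=> a b rab; rewrite -ht -ht'; exact: h.
  exact: (alike_gen0 (stage_rows st) htt).
by apply: (sd_sys sd (x := select e \o x \o f)); apply: pateq_rowpat.
Qed.

Lemma c_realizes (q : O2) : realizes (fun l => z q (inl l)) p.
Proof.
move=> phi pphi.
have := tpeq_comp (s := inl) (sd_cB sd q) (Def_pholds phi).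
by apply; exact: c_p.
Qed.

Definition Bz (a : nat) (j : nat_chain) (b : XB) : M := z (a, 0) (inr (inr (j, b))).

(* Everything except the element [c_a] and the sequences [B_a] themselves, whose
   entries are redirected to the index [a + 1]. *)
Definition others_index (a : nat) (q : nat * Z) : nat :=
  if q.2 is inr (inl _) then q.1 else if q.1 == a then a.+1 else q.1.

Definition others (a : nat) (q : nat * Z) : M := z (others_index a q, 0) q.2.

Lemma others_index_eq (a : nat) (q : nat * Z) :
  others_index a q = a -> exists w, q.2 = inr (inl w).
Proof.
rewrite /others_index; case: q => b [l|[w|jb]] /=; last 2 first.
- by move=> _; exists w.
- by case: eqP => // _; lia.
- by case: eqP => // _; lia.
Qed.

(* The pieces [B_(a, i)] are indiscernible over the elements [c_b], [b <> a]; if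
   [B_a] was not mutually indiscernible over them, they would witness an infinite
   alternation. *)
Lemma Bz_MI (a : nat) : MI C (others a) rB (Bz a).
Proof.
move=> m x s t hst S dS Ss; apply: contrapT => nSt.
have [r [f [S' [dS' hS']]]] := Def_restrict_right dS.
move: Ss nSt; rewrite !hS' => Ss nSt.
have [w0 _] := W_inhabited.
pose bi v := others_index a (f v).
pose xi v := (f v).2.
have bi_w v : bi v = a -> exists w, xi v = inr (inl w) by exact: others_index_eq.
(* Only [W]-entries of [others a] have index [a]; they move along with the piece to block (a, i),
   and the rest stays. *)
pose ind (i : nat) v : O2 := (bi v, if bi v == a then i else 0).
pose env (w : 'I_m -> nat) (i : nat) : 'I_m + 'I_r -> M :=
  env_sum (fun u => z ((a, i) : O2) (inr (inr (w u, x u)))) (fun v => z (ind i v) (xi v)).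
have env0 w : env w 0 = env_sum (fun u => Bz a (w u) (x u)) (others a \o f).
  by rewrite /env; congr env_sum; apply/funext => v; rewrite /ind /others if_same.
have shift w i : tpeq C (env w 0) (env w i).
  pose o i (g : 'I_m + 'I_r) : O2 := if g is inr v then ind i v else (a, i).
  pose xx (g : 'I_m + 'I_r) : Z := match g with inl u => inr (inr (w u, x u)) | inr v => xi v end.
  have pat : rowpat ((fun=> tt) \o xx) (o 0) (o i).
    move=> g g' _; rewrite /clt /= /lexi /clt /=.
    case: g g' => [u|v] [u'|v'] /=.
    - by rewrite !ltnn.
    - by case: eqP => [->|ne]; rewrite ?ltnn //; lia.
    - by case: eqP => [->|ne]; rewrite ?ltnn //; lia.
    - by case: eqP => [->|ne]; case: eqP => [->|ne']; rewrite ?ltnn //; lia.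
  have := alike_gen0 (sd_ind sd) pat.
  have E i' : (fun g => z (o i' g) (xx g)) = env w i' by apply/funext; case.
  by rewrite !E.
pose dq i (g : 'I_m + 'I_r) : O2 := if g is inr v then ind i v else (a, i).
pose dj (i : nat) (g : 'I_m + 'I_r) : nat := match g with
  | inl u => if odd i then t u else s u
  | inr v => if xi v is inr (inr (j, _)) then j else 0 end.
(* The elements c_b are left out of [d], with [w0] as placeholder, and become the fixed tuple of
   realizations of [p]. Without them [sys_tp] lets [dj] switch between [s] and [t]. *)
pose dx (g : 'I_m + 'I_r) : W + XB := match g with
  | inl u => inr (x u)
  | inr v => match xi v with inl _ => inl w0 | inr (inl w) => inl w | inr (inr (_, b)) => inr b
    end end.
pose d (i : nat_chain) g := z (dq i g) (zcoord (dj i g) (dx g)).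
have dMI : MI C (of_void M) (fun=> tt) d.
  apply: alike0 => q yy s' t' hst'; apply: sys_tp => h h' rhh.
  have p1 : (s' h < s' h') = (t' h < t' h') := hst' h h' erefl.
  have p2 : (s' h' < s' h) = (t' h' < t' h) := hst' h' h erefl.
  have p3 : (s' h == s' h') = (t' h == t' h') by apply/eqP/eqP; lia.
  rewrite !idxE; move: rhh p1 p2 p3; rewrite /comp.
  move: (yy h) (yy h') (s' h) (s' h') (t' h) (t' h') => -[u|v] [u'|v'] i1 i2 k1 k2 rhh p1 p2 p3;
    rewrite /dq /dj.
  - have hs : (s u < s u') = (t u < t u') by apply: hst; case: rhh.
    rewrite !clt_O3 !ltnn !eqxx /= p1 p3; congr (_ || _).
    move: p3; case: (eqVneq k1 k2) => //= -> /eqP ->.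
    by case: (odd i2); case: (odd k2).
  - case: (eqVneq (bi v') a) => [/bi_w[w e']|ne]; first by move: rhh; rewrite /dx /= e'.
    by rewrite /ind !clt_O3 (negbTE ne) [a == _]eq_sym (negbTE ne).
  - case: (eqVneq (bi v) a) => [/bi_w[w e']|ne]; first by move: rhh; rewrite /dx /= e'.
    by rewrite /ind !clt_O3 (negbTE ne).
  - rewrite /ind !clt_O3; case: (eqVneq (bi v) a) => [->|ne].
      case: (eqVneq (bi v') a) => [->|ne']; first by rewrite p1 p3.
      by [].
    case: (eqVneq (bi v') a) => [->|ne'] //.
    by rewrite (negbTE ne).
pose g (h : 'I_m + 'I_r) : ('I_r * 'I_n) + ('I_m + 'I_r) := match h with
  | inl u => inr (inl u)
  | inr v => if xi v is inl l then inl (v, l) else inr (inr v) end.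
apply: (no_alternation_tuple kapS M_sat C_small p_dep (x := fun v l => z (ind 0 v) (inl l)) _
  dMI (Def_rename g dS')).
  by move=> v; exact: c_realizes.
move=> i.
have E i' : env_sum (fun q : 'I_r * 'I_n => z (ind 0 q.1) (inl q.2)) (d i') \o g =
    env (if odd i' then t else s) i'.
  apply/funext => -[u|v] /=; first by rewrite /d /=; case: (odd i').
  have := bi_w v; rewrite /d /dq /dj /dx /ind /=; case exi: (xi v) => [l|[w|[j b]]] h;
    rewrite /= ?exi //.
  by case: eqP => // /h[].
rewrite !E /= odd_double /=; split; first by apply: (shift s) => //; rewrite env0.
by move/(tpeq_sym (shift t i.*2.+1) dS'); rewrite env0.
Qed.

Definition Jz (i : nat_chain) (q : Rw * 'I_n) : M := z (i, 0) (inr (inl (e q.1 q.2))).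

Lemma Jz_realizes (t : Rw) (i : nat_chain) : realizes (fun l => Jz i (t, l)) p.
Proof.
move=> phi pphi.
have hst : rowpat (@row_of W \o (fun l : 'I_n => inl (e t l)))
    (fun l => idx (i, 0) 0 (inl (e t l))) (fun=> 0 : nat_chain).
  by move=> a b _; rewrite /idx !clt_irr.
exact: (sd_sys sd (j := fun=> 0) hst (Def_pholds phi) (stage_p st t 0 pphi)).
Qed.

(** Applying [star] to c_b yields indiscernibility over c_b but not over B_b as well. The spent
    pieces B_1, ..., B_N are therefore replaced by B_0 among the parameters. *)
Definition mask (N b : nat) : nat := if 0 < b <= N then 0 else b.

Definition cs (N : nat) (q : 'I_N * 'I_n) : M := z ((q.1.+1, 0) : O2) (inl q.2).

Definition Bs (N : nat) (q : nat * nat * XB) : M := Bz (mask N q.1.1) q.1.2 q.2.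

(* The rows stay mutually indiscernible over [c_1, ..., c_N], by successive
   applications of [star] to [c_N] and [B_N]. *)
Lemma Jz_MI (N : nat) : MI C (env_sum (@cs N) (Bs N)) fst Jz.
Proof.
elim: N => [|N IH].
  move=> m x s t hst.
  pose E := ('I_m + nat * nat * XB)%type.
  pose xx (a : E) : Rw * 'I_n + XB := match a with inl a => inl (x a) | inr q => inr q.2 end.
  pose q (w : 'I_m -> nat) (a : E) : O2 := match a with inl a => (w a, 0) | inr q => (q.1.1, 0)
    end.
  pose j (a : E) : nat := if a is inr q then q.1.2 else 0.
  have hst' : rowpat (@tuple_row_of Rw \o xx) (fun a => idx (q s a) (j a) (select e (xx a)))
      (fun a => idx (q t a) (j a) (select e (xx a))).
    move=> [a|a] [b|b] // [rab].
    by apply: etrans (clt_O3_first _ _) (etrans _ (esym (clt_O3_first _ _))); exact: hst.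
  have := rows_tp hst'.
  have I0 (i : 'I_0) : False by case: i.
  pose g (a : 'I_m + ('I_0 * 'I_n + nat * nat * XB)) : E := match a with
    | inl a => inl a | inr (inl q) => False_rect _ (I0 q.1) | inr (inr q) => inr q end.
  move=> /(@tpeq_comp _ _ _ _ _ g).
  have E1 w : (fun a => z (q w a) (zcoord (j a) (select e (xx a)))) \o g =
      env_sum (fun i => Jz (w i) (x i)) (env_sum (@cs 0) (Bs 0)).
    apply/funext => -[a|[[? ?]|[[b j'] x']]] //=.
    by rewrite /Bs /mask /= ltnNge leqn0; case: b.
  by rewrite !E1.
apply: MI_of_rows => t.
pose U := (('I_N * 'I_n + nat * nat * XB) + nat_chain * {x : Rw * 'I_n | x.1 <> t})%type.
pose u : U -> M := env_sum (env_sum (@cs N) (Bs N.+1)) (fun q => Jz q.1 (sval q.2)).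
have maskN b : mask N.+1 b <> N.+1 by rewrite /mask; case: ifP => //; lia.
have mask_mask b : mask N (mask N.+1 b) = mask N.+1 b.
  by rewrite /mask; case: ifP => //=; case: ifP => //; lia.
have maskS : mask N N.+1 = N.+1 by rewrite /mask ltnn.
have JB : MI C u (@row_of 'I_n) (with_first (fun i l => Jz i (t, l)) (Bz N.+1)).
  move=> m x s s' hst.
  pose env (w w' : 'I_m -> nat) : 'I_m + U -> M := env_sum (fun a => match x a with
    | inl l => Jz (w a) (t, l) | inr b => Bz N.+1 (w' a) b end) u.
  have envE w : env_sum (fun i => with_first (fun i l => Jz i (t, l)) (Bz N.+1) (w i) (x i)) u =
    env w w.
    by apply/funext => -[a|//]; rewrite /env /with_first /=; case: (x a).
  (* The piece is moved first, by [Bz_MI], as c_(N+1) is not yet a parameter; then the row, by [IH],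
     where B_(N+1) still counts as a parameter. *)
  rewrite !envE; apply: (tpeq_trans (v := env s s')).
    pose xx (a : 'I_m + U) : nat * Z + XB := match a with
      | inl a => match x a with inl l => inl (s a : nat, inr (inl (e t l))) | inr b => inr b end
      | inr (inl (inl q)) => inl (q.1.+1, inl q.2)
      | inr (inl (inr q)) => inl (mask N.+1 q.1.1, inr (inr (q.1.2, q.2)))
      | inr (inr q) => inl (q.1 : nat, inr (inl (e (sval q.2).1 (sval q.2).2))) end.
    pose ss (w : 'I_m -> nat) (a : 'I_m + U) : nat_chain := if a is inl a then w a else 0.
    have := @MI_move _ _ _ _ _ _ _ _ _ _ _ xx (ss s) (ss s') (@Bz_MI N.+1).
    have E1 w : (fun a => match xx a with inl w => others N.+1 w | inr b => Bz N.+1 (ss w a) b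
      end) = env s w.
      apply/funext => -[a|[[[i l]|[[b j] x']]|q]] //=; first by case: (x a).
        by rewrite /others /others_index /= eqSS ltn_eqF.
      by rewrite /others /others_index /=; case: eqP => // /maskN.
    rewrite !E1; apply=> -[a|[[?|?]|?]] [b|[[?|?]|?]] //= xa xb.
    by case ea: (x a) => // -[<-]; case eb: (x b) => // -[<-] rab; apply: hst; rewrite /= ea eb
      /= rab.
  pose xx (a : 'I_m + U) : ('I_N * 'I_n + nat * nat * XB) + Rw * 'I_n := match a with
    | inl a => match x a with inl l => inr (t, l) | inr b => inl (inr (N.+1, s' a : nat, b)) end
    | inr (inl (inl q)) => inl (inl q)
    | inr (inl (inr q)) => inl (inr (mask N.+1 q.1.1, q.1.2, q.2))
    | inr (inr q) => inr (sval q.2) end.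
  pose ss (w : 'I_m -> nat) (a : 'I_m + U) : nat_chain := match a with
    inl a => w a | inr (inr q) => q.1 | _ => 0 end.
  have := @MI_move _ _ _ _ _ _ _ _ _ _ _ xx (ss s) (ss s') IH.
  have E1 w : (fun a => match xx a with inl w => env_sum (@cs N) (Bs N) w | inr b => Jz (ss w a)
    b end) = env w s'.
    apply/funext => -[a|[[?|[[b j] x']]|?]] //=; first by case: (x a) => //= b; rewrite /Bs /=
      maskS.
    by rewrite /Bs /= mask_mask.
  rewrite !E1; apply=> -[a|[[?|?]|[i [x1 h1]]]] [b|[[?|?]|[i2 [x2 h2]]]] //= xa xb.
  - by case ea: (x a) => // -[<-]; case eb: (x b) => // -[<-] _; apply: hst; rewrite /= ea eb.
  - by case ea: (x a) => // -[<-] [<-] /esym /h2.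
  - by move=> [<-]; case eb: (x b) => // -[<-] /h1.
have := star (sd_cB sd (N.+1, 0)) (Jz_realizes t) JB.
pose f (a : ('I_N.+1 * 'I_n + nat * nat * XB) + nat_chain * {x : Rw * 'I_n | x.1 <> t}) : U +
  'I_n := match a with
  | inl (inl q) => if insub (val q.1) is Some i then inl (inl (inl (i, q.2))) else inr q.2
  | inl (inr q) => inl (inl (inr q))
  | inr q => inl (inr q) end.
move=> /(alike_sub (r' := fun=> tt) (f := f) (g := fun x : {x : Rw * 'I_n | x.1 = t} => (sval
  x).2) (fun _ _ _ => erefl)).
rewrite (_ : env_sum u _ \o f = env_sum (env_sum (@cs N.+1) (Bs N.+1)) (fun q => Jz q.1 (sval
  q.2))); last first.
  apply/funext => -[[[i l]|q]|q] //=; case: insubP => /= [i' _ e'|]; first by rewrite /cs /= e'.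
  by rewrite -leqNgt => Ni; rewrite /cs /= (_ : i = N :> nat) //; have := ltn_ord i; lia.
rewrite (_ : (fun o => _ \o _) = fun i x => Jz i (sval x)) //.
by apply/funext => i; apply/funext => -[[t' l] /= <-].
Qed.

Definition W' := (W + 'I_n)%type.
Definition al' (l : 'I_k) : W' := inl (al l).
Definition e' (t : option Rw) (l : 'I_n) : W' := if t is Some t then inl (e t l) else inr l.
(** Block 0 contributes only the piece B_0: [Bz_MI] controls it over the later c_b but not over c_0.
    All other coordinates therefore start at block 1. *)
Definition y' (i : nat_chain) (x : W' + XB) : M := match x with
  | inl (inl w) => z (i.+1, 0) (inr (inl w))
  | inl (inr l) => z (i.+1, 0) (inl l)
  | inr b => Bz 0 i b end.

Lemma y'_MI : MI C (of_void M) (@row_of W') y'.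
Proof.
apply: alike0 => m x s t hst.
pose env (w w' : 'I_m -> nat) (a : 'I_m) : M := match x a with
  | inl (inl v) => z (((w a).+1, 0) : O2) (inr (inl v))
  | inl (inr l) => z (((w a).+1, 0) : O2) (inl l)
  | inr b => Bz 0 (w' a) b end.
(* First the entries of B_0 over the later blocks, then these blocks by indiscernibility of [z]. *)
apply: (tpeq_trans (v := env s t)).
  pose xx a : nat * Z + XB := match x a with
    | inl (inl v) => inl ((s a).+1, inr (inl v))
    | inl (inr l) => inl ((s a).+1, inl l)
    | inr b => inr b end.
  have := @MI_move _ _ _ _ _ _ _ _ _ _ _ xx s t (@Bz_MI 0).
  have E1 w : (fun a => match xx a with inl w => others 0 w | inr b => Bz 0 (w a) b end) = env s
    w.
    by apply/funext => a; rewrite /xx /env; case: (x a) => [[v|l]|b].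
  rewrite !E1; apply=> a b xa xb; rewrite /xx.
  case ea: (x a) => [[]|] // -[<-]; case eb: (x b) => [[]|] // -[<-] rab.
  by apply: hst; rewrite /= ea eb /= rab.
pose o (w : 'I_m -> nat) a : O2 := if x a is inl _ then ((w a).+1, 0) else (0, 0).
pose xx a : Z := match x a with
  | inl (inl v) => inr (inl v) | inl (inr l) => inl l | inr b => inr (inr (t a : nat, b)) end.
have hst' : rowpat ((fun=> tt) \o xx) (o s) (o t).
  move=> a b _; have := hst a b; rewrite /o /comp.
  case: (x a) => [v|u]; case: (x b) => [v'|u'] h; rewrite ?clt_irr ?clt_O2_first //.
  by rewrite !ltnS; exact: (h erefl).
have := alike_gen0 (sd_ind sd) hst'.
have E1 w : (fun a => z (o w a) (xx a)) = env w t.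
  by apply/funext => a; rewrite /o /xx /env; case: (x a) => [[]|].
by rewrite !E1.
Qed.

(** The new row shares its blocks with the old rows, so [sd_ind] alone cannot move it separately.
    After B_0, the old rows are carried out of the way by [Jz_MI], the new row is moved, and the old
    rows return to [t]. *)
Lemma y'_rows : MI C (of_void M) (@tuple_row_of (option Rw)) (fun i => y' i \o select e').
Proof.
apply: alike0 => m x s t hst.
pose env (wJ wc wB : 'I_m -> nat) (a : 'I_m) : M := match x a with
  | inl (Some r, l) => Jz (wJ a).+1 (r, l)
  | inl (None, l) => z (((wc a).+1, 0) : O2) (inl l)
  | inr b => Bz 0 (wB a) b end.
have envE w : (fun i => (y' (w i) \o select e') (x i)) = env w w w.
  by apply/funext => a; rewrite /env /=; case: (x a) => [[[r|] l]|b].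
rewrite !envE.
pose N := (\max_a maxn (s a) (t a)).
have sN a : s a <= N by rewrite (leq_trans (leq_maxl _ (t a))) // (leq_bigmax_cond (F := fun a
  => maxn (s a) (t a))).
have tN a : t a <= N by rewrite (leq_trans (leq_maxr (s a) _)) // (leq_bigmax_cond (F := fun a
  => maxn (s a) (t a))).
(* Beyond all values of [s] and [t], in the order given by [s]. *)
pose far a := s a + N.+1.
have moveB : tpeq C (env s s s) (env s s t).
  pose xx a : nat * Z + XB := match x a with
    | inl (Some r, l) => inl ((s a).+1, inr (inl (e r l)))
    | inl (None, l) => inl ((s a).+1, inl l)
    | inr b => inr b end.
  have := @MI_move _ _ _ _ _ _ _ _ _ _ _ xx s t (@Bz_MI 0).
  have E1 w : (fun a => match xx a with inl w => others 0 w | inr b => Bz 0 (w a) b end) = env s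
    s w.
    by apply/funext => a; rewrite /xx /env; case: (x a) => [[[r|] l]|b].
  rewrite !E1; apply=> a b xa xb; rewrite /xx.
  case ea: (x a) => [[[] ?]|] // -[<-]; case eb: (x b) => [[[] ?]|] // -[<-] rab.
  by apply: hst; rewrite /= ea eb /= rab.
have moveJ (w w' wc : 'I_m -> nat) : (forall a, wc a <= N) ->
    rowpat (@tuple_row_of (option Rw) \o x) (w : _ -> nat_chain) (w' : _ -> nat_chain) ->
    tpeq C (env w wc t) (env w' wc t).
  move=> wcN ww'.
  pose xx a : ('I_N.+1 * 'I_n + nat * nat * XB) + Rw * 'I_n := match x a with
    | inl (Some r, l) => inr (r, l)
    | inl (None, l) => inl (inl (inord (wc a), l))
    | inr b => inl (inr (0, t a : nat, b)) end.
  have := @MI_move _ _ _ _ _ _ _ _ _ _ _ xx (fun a => (w a).+1 : nat_chain) (fun a => (w' a).+1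
    : nat_chain) (@Jz_MI N.+1).
  have E1 v : (fun a => match xx a with inl w => env_sum (@cs N.+1) (Bs N.+1) w | inr b => Jz (v
    a).+1 b end) =
      env v wc t.
    apply/funext => a; rewrite /xx /env; case: (x a) => [[[r|] l]|b] //=.
    by rewrite /cs /= inordK // ltnS.
  rewrite !E1; apply=> a b xa xb; rewrite /xx.
  case ea: (x a) => [[[r|] l]|] // -[<-]; case eb: (x b) => [[[r'|] l']|] // -[<-] /= rab.
  by apply: (ww' a b); rewrite /= ea eb /= rab.
have movec : tpeq C (env far s t) (env far t t).
  pose o (w : 'I_m -> nat) a : O2 := match x a with
    | inl (Some _, _) => ((far a).+1, 0) | inl (None, _) => ((w a).+1, 0) | inr _ => (0, 0) end.
  pose xx a : Z := match x a with
    | inl (Some r, l) => inr (inl (e r l)) | inl (None, l) => inl l | inr b => inr (inr (t a :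
      nat, b)) end.
  have hst' : rowpat ((fun=> tt) \o xx) (o s) (o t).
    move=> a b _; have := hst a b; have := sN a; have := sN b; have := tN a; have := tN b.
    rewrite /o /far /comp.
    case: (x a) => [[[r|] l]|u]; case: (x b) => [[[r'|] l']|u'] h1 h2 h3 h4 h;
      rewrite ?clt_irr ?clt_O2_first // ?ltnS; try lia.
    exact: (h erefl).
  have := alike_gen0 (sd_ind sd) hst'.
  have E1 w : (fun a => z (o w a) (xx a)) = env far w t.
    by apply/funext => a; rewrite /o /xx /env; case: (x a) => [[[r|] l]|b].
  by rewrite !E1.
apply: tpeq_trans moveB _.
apply: (tpeq_trans (v := env far s t)).
  by apply: moveJ => // a b _; rewrite /far /clt /= ltn_add2r.
apply: tpeq_trans movec _; apply: moveJ => // a b rab.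
by rewrite -(hst a b rab) /far /clt /= ltn_add2r.
Qed.

(** Old rows keep their break by [sd_sys]; the new one breaks between blocks 1 and 2 by [sd_Phi] and
    [sd_nPhi]. For [stage_next], the a_i from block 1 on and B_0 have together the type of the old
    ones, so [c'] can be transported. *)
Lemma stage_succ : stage al' e' y'.
Proof.
split.
- by apply: small_sum => //; [exact: stage_small st|exact: small_count].
- exact: y'_MI.
- exact: y'_rows.
- by move=> [t|] i; [exact: Jz_realizes|exact: c_realizes].
- move=> [t|]; last by split; [exact: (sd_Phi sd)|apply: (sd_nPhi sd); rewrite clt_O2_first].
  pose xx (a : 'I_n + 'I_k) : W + XB := match a with inl l => inl (e t l) | inr l => inl (al l)
    end.
  pose q (b : bool) (a : 'I_n + 'I_k) : O2 := if a is inr _ then (b.+1, 0) else (1, 0).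
  pose tau (b : bool) (a : 'I_n + 'I_k) : nat_chain := if a is inr _ then b : nat else 0.
  have Y (b : bool) : tpeq C (env_sum (fun l => y 0 (inl (e t l))) (fun l => y (nat_of_bool b)
    (inl (al l))))
      (env_sum (fun l => y' 0 (inl (e' (Some t) l))) (fun l => y' (nat_of_bool b) (inl (al' l)))).
    apply: tpeq_fin => m f.
    have hst : rowpat (@row_of W \o (xx \o f)) (fun a => idx (q b (f a)) 0 (xx (f a))) (tau b \o
      f).
      move=> a a' _; rewrite /comp.
      by case: (f a) => ?; case: (f a') => ?; apply: etrans (clt_O3_first _ _) _.
    have := sd_sys sd (x := xx \o f) (j := fun=> 0) hst.
    rewrite (_ : (fun a => y _ _) = env_sum (fun l => y 0 (inl (e t l))) (fun l => y
      (nat_of_bool b) (inl (al l))) \o f); last first.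
      by apply/funext => a /=; rewrite /xx /tau; case: (f a).
    rewrite (_ : (fun a => z _ _) = env_sum (fun l => y' 0 (inl (e' (Some t) l))) (fun l => y'
      (nat_of_bool b) (inl (al' l))) \o f) //.
    by apply/funext => a /=; rewrite /xx /q; case: (f a).
  have [h0 h1] := stage_broken st t.
  by split; [exact: (Y false _ dPhi)|exact: (Y true _ (Def_not dPhi))].
- have [c' [c'B c'0 c'1]] := stage_next st.
  pose E := (nat * 'I_k + nat * XB)%type.
  pose xx (a : E) : W + XB := match a with inl q => inl (al q.2) | inr q => inr q.2 end.
  pose q (a : E) : O2 := if a is inl q then (q.1.+1, 0) else (0, 0).
  pose j (a : E) : nat := if a is inr q then q.1 else 0.
  pose tau (a : E) : nat_chain := match a with inl q => q.1 | inr q => q.1 end.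
  pose v1 : E -> M := env_sum (fun q => y q.1 (inl (al q.2))) (flat (fun i b => y i (inr b))).
  pose v2 : E -> M := env_sum (fun q => y' q.1 (inl (al' q.2))) (flat (fun i b => y' i (inr b))).
  have Y : tpeq C v1 v2.
    apply: tpeq_fin => m f.
    have hst : rowpat (@row_of W \o (xx \o f)) (fun a => idx (q (f a)) (j (f a)) (xx (f a)))
      (tau \o f).
      move=> a a'; rewrite /comp; case: (f a) => u; case: (f a') => u' // _.
        exact: (clt_O3_first u.1.+1 u'.1.+1).
    have := sd_sys sd (x := xx \o f) hst.
    rewrite (_ : (fun a => y _ _) = v1 \o f); last first.
      by apply/funext => a /=; rewrite /xx /tau /v1; case: (f a).
    rewrite (_ : (fun a => z _ _) = v2 \o f) //.
    by apply/funext => a /=; rewrite /xx /q /v2; case: (f a).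
  have [||c2 hc2] := tpeq_extend kapS M_sat C_small c' _ _ Y.
  - exact: small_count.
  - apply: small_sum => //; first exact: small_count.
    by apply: small_prod => //; exact: small_nat.
  exists c2; split.
  - apply: tpeq_trans c'B.
    have := tpeq_comp (s := fun a : 'I_n + nat * XB => match a with inl l => inl l | inr q =>
      inr (inr q) end) (tpeq_sym hc2).
    rewrite (_ : env_sum c' v1 \o _ = env_sum c' (flat (fun i b => y i (inr b)))); last by
      apply/funext; case.
    by rewrite (_ : env_sum c2 v2 \o _ = env_sum c2 (flat (fun i b => y' i (inr b)))); last by
      apply/funext; case.
  - have := tpeq_comp (s := fun a : 'I_n + 'I_k => match a with inl l => inl l | inr l => inr
    (inl (0, l)) end) hc2.
    rewrite (_ : env_sum c' v1 \o _ = env_sum c' (fun l => y 0 (inl (al l)))); last by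
      apply/funext; case.
    rewrite (_ : env_sum c2 v2 \o _ = env_sum c2 (fun l => y' 0 (inl (al' l)))); last by
      apply/funext; case.
    by move=> /(_ _ dPhi c'0).
  - move=> i.
    have := tpeq_comp (s := fun a : 'I_n + 'I_k => match a with inl l => inl l | inr l => inr
      (inl (i.+1, l)) end) hc2.
    rewrite (_ : env_sum c' v1 \o _ = env_sum c' (fun l => y i.+1 (inl (al l)))); last by
      apply/funext; case.
    rewrite (_ : env_sum c2 v2 \o _ = env_sum c2 (fun l => y' i.+1 (inl (al' l)))); last by
      apply/funext; case.
    by move=> /(_ _ (Def_not dPhi) (c'1 i)).
Qed.

End Step.

Lemma stage_step (Rw : finType) (W : Type) (al : 'I_k -> W) (e : Rw -> 'I_n -> W)
    (y : nat_chain -> W + XB -> M) : stage al e y ->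
  exists (W1 : Type) (al1 : 'I_k -> W1) (e1 : option Rw -> 'I_n -> W1) (y1 : nat_chain -> W1 +
    XB -> M),
    stage al1 e1 y1.
Proof.
move=> st; have [z sd] := step_data_exists st.
by do 4!eexists; exact: (stage_succ st sd).
Qed.

End Stage.

(** * Automorphisms *)

Section Automorphism.
Variables (L : language) (M : structure L) (f : M -> M).
Hypothesis f_aut : automorphism f.

Lemma teval_automorphism (V : Type) (w : V -> M) (t : term L V) :
  teval (f \o w) t = f (teval w t).
Proof.
have [_ ff _] := f_aut.
by elim: t => //= g ts IH; rewrite ff; congr finterp; apply/funext.
Qed.

Lemma holds_automorphism (V : Type) (w : V -> M) (phi : formula L V) :
  holds (f \o w) phi <-> holds w phi.
Proof.
have [[g fg gf] _ fr] := f_aut.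
elim: phi w => //= {}V.
- by move=> t u w; rewrite !teval_automorphism; split=> [/(can_inj fg)//|->].
- move=> r ts w; rewrite (_ : (fun i => _) = f \o (fun i => teval w (ts i))) -?fr //.
  by apply/funext => i /=; exact: teval_automorphism.
- by move=> a IHa b IHb w; rewrite IHa IHb.
- move=> a IH w.
  have E x : env_cons (f \o w) (f x) = f \o env_cons w x by apply/funext; case.
  split=> h x; first by have := h (f x); rewrite E IH.
  by rewrite -(gf x) E IH.
Qed.

Lemma tpeq_automorphism (C : set M) (X : Type) (w : X -> M) :
  (forall c, C c -> f c = c) -> tpeq C w (f \o w).
Proof.
move=> fC S [phi hphi]; rewrite -!hphi /pholds -(holds_automorphism (env_sum w _)).
rewrite (_ : f \o env_sum w set_val = env_sum (f \o w) set_val) //.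
by apply/funext => -[x|c] //=; apply: fC; exact: set_mem (valP c).
Qed.

End Automorphism.

Lemma indiscernible_sub (L : language) (M : structure L) (A A' : set M) (s : oseq M) :
  A `<=` A' -> indiscernible A' s -> indiscernible A s.
Proof.
move=> AA' hs k i j hi hj phi.
have cA (a : A) : val a \in A' by apply/mem_set/AA'/set_mem/(valP a).
have := hs k i j hi hj (frename (fun x => match x with inl q => inl q | inr a => inr (SigSub (cA
  a)) end) phi).
rewrite /pholds !holds_rename.
have E (w : 'I_k * 'I_(seq_len s) -> M) : env_sum w (@set_val M A') \o
    (fun x => match x with inl q => inl q | inr a => inr (SigSub (cA a)) end) = env_sum w
      (@set_val M A).
  by apply/funext; case.
by rewrite !E.
Qed.

(** The truth value changes at least once, so either it changes infinitely often or there is a last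
    change, found by minimality of the point from which it is constant. *)
Lemma alternation_dichotomy (Q : nat -> Prop) : ~ (Q 0 <-> Q 1) ->
  [\/ exists2 f, incr f & forall i, Q (f i.*2) /\ ~ Q (f i.*2.+1),
      exists2 j, Q j & forall i, ~ Q (j + i.+1) |
      exists2 j, ~ Q j & forall i, Q (j + i.+1)].
Proof.
suff last (R : nat -> Prop) : ~ (R 0 <-> R 1) -> (exists N, forall j, N <= j -> ~ R j) ->
    exists2 j, R j & forall i, ~ R (j + i.+1).
  move=> Q01.
  have [h1|/existsNP[N hN]] := pselect (forall N, exists j, N <= j /\ Q j); last first.
    constructor 2; apply: last => //; exists N => j Nj Qj; apply: hN; by exists j.
  have [h2|/existsNP[N hN]] := pselect (forall N, exists j, N <= j /\ ~ Q j); last first.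
    constructor 3; have [||j Qj hj] := last (fun j => ~ Q j).
    - by apply: contra_not Q01 => h; split=> h'; apply: contrapT => h''; move: h'; apply/h.
    - by exists N => j Nj Qj; apply: hN; exists j.
    - by exists j => // i; apply: contrapT; exact: hj.
  constructor 1; have [f1 hf1] := choice h1; have [f2 hf2] := choice h2.
  pose f := fix f i := if i is j.+1 then (if odd j then f1 else f2) (f j).+1 else f1 0.
  exists f => [|i].
    by apply: incrS => i /=; case: (odd i); [exact: (hf1 _).1|exact: (hf2 _).1].
  split; last by rewrite /= odd_double; exact: (hf2 _).2.
  by case: i => [|i]; [exact: (hf1 _).2|rewrite doubleS /= odd_double; exact: (hf1 _).2].
move=> R01 exN.
have exN' : exists N, `[< forall j, N <= j -> ~ R j >] by have [N hN] := exN; exists N;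
  apply/asboolP.
case: (ex_minnP exN') => -[|N] /asboolP hN minN.
  by case: R01; split=> /hN; case.
exists N => [|i]; last by apply: hN; lia.
apply: contrapT => nRN; have := minN N; rewrite ltnn => H; apply: notF; apply: H.
apply/asboolP => j; rewrite leq_eqVlt => /orP[/eqP<-//|]; exact: hN.
Qed.

(** * The theorem *)

Section Main.
Variables (L : language) (kap : Type) (M : structure L) (C : set M).
Hypothesis kapS : uncountable_strong_limit kap.
Hypothesis M_sat : saturated kap M.
Hypothesis M_hom : strongly_homogeneous kap M.
Hypothesis C_small : small kap C.
Variables (n : nat) (p : set (pformula 'I_n C)).
Hypothesis p_dep : dependent kap p.
Variables (K : Type) (i0 : K) (c : 'I_n -> M).
Hypothesis c_p : realizes c p.
Variables (len : K -> nat) (I : forall i : K, nat -> 'I_(len i) -> M).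
Hypothesis I_mut : mutually_indiscernible C (fun i => omega_seq (@I i)).
Hypothesis I_not : forall i, ~ indiscernible (C `|` range c) (omega_seq (@I i)).

Definition witness : Prop :=
  exists (C' : set M) (c' : 'I_n -> M) (d : Order.disp_t) (O : orderType d) (J0 : O -> 'I_n -> M),
    (C `<=` C' /\ finite_set (C' `\` C)) /\
    realizes c' p /\
    infinite_set [set: O] /\
    mutually_indiscernible C' (replace_at i0 (OSeq J0) (fun i => omega_seq (@I i))) /\
    same_type (C `|` \bigcup_(i in [set i | i <> i0]) seq_range (omega_seq (@I i))) c' c /\
    ~ indiscernible (C' `|` range c') (OSeq J0) /\
    (forall t : O, realizes (J0 t) p).

(** If [Lam] embedded into [K], dependence would make some I_i indiscernible over [c]; hence [K]
    embeds into [Lam]. *)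
Lemma K_small : smallT kap K.
Proof.
have [Lam sLam hLam] := p_dep.
have [[f fI]|[f fI]] := type_comparability Lam K; last exact: small_inj fI sLam.
have [||l] := hLam c (fun l => omega_seq (@I (f l))) c_p; last by move/I_not.
- by move=> l; exact: infinite_nat.
- move=> l; refine (indiscernible_sub _ (@I_mut (f l))) => a [Ca|[j jl aj]]; first by left.
  by right; exists (f j) => // /fI.
Qed.

Definition XB := {x : {t : K & 'I_(len t)} | projT1 x <> i0}.
Definition rB (x : XB) : K := projT1 (sval x).
Definition B0 (i : nat_chain) (x : XB) : M := row_system I i (sval x).

Lemma XB_small : smallT kap XB.
Proof. by apply/small_sig/small_tagged/K_small. Qed.

Section Rows.
Variable J : nat_chain -> 'I_n -> M.

(** [rlen] and [rrow] present the replaced family as rows of dependent length, the form that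
    [row_system] expects. *)
Definition rlen (k : K) : nat := if `[< k = i0 >] then n else len k.

Definition rrow (k : K) : nat -> 'I_(rlen k) -> M :=
  if `[< k = i0 >] as b return nat -> 'I_(if b then n else len k) -> M then J else @I k.

Lemma replace_rows : replace_at i0 (@OSeq M _ nat n J) (fun i => omega_seq (@I i)) =
  fun k => omega_seq (@rrow k).
Proof. by apply/funext => k; rewrite /replace_at /rrow /rlen; case: `[< k = i0 >]. Qed.

Lemma with_first_mutual (U : Type) (u : U -> M) :
  MI C u (@row_of K XB rB 'I_n) (with_first J B0) ->
  mutually_indiscernible (C `|` range u) (replace_at i0 (@OSeq M _ nat n J) (fun i => omega_seq
    (@I i))).
Proof.
move=> hJ; rewrite replace_rows; apply: (MI_mutual (C := C) (u := u)) => //.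
have g (x : {k : K & 'I_(rlen k)}) : {b : 'I_n + XB |
    (forall i, row_system rrow i x = with_first J B0 i b) /\
    row_of rB b = if `[< projT1 x = i0 >] then None else Some (projT1 x)}.
  case: x => k; rewrite /row_system /rrow /rlen /=; case: asboolP => [_ l|ne l].
    by exists (inl l).
  by exists (inr (exist _ (existT _ k l) ne)).
have := alike_sub (r' := @projT1 K (fun k => 'I_(rlen k))) (f := id) (g := fun x => sval (g x))
  _ hJ.
rewrite (_ : (fun o => with_first J B0 o \o _) = row_system rrow); last first.
  by apply/funext => i; apply/funext => x /=; rewrite (svalP (g x)).1.
move=> H; refine (H _) => x x'; rewrite (svalP (g x)).2 (svalP (g x')).2.
by case: asboolP => [->|_]; case: asboolP => // _ [].
Qed.

End Rows.

(** An automorphism over [C] carries [B] to the original sequences. The images of [J], [u] and [c']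
    would be a witness if that of [J] were not indiscernible; [u] is finite so that only finitely
    many elements are added to [C]. *)
Lemma star_fin (nW : ~ witness) (q : nat) (u : 'I_q -> M) (B : nat_chain -> XB -> M) (c' : 'I_n
  -> M)
    (J : nat_chain -> 'I_n -> M) :
  tpeq C (env_sum c (flat B0)) (env_sum c' (flat B)) -> (forall i, realizes (J i) p) ->
  MI C u (@row_of K XB rB 'I_n) (with_first J B) -> MI C (env_sum u c') (fun=> tt) J.
Proof.
move=> cB Jp hJ.
have [||f f_aut hf] := @M_hom (nat * XB + C)%type (env_sum (flat B) set_val) (env_sum (flat B0)
  set_val).
- apply: small_sum => //; last exact: (small_setP kap C).1 C_small.
  by apply: small_prod => //; [exact: small_nat|exact: XB_small].
- move=> phi.
  have S0 (a : @set0 M) : False by case: a => a; rewrite inE.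
  pose g (a : (nat * XB + C) + @set0 M) : nat * XB + C := match a with
    inl b => b | inr s => False_rect _ (S0 s) end.
  have E (w : nat * XB + C -> M) : env_sum w (@set_val M set0) = w \o g.
    by apply/funext => -[//|s]; case: (S0 s).
  rewrite /pholds !E -!holds_rename.
  apply: iff_sym; exact: (tpeqE (tpeq_comp (s := inr) cB) (Def_pholds (frename g phi))).
have fC a : C a -> f a = a by move=> Ca; exact: (hf (inr (SigSub (mem_set Ca)))).
have fB i b : f (B i b) = B0 i b by exact: (hf (inl (i, b))).
have ftp (X : Type) (w : X -> M) : tpeq C w (f \o w) by exact: tpeq_automorphism.
have fsum (X Y : Type) (v : X -> M) (w : Y -> M) : env_sum (f \o v) (f \o w) = f \o env_sum v w.
  by apply/funext; case.
pose J0 (i : nat_chain) := f \o J i.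
have hJ0 : MI C (f \o u) (@row_of K XB rB 'I_n) (with_first J0 B0).
  move=> m x s t hst.
  have E w : (fun i => with_first J0 B0 (w i) (x i)) = f \o (fun i => with_first J B (w i) (x i)).
    by apply/funext => i; rewrite /with_first /=; case: (x i) => //= b; rewrite fB.
  rewrite !E !fsum; apply: tpeq_trans (tpeq_sym (ftp _ _)) _; apply: tpeq_trans (ftp _ _).
  exact: hJ.
have cc : tpeq C (env_sum c (flat B0)) (env_sum (f \o c') (flat B0)).
  apply: tpeq_trans cB _; rewrite (_ : flat B0 = f \o flat B); first by rewrite fsum; exact: ftp.
  by apply/funext => -[i b]; rewrite /flat /= fB.
have c'p : realizes (f \o c') p.
  by move=> phi pphi; exact: (tpeq_comp (s := inl) cc (Def_pholds phi) (c_p pphi)).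
have ind : indiscernible ((C `|` range (f \o u)) `|` range (f \o c')) (omega_seq J0).
  apply: contrapT => nind; apply: nW.
  exists (C `|` range (f \o u)), (f \o c'), _, nat, J0; split; last split=> //; last split; last
    split; last split; last split=> //.
  - split; first by left.
    apply: (sub_finite_set (B := range (f \o u))); first by move=> a [[]].
    exact/finite_image/finite_finset.
  - exact: infinite_nat.
  - exact: with_first_mutual.
  - move=> phi.
    have cl (a : C `|` \bigcup_(i in [set i | i <> i0]) seq_range (omega_seq (@I i))) :
        exists b : nat * XB + C, val a = match b with inl r => flat B0 r | inr d => val d end.
      have [Ca|[j ji [i [l e]]]] := set_mem (valP a); first by exists (inr (SigSub (mem_set Ca))).
      by exists (inl (i, exist _ (existT _ j l) ji)).
    have [h hh] := choice cl.
    pose g a : ('I_n + nat * XB) + C := match a with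
      | inl l => inl (inl l)
      | inr a => match h a with inl r => inl (inr r) | inr d => inr d end end.
    have E w : env_sum w set_val = env_sum (env_sum w (flat B0)) set_val \o g.
      by apply/funext => -[l|a] //=; have := hh a; rewrite /g; case: (h a).
    rewrite /pholds !E -!holds_rename.
    apply: iff_sym; exact: (tpeqE cc (Def_pholds (frename g phi))).
  - move=> i phi pphi; exact: (ftp _ _ _ (Def_pholds phi) (Jp i _ pphi)).
have hMI : MI C (env_sum (f \o u) (f \o c')) (fun=> tt) J0.
  apply: indiscernible_MI ind; first by move=> a Ca; do 2!left.
  by case=> v; [left; right|right]; exists v.
move=> m x s t hst; have := hMI m x s t hst.
have E w : (fun i => J0 (w i) (x i)) = f \o (fun i => J (w i) (x i)) by [].
rewrite !E !fsum => H; apply: tpeq_trans (ftp _ _) _; apply: tpeq_trans H _.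
exact: tpeq_sym.
Qed.

(** A definable set mentions only finitely many of the parameters [u]. *)
Lemma star_of_failure (nW : ~ witness) (U : Type) (u : U -> M) (B : nat_chain -> XB -> M) (c' :
  'I_n -> M)
    (J : nat_chain -> 'I_n -> M) :
  tpeq C (env_sum c (flat B0)) (env_sum c' (flat B)) -> (forall i, realizes (J i) p) ->
  MI C u (@row_of K XB rB 'I_n) (with_first J B) -> MI C (env_sum u c') (fun=> tt) J.
Proof.
move=> cB Jp hJ m x s t hst; apply: tpeq_fin => r f.
have [F [f1 [g e]]] := factor_sum (fun i => match f i with
  | inl a => inr (inl a) | inr (inl v) => inl v | inr (inr l) => inr (inr l) end).
pose h (i : 'I_#|F|) := f1 (enum_val i).
have hJ' : MI C (u \o h) (@row_of K XB rB 'I_n) (with_first J B).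
  exact (alike_sub (r' := @row_of K XB rB 'I_n) (f := h) (g := id) (fun _ _ r => r) hJ).
have := star_fin nW cB Jp hJ' hst.
pose g' i : 'I_m + ('I_#|F| + 'I_n) := match g i with
  | inl v => inr (inl (enum_rank v)) | inr (inl a) => inl a | inr (inr l) => inr (inr l) end.
move=> /(@tpeq_comp _ _ _ _ _ g').
have E (w : 'I_m -> M) : env_sum w (env_sum (u \o h) c') \o g' =
    env_sum w (env_sum u c') \o f.
  apply/funext => i; have := congr1 (fun k => k i) e; rewrite /g' /h /=.
  by case: (f i) (g i) => [a|[v|l]] [v'|[a'|l']] //= [->]; rewrite ?enum_rankK.
by rewrite !E.
Qed.

Lemma I0_broken : exists m (x : 'I_m -> 'I_(len i0)) (s t : 'I_m -> nat) (S : set ('I_m + 'I_n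
  -> M)),
  [/\ @pateq _ nat_chain nat_chain s t, Def C S,
      S (env_sum (fun a => @I i0 (s a) (x a)) c) & ~ S (env_sum (fun a => @I i0 (t a) (x a)) c)].
Proof.
apply: contrapT => H; apply: (@I_not i0).
apply: (MI_indiscernible (C := C) (u := c)) => // m x s t hst S dS Ss.
apply: contrapT => nSt; apply: H; exists m, x, s, t, S; split=> // a b.
exact: hst.
Qed.

(** The [A j] are consecutive index tuples of one pattern, so the blocks [D j] are indiscernible.
    Along them [V] changes at least once and, by dependence, finitely often; [Phi] is [Phi0] or its
    negation, and the stage starts just before the last change. *)
Lemma stage_zero : exists k (Phi : set ('I_n + 'I_k -> M)), Def C Phi /\
  exists y, stage kap p rB c B0 Phi (@id 'I_k) (fun t : void => match t with end) y.
Proof.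
have [m [x [s [t [S [pat dS Ss nSt]]]]]] := I0_broken.
have sys := mutual_MI I_mut.
pose N := (\max_a maxn (s a) (t a)).+1.
have sN a : s a < N by rewrite ltnS (leq_trans (leq_maxl _ (t a))) // (leq_bigmax_cond (F := fun
  a => maxn (s a) (t a))).
have tN a : t a < N by rewrite ltnS (leq_trans (leq_maxr (s a) _)) // (leq_bigmax_cond (F := fun
  a => maxn (s a) (t a))).
pose V (w : 'I_m -> nat) := S (env_sum (fun a => @I i0 (w a) (x a)) c).
(* [V] holds at [s] and fails at [t], so one of them differs from the block [s] shifted by [N]. *)
have [sg [sgN sg_pat hsg]] : exists sg : 'I_m -> nat, [/\ forall a, sg a < N,
    @pateq _ nat_chain nat_chain s sg & ~ (V sg <-> V (fun a => s a + N * 1))].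
  have [h|h] := pselect (V (fun a => s a + N * 1)).
    by exists t; split=> // -[_ /(_ h)].
  by exists s; split=> // -[/(_ Ss)].
pose A (j : nat) (a : 'I_m) : nat := (if j is 0 then sg a else s a) + N * j.
have Alt j j' a a' : (A j a < A j' a') = (j < j') || (j == j') && (s a < s a').
  have hsg' : (s a < s a') = (sg a < sg a') := sg_pat a a'.
  have lt i i' b b' : i < i' -> A i b < A i' b'.
    move=> ii; have : N * i.+1 <= N * i' by rewrite leq_mul2l ii orbT.
    rewrite mulnS /A; have := sN b; have := sgN b; move: (N * i) (N * i') => n1 n2.
    by case: (i); case: (i'); lia.
  case: (ltngtP j j') => [jj|jj|<-] /=; first exact: lt.
    by apply/negbTE; rewrite -leqNgt; exact/ltnW/lt.
  by rewrite /A ltn_add2r; case: j.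
pose D (j : nat_chain) (a : 'I_m) : M := @I i0 (A j a) (x a).
pose Phi0 (w : 'I_n + 'I_m -> M) := S (w \o (fun a => match a with inl a => inr a | inr l => inl
  l end)).
have dPhi0 : Def C Phi0 by exact: Def_rename.
have PhiE v (w : 'I_m -> M) : Phi0 (env_sum v w) = S (env_sum w v).
  by rewrite /Phi0; congr S; apply/funext; case.
have base (Phi : set ('I_n + 'I_m -> M)) (j0 : nat) : Def C Phi -> Phi (env_sum c (D j0)) ->
    (forall i, ~ Phi (env_sum c (D (j0 + i.+1)))) ->
    exists k (Phi : set ('I_n + 'I_k -> M)), Def C Phi /\
      exists y, stage kap p rB c B0 Phi (@id 'I_k) (fun t : void => match t with end) y.
  move=> dPhi P0 P1; exists m, Phi; split=> //.
  pose y (i : nat_chain) : 'I_m + XB -> M := env_sum (D (j0 + i)) (B0 i).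
  have yMI : MI C (of_void M) (@row_of K XB rB 'I_m) y.
    apply: alike0 => q xx s1 t1 hst.
    pose xx' a : {k : K & 'I_(len k)} := match xx a with inl l => existT _ i0 (x l) | inr b =>
      sval b end.
    pose o (w : 'I_q -> nat) a : nat_chain := match xx a with inl l => A (j0 + w a) l | inr _ =>
      w a end.
    have hst' : rowpat (@projT1 _ _ \o xx') (o s1) (o t1).
      move=> a b; have h1 := hst a b; have h2 := hst b a; move: h1 h2; rewrite /o /xx' /comp.
      case: (xx a) => [l|[u hu]]; case: (xx b) => [l'|[u' hu']] //= h1 h2 e.
      - rewrite /clt /= !Alt !ltn_add2l !eqn_add2l.
        have := h1 erefl; have := h2 erefl; rewrite /clt /= => h2' h1'.
        by rewrite h1' (_ : (s1 a == s1 b) = (t1 a == t1 b)) //; apply/eqP/eqP; lia.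
      - by case: (hu' (esym e)).
      - by apply: h1; rewrite /rB /= e.
    have := alike_gen0 sys hst'.
    have E w : (fun a => row_system I (o w a) (xx' a)) = fun a => y (w a) (xx a).
      by apply/funext => a; rewrite /o /xx' /y; case: (xx a).
    by rewrite !E.
  exists y; split=> //.
  - exact: small_count.
  - have H := alike_sub (r' := @tuple_row_of n K XB rB void) (f := id)
      (g := select (fun t : void => match t with end)) _ yMI.
    by refine (H _) => -[[[]]|b] [[[]]|b'] //= [->].
  - exists c; split=> //; first by rewrite /= addn0.
have [|[f fi hf]|[j Vj hj]|[j Vj hj]] := @alternation_dichotomy (fun j => V (A j)).
- rewrite (_ : A 0 = sg) //; apply/funext => a; by rewrite /A muln0 addn0.
- have DMI : @MI _ _ C _ _ _ nat_chain (of_void M) (fun=> tt) (fun j => D (f j)).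
    apply: alike0 => q xx s1 t1 hst.
    have hst' : rowpat (@projT1 K (fun k => 'I_(len k)) \o (fun a => existT _ i0 (x (xx a))))
        (fun a => A (f (s1 a)) (xx a) : nat_chain) (fun a => A (f (t1 a)) (xx a) : nat_chain).
      move=> a b _; rewrite /clt /= !Alt !(incr_le fi).
      have h1 : (s1 a < s1 b) = (t1 a < t1 b) := hst a b erefl.
      have h2 : (s1 b < s1 a) = (t1 b < t1 a) := hst b a erefl.
      have fI : injective f by move=> i i' e; have := incr_le fi i i'; have := incr_le fi i' i;
        lia.
      by rewrite !(inj_eq fI) h1 (_ : (s1 a == s1 b) = (t1 a == t1 b)) //; apply/eqP/eqP; lia.
    exact: (alike_gen0 sys hst').
  case: (no_alternation kapS M_sat C_small p_dep c_p DMI dPhi0) => i.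
  by rewrite !PhiE; exact: hf.
- by apply: (base Phi0 j dPhi0) => [|i]; rewrite PhiE //; exact: hj.
- by apply: (base _ j (Def_not dPhi0)) => [|i]; rewrite PhiE // => H; exact: (H (hj i)).
Qed.

Lemma witness_exists : NTP2 M -> witness.
Proof.
move=> hNTP2; apply: contrapT => nW.
have star := star_of_failure nW.
have [k [Phi [dPhi [y0 st0]]]] := stage_zero.
have stages N : exists (Rw : finType) (W : Type) (al : 'I_k -> W) (e : Rw -> 'I_n -> W) y,
    #|Rw| = N /\ stage kap p rB c B0 Phi al e y.
  elim: N => [|N [Rw [W [al [e [y [cardR st]]]]]]].
    by exists void, 'I_k, id, (fun t : void => match t with end), y0; split=> //; rewrite
      card_void.
  have [W1 [al1 [e1 [y1 st1]]]] := stage_step kapS M_sat C_small p_dep XB_small c_p dPhi star st.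
  by exists (option Rw), W1, al1, e1, y1; split=> //; rewrite card_option cardR.
apply: (broken_rows_bounded kapS M_sat C_small p_dep hNTP2 (Def_not dPhi)) => N.
have [Rw [W [al [e [y [cardR st]]]]]] := stages N.
have [pt] := carrier_inhabited M.
move: N cardR => _ <-.
(* Rows beyond the cardinality of [Rw] are filled with [pt]. *)
exists (fun t i l => if insub t is Some u then y i (inl (e (enum_val (u : 'I_#|Rw|)) l)) else pt).
exists (fun l => y 1 (inl (al l))).
have tE t (tR : t < #|Rw|) i : (fun l => if insub t is Some u then y i (inl (e (enum_val (u :
  'I_#|Rw|)) l)) else pt) =
    fun l => y i (inl (e (enum_val (Ordinal tR)) l)).
  by apply/funext => l; rewrite insubT.
split.
- have H := alike_sub (r' := @fst 'I_#|Rw| 'I_n) (f := id)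
    (g := fun q : 'I_#|Rw| * 'I_n => inl (enum_val q.1, q.2)) _ (stage_rows st).
  rewrite (_ : (fun i q => _) = fun i => (y i \o select e) \o (fun q : 'I_#|Rw| * 'I_n => inl
    (enum_val q.1, q.2))).
    by refine (H _) => a b /= [] /enum_val_inj.
  by apply/funext => i; apply/funext => -[u l] /=; rewrite valK.
- by move=> t i tR; rewrite tE; exact: stage_p st _ _.
- move=> t tR; rewrite !tE.
  have [h0 h1] := stage_broken st (enum_val (Ordinal tR)).
  split=> //; apply: contrapT => h; apply: h => h; move: h0.
  pose xx (a : 'I_n + 'I_k) : W + XB := match a with
    inl l => inl (e (enum_val (Ordinal tR)) l) | inr l => inl (al l) end.
  (* [Phi] holds at e_0 and a_0, hence at e_1 and a_1 by indiscernibility, whereas it fails at e_0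
     and a_1: the row is broken by a_1. *)
  have hst : rowpat (@row_of K XB rB W \o xx) (fun=> 0 : nat_chain) (fun=> 1 : nat_chain) by [].
  have := alike_gen0 (stage_MI st) hst.
  have E i : (fun a => y i (xx a)) = env_sum (fun l => y i (inl (e (enum_val (Ordinal tR)) l)))
    (fun l => y i (inl (al l))).
    by apply/funext; case.
  by rewrite !E => /(_ _ dPhi) H /H.
Qed.

End Main.

Theorem theorem3p12 (L : language) (T : theory L) (kap : Type)
    (M : structure L)
    (T_complete : complete_theory T)
    (M_monster : monster T kap M)
    (T_NTP2 : NTP2 M)
    (C : set M) (C_small : small kap C)
    (n : nat) (p : set (pformula 'I_n C))
    (p_dep : dependent kap p)
    (K : Type) (i0 : K)
    (c : 'I_n -> M) (c_p : realizes c p)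
    (len : K -> nat) (I : forall i : K, nat -> 'I_(len i) -> M)
    (I_mut : mutually_indiscernible C (fun i => omega_seq (I i)))
    (I_not : forall i, ~ indiscernible (C `|` range c) (omega_seq (I i))) :
  exists (C' : set M) (c' : 'I_n -> M)
         (d : Order.disp_t) (O : orderType d) (J0 : O -> 'I_n -> M),
    (C `<=` C' /\ finite_set (C' `\` C)) /\
    realizes c' p /\
    infinite_set [set: O] /\
    mutually_indiscernible C'
      (replace_at i0 (OSeq J0) (fun i => omega_seq (I i))) /\
    same_type
      (C `|` \bigcup_(i in [set i | i <> i0]) seq_range (omega_seq (I i)))
      c' c /\
    ~ indiscernible (C' `|` range c') (OSeq J0) /\
    (forall t : O, realizes (J0 t) p).
Proof.
have [_ kapS _ M_sat M_hom] := M_monster.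
exact: (witness_exists kapS M_sat M_hom C_small p_dep i0 c_p I_mut I_not T_NTP2).
Qed.
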